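(* Let $T>0$, $\nu\in\mathcal{P}(\mathbb{T}^d)$, let $L:\mathbb{T}^d\times\mathbb{R}^d\to[0,\infty)$ be a cost function and $\sigma:[0,T)\to\mathbb{R}$ a smooth bounded function. Assume that there exists $C\ge0$ such that $L(x,\alpha)\le C(1+|\alpha|^2)$ for all $x\in\mathbb{T}^d$, $\alpha\in\mathbb{R}^d$, and that $$\sigma(t)\sim K(T-t)^\gamma\quad\text{as }t\to T$$ for some $K\ne0$, $\gamma>0$. Then for all $t<T$, $\mu\in\mathcal{P}(\mathbb{T}^d)$, $w\in\mathbb{T}^d$, the value function $U$ of the stochastic optimal transport problem with target $(\tau_{W_T})_\#\nu$, where $dW_t=\sigma(t)dB_t$, satisfies $U(t,\mu,w)<\infty$.
   Context: $\mathbb{T}^d$ is the $d$-dimensional torus, $\mathcal{P}(\mathbb{T}^d)$ its Borel probability measures with the weak topology; $\tau_h(x)=x+h$ and $_\#$ denotes push-forward. $(B_t)$ is a standard Brownian motion ($d$-dimensional) on a filtered probability space $(\Omega,\mathcal{A},\mathbb{P},(\mathcal{F}_t)_{t\ge0})$. For $t<T$, $\mu,\nu'\in\mathcal{P}(\mathbb{T}^d)$, $\mathcal{A}dm(t,\mu,\nu')$ is the set of pairs $(\psi,m)$ with $m\in\mathcal{C}([t,T],\mathcal{P}(\mathbb{T}^d))$, $m_t=\mu$, $m_T=\nu'$, $\psi:[t,T]\times\mathbb{T}^d\to\mathcal{P}(\mathbb{R}^d)$ measurable, and for all $\varphi\in\mathcal{C}^1([t,T]\times\mathbb{T}^d,\mathbb{R})$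 $$\int\varphi(T,x)\nu'(dx)-\int\varphi(t,x)\mu(dx)=\int_t^T\!\!\int_{\mathbb{T}^d}\Big(\partial_t\varphi(s,x)+\int_{\mathbb{R}^d}z\,\psi_s(x,dz)\cdot\nabla_x\varphi(s,x)\Big)m_s(dx)ds.$$ The value function is $$U(t,\mu,w)=\inf_{(\psi,m)}\mathbb{E}\Big[\int_t^T\int_{\mathbb{T}^d\times\mathbb{R}^d}L(x,z)\psi_s(x,dz)m_s(dx)ds\,\Big|\,W_t=w\Big],$$ the infimum being over random pairs $(\psi,m):\Omega\to\cup_{\nu'}\mathcal{A}dm(t,\mu,\nu')$, adapted to $(\mathcal{F}_s)_{s\ge t}$, with $m_T=(\tau_{W_T})_\#\nu$ $\mathbb{P}$-a.s. on $\{W_t=w\}$. *)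

(* Defs.v *)
From HB Require Import structures.
From mathcomp Require Import all_boot all_order all_algebra.
From mathcomp Require Import ring_quotient.
From mathcomp Require Import all_classical all_reals all_analysis.

Set Implicit Arguments.
Unset Strict Implicit.
Unset Printing Implicit Defensive.

Import Order.TTheory GRing.Theory Num.Theory.
Import numFieldNormedType.Exports.

Local Open Scope classical_set_scope.
Local Open Scope ring_scope.

Definition int_lattice (R : realType) (d : nat) : {pred 'rV[R]_d} :=
  fun v => [forall i, v ord0 i \is a Num.int].

Lemma int_lattice_zmod_closed (R : realType) (d : nat) :
  zmod_closed (@int_lattice R d).
Proof.
split=> [|u v /forallP uZ /forallP vZ]; apply/forallP => i; rewrite !mxE.
  exact: rpred0.
exact: rpredB.
Qed.

HB.instance Definition _ (R : realType) (d : nat) :=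
  GRing.isZmodClosed.Build 'rV[R]_d (@int_lattice R d)
    (@int_lattice_zmod_closed R d).

(* [torus] carries the quotient topology only; the group law is the one of the
   algebraic quotient, which has the same carrier. *)
Definition torus (R : realType) (d : nat) : ptopologicalType :=
  quotient_topology {ideal_quot (@int_lattice R d)}.

Definition torus_proj (R : realType) (d : nat) (v : 'rV[R]_d) : torus R d :=
  \pi_({ideal_quot (@int_lattice R d)})%qT v.

Definition torus_repr (R : realType) (d : nat) (x : torus R d) : 'rV[R]_d :=
  repr (x : {ideal_quot (@int_lattice R d)}).

Definition translate (R : realType) (d : nat) (h x : torus R d) : torus R d :=
  (x : {ideal_quot (@int_lattice R d)}) + h.

(* Borel measurable structures on the torus and on R^d. *)
Notation Torus R d := (g_sigma_algebraType (@open (torus R d))).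
Notation Rd R d := (g_sigma_algebraType (@open 'rV[R]_d)).

Definition enorm (R : realType) (d : nat) (v : 'rV[R]_d) : R :=
  Num.sqrt (\sum_i v ord0 i ^+ 2).

Section test_functions.
Variables (R : realType) (d : nat).
Implicit Types phi : R -> torus R d -> R.

Definition dt phi (s : R) (x : torus R d) : R := derive1 (phi ^~ x) s.

Definition dx phi (s : R) (i : 'I_d) (v : 'rV[R]_d) : R :=
  'D_(delta_mx ord0 i) (phi s \o @torus_proj R d) v.

(* The lift [phi s \o torus_proj] is periodic, so the choice of the
   representative of [x] is irrelevant. *)
Definition grad phi (s : R) (x : torus R d) : 'rV[R]_d :=
  \row_i dx phi s i (torus_repr x).

(* C^1([t, T] * torus) is understood as the set of restrictions to [t, T] of
   the functions that are C^1 on R * torus. *)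
Definition C1_test phi : Prop :=
  [/\ forall s x, derivable (phi ^~ x) s 1,
      continuous (fun p : R * torus R d => dt phi p.1 p.2),
      forall s i v, derivable (phi s \o @torus_proj R d) v (delta_mx ord0 i) &
      forall i, continuous (fun p : R * 'rV[R]_d => dx phi p.1 i p.2)].

End test_functions.

Section admissible_pairs.
Variables (R : realType) (d : nat).
Local Notation PT := (probability (Torus R d) R).
Local Notation PRd := (probability (Rd R d) R).
Implicit Types (mu nu : PT) (m : R -> PT) (psi : R -> torus R d -> PRd).

Definition weakly_continuous (t T : R) m : Prop :=
  forall f : torus R d -> R, continuous f ->
    {within `[t, T], continuous (fun s => \int[m s]_x f x)}.

Definition eq_measure mu nu : Prop := forall A, measurable A -> mu A = nu A.

(* The third clause is the absolute convergence of the right-hand side of the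
   fourth one, without which that integral is not defined. *)
Definition Adm (t T : R) mu nu' psi m : Prop :=
  [/\ [/\ weakly_continuous t T m, eq_measure (m t) mu & eq_measure (m T) nu'],
      measurable_fun (`[t, T] `*` [set: Torus R d])
        (fun p : R * Torus R d => psi p.1 p.2 : pprobability (Rd R d) R),
      (\int[lebesgue_measure]_(s in `[t, T])
         \int[m s]_x \int[psi s x]_z (enorm (z : 'rV[R]_d))%:E < +oo)%E &
      forall phi, C1_test phi ->
        \int[nu']_x phi T x - \int[mu]_x phi t x =
        \int[lebesgue_measure]_(s in `[t, T]) \int[m s]_x
          (dt phi s x +
           \sum_i (\int[psi s x]_z (z : 'rV[R]_d) ord0 i) * grad phi s x ord0 i)].

End admissible_pairs.

Section stochastic_basis.
Context {R : realType} {d : nat} {dO : measure_display}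
  {Omega : measurableType dO}.
Variable P : probability Omega R.
Implicit Types (F : R -> set (set Omega)) (B Y : R -> Omega -> 'rV[R]_d).

Definition filtration F : Prop :=
  [/\ forall s, 0 <= s -> sigma_algebra [set: Omega] (F s),
      forall s, 0 <= s -> F s `<=` measurable &
      forall s r, 0 <= s -> s <= r -> F s `<=` F r].

Definition adapted (D : set R) F Y : Prop :=
  forall s, D s ->
    measurable_fun [set: g_sigma_algebraType (F s)] (Y s : _ -> Rd R d).

Definition brownian_motion F B : Prop :=
  [/\ adapted [set s | 0 <= s] F B,
      {ae P, forall w, B 0 w = 0},
      {ae P, forall w, {within [set s | 0 <= s], continuous (B ^~ w)}},
      forall s r (G : set Omega) (A : set (Rd R d)),
        0 <= s -> s <= r -> F s G -> measurable A ->
        P (G `&` [set w | A (B r w - B s w)%R]) =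
        (P G * P [set w | A (B r w - B s w)%R])%E &
      forall s r (A : 'I_d -> set R),
        0 <= s -> s < r -> (forall i, measurable (A i)) ->
        P [set w | forall i, A i ((B r w - B s w)%R ord0 i)] =
        (\prod_i normal_prob 0 (Num.sqrt (r - s)) (A i))%E].

(* The step function with value [c k] on ]p k, p k.+1], k < n, and its
   stochastic integral. *)
Definition step_fun (n : nat) (p c : nat -> R) (r : R) : R :=
  \sum_(k < n) c k * \1_(`]p k, p k.+1]) r.

Definition step_integral B (n : nat) (p c : nat -> R) (w : Omega) : 'rV[R]_d :=
  \sum_(k < n) c k *: (B (p k.+1) w - B (p k) w).

(* [X] is the Ito integral of the deterministic integrand [sigma] over [a, b]:
   the L^2(P) limit of the integrals of step functions that converge to [sigma]
   in L^2([a, b]). By the Ito isometry the limit does not depend on the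
   approximating sequence. *)
Definition is_ito_integral B (sigma : R -> R) (a b : R)
    (X : Omega -> 'rV[R]_d) : Prop :=
  exists (n : nat -> nat) (p c : nat -> nat -> R),
  [/\ forall j, p j 0%N = a /\ p j (n j) = b,
      forall j k, (k < n j)%N -> p j k <= p j k.+1,
      (\int[lebesgue_measure]_(r in `[a, b])
        ((sigma r - step_fun (n j) (p j) (c j) r) ^+ 2)%:E @[j --> \oo]
        --> 0)%E &
      (\int[P]_w (enorm (X w - step_integral B (n j) (p j) (c j) w) ^+ 2)%:E
        @[j --> \oo] --> 0)%E].

(* [W] solves dW = sigma dB on [t, T], projected on the torus, and starts from
   [w0] at time [t]. *)
Definition diffusion_from F B (sigma : R -> R) (t T : R) (w0 : torus R d)
    (W : R -> Omega -> torus R d) : Prop :=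
  exists Y : R -> Omega -> 'rV[R]_d,
  [/\ adapted `[t, T] F Y,
      {ae P, forall w, {within `[t, T], continuous (Y ^~ w)}},
      forall a b, t <= a -> a <= b -> b <= T ->
        is_ito_integral B sigma a b (fun w => Y b w - Y a w),
      {ae P, forall w, Y t w = 0} &
      {ae P, forall w, forall s, s \in `[t, T] ->
        W s w = translate (torus_proj (Y s w)) w0}].

End stochastic_basis.

Section value_function.
Context {R : realType} {d : nat} {dO : measure_display}
  {Omega : measurableType dO}.
Variables (P : probability Omega R) (F : R -> set (set Omega)).
Variables (L : torus R d -> 'rV[R]_d -> R) (T : R).
Variable nu : probability (Torus R d) R.
Variable W : R -> Omega -> torus R d.
Local Notation PT := (probability (Torus R d) R).
Local Notation PRd := (probability (Rd R d) R).
Implicit Types (psi : Omega -> R -> torus R d -> PRd) (m : Omega -> R -> PT).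

Definition random_pair (t : R) psi m : Prop :=
  measurable_fun ([set: Omega] `*` (`[t, T] `*` [set: Torus R d]))
    (fun p : Omega * (R * Torus R d) =>
       psi p.1 p.2.1 p.2.2 : pprobability (Rd R d) R) /\
  measurable_fun ([set: Omega] `*` `[t, T])
    (fun p : Omega * R => m p.1 p.2 : pprobability (Torus R d) R).

Definition adapted_pair (t : R) psi m : Prop :=
  forall s, s \in `[t, T] ->
  measurable_fun [set: g_sigma_algebraType (F s) * Torus R d]
    (fun p : g_sigma_algebraType (F s) * Torus R d =>
       psi p.1 s p.2 : pprobability (Rd R d) R) /\
  measurable_fun [set: g_sigma_algebraType (F s)]
    (fun w => m w s : pprobability (Torus R d) R).

(* As usual for random objects, membership in the set of admissible pairs is
   required almost surely. *)
Definition control (t : R) (mu : PT) psi m : Prop :=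
  [/\ random_pair t psi m, adapted_pair t psi m,
      {ae P, forall w, exists nu' : PT, Adm t T mu nu' (psi w) (m w)} &
      {ae P, forall w, forall A : set (Torus R d), measurable A ->
         m w T A = pushforward nu (translate (W T w) : Torus R d -> Torus R d) A}].

Definition cost (t : R) psi m : \bar R :=
  (\int[P]_w \int[lebesgue_measure]_(s in `[t, T]) \int[m w s]_x
     \int[psi w s x]_z (L x z)%:E)%E.

(* The value at (t, mu, w0) is obtained when [W] starts from [w0] at time [t]
   (see [diffusion_from]); the event W_t = w0 then has probability 1 and the
   conditional expectation is the expectation. *)
Definition value (t : R) (mu : PT) : \bar R :=
  ereal_inf [set c | exists psi m, control t mu psi m /\ c = cost t psi m].

End value_function.

Definition smooth_on (R : realType) (D : set R) (f : R -> R) : Prop :=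
  exists g : nat -> R -> R,
    (forall x, D x -> g 0%N x = f x) /\
    (forall n x, D x ->
       (g n y - g n x) / (y - x) @[y --> within D x^'] --> g n.+1 x).

(* Main.v *)
(* The control is built explicitly, by reducing to a deterministic transport that
   absorbs the noise through a translation.

   Deterministic part: under Q = mu x nu, let a particle move on a straight line
   from x to y + w0, for (x, y) of law Q, and let v(s, .) be the conditional
   expectation of its velocity given its position at time s; it is bounded, and
   the laws of the positions solve the continuity equation with velocity v. If
   all particles are moreover translated by a path A with derivative a, the
   translated laws solve the continuity equation with the velocity
   v(s, x - A_s) + a_s, and they end at the law nu translated by w0 + A_T.

   Random part: W_s = w0 + Y_s with Y_s = int_t^s sigma dB, so A must be an
   adapted path from 0 to Y_T. On the grid tau_n = T - (T - t) / 2^n let A go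
   linearly from Y(tau_(n-1)) to Y(tau_n) during [tau_n, tau_(n+1)]. Since
   |sigma(s)| <= C (T - s)^gamma, the Ito isometry gives
   E |Y(tau_n) - Y(tau_(n-1))|^2 <= C' 4^(-gamma n) (tau_(n+1) - tau_n), so that
   E int |a|^2 is dominated by a convergent geometric series; this bounds the cost
   by the quadratic growth of L. *)
From HB Require Import structures.
Require Import Defs.
From mathcomp Require Import all_boot all_order all_algebra.
From mathcomp Require Import ring_quotient.
From mathcomp Require Import all_classical all_reals all_analysis.
From mathcomp Require Import measurable_realfun.
From mathcomp Require Import ring lra zify.
Set Implicit Arguments.
Unset Strict Implicit.
Unset Printing Implicit Defensive.
Import Order.TTheory GRing.Theory Num.Theory.
Import numFieldNormedType.Exports.
Local Open Scope classical_set_scope.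
Local Open Scope ring_scope.

(** * The Borel structure of the torus *)

(** The obstacle is that the target is revealed only at time [T]: aiming at [Y T] from the start is
    not adapted, and a path that ends at [Y T] has to keep correcting up to the last moment, with a
    speed that may blow up there. A delay of one cell makes the path adapted. It stays cheap because
    consecutive dyadic cells have comparable lengths: an increment whose variance is proportional to
    one cell is paid over a cell half as long. The energy of a cell is then at most a constant times
    the squared size of [sigma] on the cell before, and [gamma > 0] makes these terms summable.

    The field [v] is found once, before any noise is drawn. Randomness enters only through the path
    [A w] and its slope [a w], so joint measurability and adaptedness of the control reduce to those
    of two vector-valued processes. Conditioning on time and position makes the velocity a function
    of position even where trajectories cross, so that Dirac masses suffice for [psi]. Since [a] may
    be unbounded near [T], the continuity equation is first established cell by cell and then
    continued to [T] by a limit. *)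

Lemma continuous_measurable_borel (X Y : ptopologicalType) (f : X -> Y) :
  continuous f ->
  measurable_fun [set: g_sigma_algebraType (@open X)]
    (f : g_sigma_algebraType (@open X) -> g_sigma_algebraType (@open Y)).
Proof.
move=> cf.
apply: (@measurability _ _ _ (g_sigma_algebraType (@open Y)) _ _ (@open Y)) => //.
move=> _ [U oU <-]; rewrite setTI; apply: sub_gen_smallest.
by move/continuousP: cf; apply.
Qed.

Lemma continuous_measurable_real (R : realType) (X : ptopologicalType) (f : X -> R) :
  continuous f ->
  measurable_fun [set: g_sigma_algebraType (@open X)]
    (f : g_sigma_algebraType (@open X) -> R).
Proof.
move=> cf; apply: (measurability _ (RGenOInfty.measurableE R)).
move=> _ [_ [x ->] <-]; rewrite setTI; apply: sub_gen_smallest.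
by move/continuousP: cf; apply; exact: interval_open.
Qed.

Section row_vectors.
Context {R : realType} {d : nat}.

Lemma measurable_coord (i : 'I_d) :
  measurable_fun [set: Rd R d] (fun v : Rd R d => (v : 'rV[R]_d) ord0 i).
Proof. by apply: continuous_measurable_real; exact: coord_continuous. Qed.

(** Rational centres and radii 1/(k+1) give a countable base of the topology. As [Rd] is generated
    by the open sets, this is what reduces Borel measurability of a vector to that of its
    coordinates. *)
Let box (k : 'rV[rat]_d * nat) : set 'rV[R]_d :=
  [set y | forall i, `|ratr (k.1 ord0 i) - y ord0 i| < k.2.+1%:R^-1].

Let open_rV_bigcup (U : set 'rV[R]_d) : open U ->
  U = \bigcup_(k in [set k | box k `<=` U]) box k.
Proof.
move=> oU; apply/seteqP; split => [x Ux|x [k]]; last by apply.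
have /nbhs_ballP[e /= e0 eU] : nbhs x U by exact: open_nbhs_nbhs.
(* The radius is below e/2, so every point of a box around [x] is within [e] of [x]. *)
pose n := Num.truncn (2 / e).
have ne : (n.+1%:R : R)^-1 < e / 2.
  rewrite -[e / 2]invrK ltf_pV2 ?posrE// ?invr_gt0 ?divr_gt0// invf_div.
  exact: truncnS_gt.
have /choice[q hq] : forall i, exists q : rat, `|ratr q - x ord0 i| < n.+1%:R^-1.
  have : 0 < (n.+1%:R : R)^-1 by rewrite invr_gt0.
  move: ne; set a := _^-1 => ne a0 i.
  have [|q] := @rat_in_itvoo R (x ord0 i - a) (x ord0 i + a); first by lra.
  rewrite in_itv /= => /andP[q1 q2]; exists q.
  by rewrite ltr_norml; apply/andP; split; lra.
exists (\row_i q i, n) => /=; rewrite /box /=; move: ne hq; set a := _^-1 => ne hq.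
  move=> y /= hy; apply: eU; split => // k i; rewrite ord1 /ball /=.
  have := hq i; have := hy i; rewrite mxE !ltr_norml => /andP[? ?] /andP[? ?].
  by apply/andP; split; lra.
by move=> i; rewrite mxE.
Qed.

Lemma measurable_fun_rV d' (T : measurableType d') (D : set T)
    (f : T -> 'rV[R]_d) :
  (forall i, measurable_fun D (fun x => f x ord0 i)) ->
  measurable_fun D (f : T -> Rd R d).
Proof.
move=> mf mD; move: (mD).
apply: (@measurability _ _ _ (Rd R d) _ _ (@open (matrix R 1 d))) => //.
move=> _ [U oU <-]; rewrite [X in f @^-1` X](@open_rV_bigcup U oU) preimage_bigcup setI_bigcupr.
rewrite bigcup_mkcond; apply: countable_bigcupT_measurable.
  exact: countableP.
move=> k; case: ifPn => // _.
rewrite (_ : _ `&` _ = D `&` \bigcap_(i in [set: 'I_d]) (D `&` (fun x => f x ord0 i) @^-1`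
   [set y : R | `|ratr (k.1 ord0 i) - y| < k.2.+1%:R^-1])); last first.
  apply/seteqP; split => x /= [Dx h]; split => // i; first by split => //; exact: h.
  by have [] := h i I.
apply: measurableI => //; apply: fin_bigcap_measurable => // i _.
apply: mf => //; apply: open_measurable.
rewrite (_ : mkset _ = ball (ratr (k.1 ord0 i) : R) k.2.+1%:R^-1) //.
by apply: ball_open; rewrite invr_gt0.
Qed.

Lemma measurable_fun_rVP d' (T : measurableType d') (D : set T)
    (f : T -> 'rV[R]_d) : measurable_fun D (f : T -> Rd R d) <->
  (forall i, measurable_fun D (fun x => f x ord0 i)).
Proof.
split; last exact: measurable_fun_rV.
move=> mf i; exact: (measurableT_comp (measurable_coord i) mf).
Qed.

End row_vectors.

Section torus_borel.
Context {R : realType} {d : nat}.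
Local Notation pi := (@torus_proj R d).

Lemma torus_proj_eq (u v : 'rV[R]_d) :
  (pi u = pi v) <-> (forall i, u ord0 i - v ord0 i \is a Num.int).
Proof.
have E := @Quotient.idealrBE _ (@int_lattice R d) u v.
split => [h i|h].
  have /forallP/(_ i) : u - v \in @int_lattice R d by rewrite E; apply/eqP; exact: h.
  by rewrite !mxE.
have : u - v \in @int_lattice R d by apply/forallP => i; rewrite !mxE.
by rewrite E => /eqP.
Qed.

Lemma torus_projK (x : torus R d) : pi (torus_repr x) = x.
Proof. exact: reprK. Qed.

Lemma torus_projD (u v : 'rV[R]_d) : translate (pi v) (pi u) = pi (u + v).
Proof. by rewrite /translate /torus_proj; rewrite !piE. Qed.

Lemma continuous_torus_proj : continuous pi.
Proof. exact: pi_continuous. Qed.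

Definition fract (x : R) : R := x - (Num.floor x)%:~R.

Lemma fract_itv x : 0 <= fract x < 1.
Proof.
by have /andP[] := floor_itv x; rewrite intrD /fract => ? ?; apply/andP; split; lra.
Qed.

Lemma fractD_int x y : x - y \is a Num.int -> fract x = fract y.
Proof.
move=> xy; rewrite /fract -[x in LHS](subrK y) floorDzr// intrD.
have -> : (Num.floor (x - y))%:~R = x - y by apply/eqP; rewrite -intrEfloor.
lra.
Qed.

(** The representative [torus_repr] is an arbitrary choice with no measurability attached. Reduction
    to [0, 1[^d gives a Borel section of the projection, and a bounded one: the bound on the
    transport velocity comes from it. *)
Definition torus_rep (x : torus R d) : 'rV[R]_d :=
  \row_i fract (torus_repr x ord0 i).

Lemma torus_repK x : pi (torus_rep x) = x.
Proof.
rewrite -[RHS]torus_projK; apply/torus_proj_eq => i; rewrite mxE /fract.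
by rewrite addrAC subrr add0r rpredN rpred_int.
Qed.

Lemma torus_rep_itv x i : 0 <= torus_rep x ord0 i < 1.
Proof. by rewrite mxE fract_itv. Qed.

Lemma torus_rep_proj v i : torus_rep (pi v) ord0 i = fract (v ord0 i).
Proof.
rewrite mxE; apply: fractD_int.
by have /torus_proj_eq := torus_projK (pi v); exact.
Qed.

Lemma measurable_torus_proj :
  measurable_fun [set: Rd R d] (pi : Rd R d -> Torus R d).
Proof. apply: continuous_measurable_borel; exact: continuous_torus_proj. Qed.

(** [fract] is discontinuous only at the integers, where it vanishes. For [c >= 0] these points are
    excluded, and between two integers the condition describes an open interval. *)
Lemma open_fract_gt (c : R) : 0 <= c -> open [set x | c < fract x].
Proof.
move=> c0; rewrite (_ : mkset _ =
   \bigcup_(k in [set: int]) `]k%:~R + c, k%:~R + 1[%classic); last first.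
  apply/seteqP; split => x /=.
    move=> cx; exists (Num.floor x) => //=; rewrite in_itv /=.
    have /andP[] := fract_itv x.
    by move: cx; rewrite /fract => ? ? ?; apply/andP; split; lra.
  move=> [k _] /=; rewrite in_itv /= => /andP[h1 h2].
  have /eqP -> : fract x == x - k%:~R.
    rewrite /fract (_ : Num.floor x = k)//; apply/eqP; rewrite floor_eq intrD.
    by apply/andP; split; lra.
  lra.
by apply: bigcup_open => k _; exact: interval_open.
Qed.

Lemma measurable_torus_rep :
  measurable_fun [set: Torus R d] (torus_rep : Torus R d -> Rd R d).
Proof.
apply: measurable_fun_rV => i; apply: (measurability _ (RGenOInfty.measurableE R)).
move=> _ [_ [c ->] <-]; rewrite setTI.
have [c0|c0] := ltP c 0.
  rewrite (_ : _ @^-1` _ = setT) //; apply/seteqP; split => // x _ /=.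
  by rewrite in_itv /= andbT; have /andP[h _] := torus_rep_itv x i; lra.
(* A set is open in the torus when its lift to R^d is open, and the lift of this one is read on a
   single coordinate. *)
apply: sub_gen_smallest; rewrite /open /= /quotient_open.
rewrite (_ : _ @^-1` _ = (fun v : 'rV[R]_d => v ord0 i) @^-1` [set x | c < fract x]).
  by have /continuousP := @coord_continuous R 1 d ord0 i; apply; exact: open_fract_gt.
by apply/seteqP; split => v /=; rewrite in_itv /= andbT torus_rep_proj.
Qed.

End torus_borel.

(** * Integrals, laws and conditional expectations *)

(* No measurability is needed, since the integral of a nonnegative function is
   a supremum over the simple functions below it. *)
Lemma le_integral_ge0 d (T : measurableType d) (R : realType)
    (m : {measure set T -> \bar R}) (D : set T) (f g : T -> \bar R) :
  (forall x, D x -> 0 <= f x)%E -> (forall x, D x -> f x <= g x)%E ->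
  (\int[m]_(x in D) f x <= \int[m]_(x in D) g x)%E.
Proof.
move=> f0 fg; have g0 x : D x -> (0 <= g x)%E.
  by move=> Dx; exact: le_trans (f0 x Dx) (fg x Dx).
rewrite !ge0_integralE//; apply: le_ereal_sup => _ /= [h hf <-]; exists h => //.
move=> x; apply: (le_trans (hf x)); rewrite !patchE; case: ifPn => // /set_mem.
exact: fg.
Qed.

Lemma integral_probability_cst d (T : measurableType d) (R : realType)
    (P : probability T R) (c : R) : (\int[P]__ c%:E = c%:E)%E.
Proof. by rewrite integral_cst//= probability_setT mule1. Qed.

Section integrable_EFin.
Context d (T : measurableType d) (R : realType).
Variables (m : {measure set T -> \bar R}) (D : set T).
Hypothesis mD : measurable D.
Implicit Types f g : T -> R.

Lemma integrable_EFinD f g : m.-integrable D (EFin \o f) ->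
  m.-integrable D (EFin \o g) -> m.-integrable D (EFin \o (fun x => f x + g x)).
Proof. by move=> intf intg; exact: (integrableD mD intf intg). Qed.

Lemma integrable_EFinZl (k : R) f : m.-integrable D (EFin \o f) ->
  m.-integrable D (EFin \o (fun x => k * f x)).
Proof. by move=> intf; exact: (integrableZl mD k intf). Qed.

Lemma integrable_EFin_sum (I : finType) (f : I -> T -> R) :
  (forall i, m.-integrable D (EFin \o f i)) ->
  m.-integrable D (EFin \o (fun x => \sum_i f i x)).
Proof.
move=> intf; have := integrable_sum mD (P := xpredT) (index_enum I) (fun i _ => intf i).
by apply: eq_integrable => // x _; rewrite /= sumEFin.
Qed.

Lemma Rintegral_sum (I : finType) (f : I -> T -> R) :
  (forall i, m.-integrable D (EFin \o f i)) ->
  \int[m]_(x in D) (\sum_i f i x) = \sum_i \int[m]_(x in D) f i x.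
Proof.
move=> intf; rewrite /Rintegral.
under eq_integral do rewrite -sumEFin.
rewrite (integral_sum mD intf).
by rewrite -sum_fine// => i _; exact: (integrable_fin_num mD (intf i)).
Qed.

End integrable_EFin.

Lemma integrable_cst_lty d (T : measurableType d) (R : realType)
    (m : {measure set T -> \bar R}) (D : set T) (k : R) :
  measurable D -> (m D < +oo)%E -> m.-integrable D (EFin \o cst k).
Proof.
move=> mD Dlty; apply: measurable_bounded_integrable => //.
by exists `|k|; split => // e /ltW ke x _.
Qed.

Section law.
Context d d' (T : measurableType d) (S : measurableType d') (R : realType).
Variables (P : probability T R) (X : T -> S).

Definition law (mX : measurable_fun [set: T] X) : probability S R :=
  distribution P (HB.pack X (isMeasurableFun.Build _ _ _ _ X mX)).

Lemma lawE (mX : measurable_fun [set: T] X) A : law mX A = P (X @^-1` A).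
Proof. by []. Qed.

Lemma ge0_integral_law (mX : measurable_fun [set: T] X) (f : S -> \bar R) :
  measurable_fun [set: S] f -> (forall y, 0 <= f y)%E ->
  (\int[law mX]_y f y = \int[P]_x f (X x))%E.
Proof. by move=> mf f0; rewrite ge0_integral_pushforward. Qed.

Lemma integral_law (mX : measurable_fun [set: T] X) (f : S -> \bar R) :
  measurable_fun [set: S] f -> P.-integrable [set: T] (f \o X) ->
  (\int[law mX]_y f y = \int[P]_x f (X x))%E.
Proof. by move=> mf intf; rewrite integral_pushforward. Qed.

Lemma Rintegral_law (mX : measurable_fun [set: T] X) (f : S -> R) :
  measurable_fun [set: S] f -> P.-integrable [set: T] (EFin \o f \o X) ->
  \int[law mX]_y f y = \int[P]_x f (X x).
Proof.
move=> mf intf; rewrite /Rintegral (integral_law _ (f := EFin \o f))//.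
exact/measurable_EFinP.
Qed.

End law.

Section measurable_pprobability.
Context d d' (T : measurableType d) (S : measurableType d') (R : realType).

Lemma measurable_fun_pprobability (D : set T) (k : T -> probability S R) :
  (forall A, measurable A -> measurable_fun D (fun x => k x A)) ->
  measurable_fun D (k : T -> pprobability S R).
Proof.
move=> mk mD; move: (mD).
apply: (measurability (@pset _ _ _ : set (set (pprobability S R)))) => //.
move=> _ [_ [r r01] [A mA <-] <-]; have := mk A mA mD `]-oo, r%:E[%classic.
by rewrite preimage_itvNyo /mset; apply; exact: emeasurable_itv.
Qed.

Lemma measurable_fun_dirac_comp (D : set T) (v : T -> S) :
  measurable_fun D v ->
  measurable_fun D ((fun x => \d_(v x)%R) : T -> pprobability S R).
Proof.
move=> mv; apply: (measurable_fun_pprobability (k := fun x => \d_(v x)%R)) => A mA.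
by have := measurableT_comp (measurable_fun_dirac (R := R) mA) mv.
Qed.

End measurable_pprobability.

(** The mass of a set is the [Q]-measure of a section of the joint preimage, hence measurable in the
    parameter. With the sigma-algebra [F s] on the parameter space, this becomes a statement of
    adaptedness. *)
Lemma measurable_fun_law d1 d2 d3 (T : measurableType d1) (Z : measurableType d2)
    (S : measurableType d3) (R : realType) (Q : probability Z R)
    (g : T -> Z -> S) (mg : forall x, measurable_fun [set: Z] (g x)) :
  measurable_fun [set: T * Z] (fun p => g p.1 p.2) ->
  measurable_fun [set: T] ((fun x => law Q (mg x)) : T -> pprobability S R).
Proof.
move=> mg2; apply: (measurable_fun_pprobability (k := fun x => law Q (mg x))).
move=> A mA.
rewrite (_ : (fun _ => _) = (fun x => Q (xsection ((fun p => g p.1 p.2) @^-1` A) x))).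
  by apply: measurable_fun_xsection; rewrite -[X in measurable X]setTI; exact: mg2.
by apply/funext => x; rewrite lawE; congr (Q _); rewrite xsectionE.
Qed.

Section finite_measure_of.
Context d (T : measurableType d) (R : realType).
Variable m : {measure set T -> \bar R}.

(** An alias that carries the proof of finiteness, so that a measure known to be finite only through
    such a proof can enter the Radon-Nikodym theorem. *)
Definition finite_measure_of (mfin : fin_num_fun m) : set T -> \bar R := m.

HB.instance Definition _ (mfin : fin_num_fun m) :=
  Measure.copy (finite_measure_of mfin) m.

HB.instance Definition _ (mfin : fin_num_fun m) :=
  Measure_isFinite.Build _ _ _ (finite_measure_of mfin) mfin.

End finite_measure_of.

Lemma bounded_integrable d (T : measurableType d) (R : realType)
    (m : {finite_measure set T -> \bar R}) (D : set T) (f : T -> R) (c : R) :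
  measurable D -> measurable_fun D f -> (forall x, D x -> `|f x| <= c) ->
  m.-integrable D (EFin \o f).
Proof.
move=> mD mf fc; apply: measurable_bounded_integrable => //.
  by rewrite ltey_eq fin_num_measure.
exists c; split; first exact: num_real.
by move=> e ce x Dx; apply: le_trans (ltW ce); exact: fc.
Qed.

Section conditional_expectation.
Local Open Scope ereal_scope.
Context d d' (T : measurableType d) (S : measurableType d') (R : realType).
Variables (P : probability T R) (X : T -> S).
Hypothesis mX : measurable_fun [set: T] X.

(** The measure f dP is absolutely continuous with respect to [P], and its Radon-Nikodym derivative
    is a.e. [f] because both have the same integral over every measurable set. *)
Lemma integral_density (f : T -> R) (intf : P.-integrable [set: T] (EFin \o f))
    (f0 : forall A, 0 <= induced_charge intf A) (g : T -> \bar R) :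
  (forall x, (0 <= f x)%R) -> (forall x, 0 <= g x) -> measurable_fun [set: T] g ->
  \int[measure_of_charge (induced_charge intf) f0]_x g x =
  \int[P]_x (g x * (f x)%:E).
Proof.
move=> f_ge0 g0 mg; pose m : {measure set T -> \bar R} := measure_of_charge _ f0.
have fin : fin_num_fun m by move=> A mA; exact: fin_num_measure.
pose n : {finite_measure set _ -> \bar R} := finite_measure_of fin.
have nP : n `<< P.
  apply/null_content_dominatesP => A mA PA0.
  by apply: (null_set_integral mA _ PA0); exact/measurable_funTS/(measurable_int _ intf).
rewrite -[LHS]/(\int[n]_x g x).
rewrite -(Radon_Nikodym_SigmaFinite.change_of_variables nP)//.
have mf := measurable_int _ intf.
have FE : ae_eq P setT (Radon_Nikodym_SigmaFinite.f n P) (EFin \o f).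
  apply: integral_ae_eq => //; first exact: Radon_Nikodym_SigmaFinite.f_integrable.
  by move=> A _ mA; rewrite -Radon_Nikodym_SigmaFinite.f_integral.
apply: ge0_ae_eq_integral => //.
- apply: emeasurable_funM => //.
  exact: measurable_int (Radon_Nikodym_SigmaFinite.f_integrable _).
- exact: emeasurable_funM.
- by move=> x _; apply: mule_ge0 => //; exact: Radon_Nikodym_SigmaFinite.f_ge0.
- by move=> x _; apply: mule_ge0 => //; rewrite lee_fin.
- exact: ae_eqe_mul2l.
Qed.

(** The image under [X] of the measure f dP is absolutely continuous with respect to the law of [X];
    its density is the conditional expectation of [f] given [X]. *)
Let ge0_conditional_expectation (f : T -> R) (c : R) :
  measurable_fun [set: T] f -> (forall x, 0 <= f x <= c)%R ->
  exists v : S -> R, [/\ measurable_fun [set: S] v, forall y, (0 <= v y <= c)%R &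
    forall h : S -> R, measurable_fun [set: S] h -> (forall y, 0 <= h y)%R ->
      \int[P]_x (f x * h (X x))%:E = \int[P]_x (v (X x) * h (X x))%:E].
Proof.
move=> mf f0c.
have f_ge0 x : (0 <= f x)%R by have /andP[] := f0c x.
have intf : P.-integrable [set: T] (EFin \o f).
  apply: (@bounded_integrable _ _ _ P _ _ c) => // x _.
  by rewrite ger0_norm//; have /andP[] := f0c x.
have f0 A : 0 <= induced_charge intf A.
  by apply: integral_ge0 => x _; rewrite lee_fin.
pose m := measure_of_charge (induced_charge intf) f0.
pose mi0 : {measure set S -> \bar R} := pushforward m X.
pose mi := mi0 mX.
have fin : fin_num_fun mi.
  by move=> A mA; apply: fin_num_measure => //; rewrite -[X in measurable X]setTI; exact: mX.
pose n : {finite_measure set _ -> \bar R} := finite_measure_of fin.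
pose M := law P mX.
have nM : n `<< M.
  apply/null_content_dominatesP => A mA PA0.
  apply: (@null_set_integral _ _ _ P (X @^-1` A) (EFin \o f)) => //.
    by rewrite -[X in measurable X]setTI; exact: mX.
  by apply: measurable_funTS; exact/measurable_EFinP.
have cov g : (forall y, 0 <= g y) -> measurable_fun [set: S] g ->
   \int[P]_x (g (X x) * (f x)%:E) =
   \int[P]_x (g (X x) * Radon_Nikodym_SigmaFinite.f n M (X x)).
  move=> g0 mg.
  have mgX : measurable_fun [set: T] (g \o X) by exact: measurableT_comp.
  rewrite -(integral_density f0 (g := g \o X))//; last by move=> x; exact: g0.
  transitivity (\int[n]_y g y).
    by have := ge0_integral_pushforward mX m measurableT mg (fun y _ => g0 y); exact: esym.
  rewrite -(ge0_integral_law P mX (f := fun y => g y * Radon_Nikodym_SigmaFinite.f n M y)); last 2 first.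
  - apply: emeasurable_funM => //.
    exact: measurable_int (Radon_Nikodym_SigmaFinite.f_integrable _).
  - by move=> x; apply: mule_ge0 => //; exact: Radon_Nikodym_SigmaFinite.f_ge0.
  by rewrite (Radon_Nikodym_SigmaFinite.change_of_variables nM).
set F := Radon_Nikodym_SigmaFinite.f n M in cov.
have F0 y : 0 <= F y by exact: Radon_Nikodym_SigmaFinite.f_ge0.
have Ffin y : F y \is a fin_num by exact: Radon_Nikodym_SigmaFinite.f_fin_num.
have mF : measurable_fun [set: S] F.
  exact: measurable_int (Radon_Nikodym_SigmaFinite.f_integrable _).
have iF : P.-integrable [set: T] (F \o X).
  apply/integrableP; split; first exact: measurableT_comp.
  under eq_integral do rewrite /= gee0_abs//.
  have := cov (cst 1) (fun=> lee01) (measurable_cst _); rewrite /=.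
  under eq_integral do rewrite mul1e.
  under [in RHS]eq_integral do rewrite mul1e.
  move=> <-; have /integrableP[_] := intf.
  apply: le_lt_trans.
  by apply: le_integral_ge0 => x _; rewrite lee_fin//= ler_norm.
(* On the event where the density exceeds [c], its integral equals that of [f], which is at most
   that of [c]. The excess is nonnegative there with nonpositive integral, hence vanishes a.e. *)
have Fc : {ae P, forall x, F (X x) <= c%:E}.
  pose A := [set y | c%:E < F y].
  have mA : measurable A by rewrite -[A]setTI; exact: emeasurable_fun_o_infty.
  have mA' : measurable (X @^-1` A) by rewrite -[X in measurable X]setTI; exact: mX.
  have iFA : P.-integrable (X @^-1` A) (F \o X) by exact: integrableS iF.
  have icA : P.-integrable (X @^-1` A) (cst c%:E).
    exact: finite_measure_integrable_cst.
  have FA : \int[P]_(x in X @^-1` A) F (X x) <= \int[P]_(x in X @^-1` A) c%:E.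
    rewrite (_ : \int[P]_(x in X @^-1` A) F (X x) =
       \int[P]_(x in X @^-1` A) (f x)%:E).
      apply: le_integral_ge0 => x _; rewrite lee_fin//.
      by have /andP[] := f0c x.
    transitivity (\int[M]_(y in A) F y).
      by rewrite ge0_integral_pushforward//; exact: measurable_funTS.
    by rewrite -(Radon_Nikodym_SigmaFinite.f_integral nM).
  have : ae_eq P (X @^-1` A) (fun x => F (X x) - c%:E) (cst 0).
    apply/ae_eq_integral_abs => //.
      by apply: emeasurable_funB => //; exact: measurable_int iFA.
    apply/eqP; rewrite eq_le integral_ge0// andbT.
    under eq_integral => x /set_mem xA.
      rewrite gee0_abs; last by rewrite sube_ge0 ?ltW//; exact: xA.
      over.
    by rewrite integralB// sube_le0.
  apply: filterS => x xA; rewrite leNgt; apply/negP => cF.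
  have := xA cF; rewrite -(fineK (Ffin (X x))) -EFinB => -[] /subr0_eq Fc.
  by move: cF; rewrite -(fineK (Ffin (X x))) Fc ltxx.
(* Truncation at [c] changes the density on a null set only, and makes the bound hold at every
   point. *)
exists (fun y => Num.min (fine (F y)) c); split.
- by apply: measurable_minr => //; exact: measurableT_comp.
- move=> y; rewrite le_min ge_min lexx orbT andbT fine_ge0//=.
  by have /andP[h1 h2] := f0c point; apply: le_trans h1 h2.
move=> h mh h0.
transitivity (\int[P]_x ((h (X x))%:E * F (X x))).
  rewrite -(cov (EFin \o h))//=; last exact/measurable_EFinP.
  by apply: eq_integral => x _; rewrite EFinM muleC.
apply: ge0_ae_eq_integral => //.
- apply: emeasurable_funM; last exact: measurableT_comp.
  by apply/measurable_EFinP; exact: measurableT_comp.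
- apply/measurable_EFinP; apply: measurable_funM; last exact: measurableT_comp.
  by apply: measurable_minr => //; do 2 apply: measurableT_comp => //.
- by move=> x _; rewrite mule_ge0// lee_fin.
- move=> x _; rewrite lee_fin mulr_ge0// le_min fine_ge0//=.
  by have /andP[h1 h2] := f0c x; apply: le_trans h1 h2.
apply: filterS Fc => x Fxc _.
rewrite EFinM muleC; congr (_ * _).
rewrite -[LHS]fineK//; congr EFin; apply/esym/min_idPl.
by rewrite -lee_fin fineK.
Qed.

(** Reduction to the nonnegative case: [u] is shifted by [c] and the test function by [H]. Linearity
    removes the shifts, the term in [H] being handled by the test function 1. *)
Lemma bounded_conditional_expectation (u : T -> R) (c : R) :
  measurable_fun [set: T] u -> (forall x, `|u x| <= c)%R ->
  exists v : S -> R, [/\ measurable_fun [set: S] v, forall y, (`|v y| <= c)%R &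
    forall (h : S -> R) (H : R), measurable_fun [set: S] h ->
      (forall y, `|h y| <= H)%R ->
      (\int[P]_x (u x * h (X x)) = \int[P]_x (v (X x) * h (X x)))%R].
Proof.
move=> mu uc.
have c0 : (0 <= c)%R by exact: le_trans (uc point).
have [||v [mv v0 hv]] := @ge0_conditional_expectation (fun x => u x + c)%R (2 * c)%R.
- exact: measurable_funD.
- by move=> x; have := uc x; rewrite ler_norml => /andP[? ?]; apply/andP; split; lra.
exists (fun y => v y - c)%R; split.
- exact: measurable_funB.
- by move=> y; have /andP[? ?] := v0 y; rewrite ler_norml; apply/andP; split; lra.
move=> h H mh hH.
have H0 : (0 <= H)%R by exact: le_trans (hH point).
have vb y : (`|v y| <= 2 * c)%R by have /andP[? ?] := v0 y; rewrite ger0_norm.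
have E : (\int[P]_x ((u x + c) * (h (X x) + H)) = \int[P]_x (v (X x) * (h (X x) + H)))%R.
  rewrite /Rintegral (hv (fun y => h y + H)%R)//; first exact: measurable_funD.
  by move=> y; have := hH y; rewrite ler_norml => /andP[? ?]; lra.
have E1 : (\int[P]_x (u x + c) = \int[P]_x (v (X x)))%R.
  have := hv (cst 1%R) (measurable_cst _) (fun=> ler01).
  rewrite /Rintegral /=; under eq_integral do rewrite mulr1.
  by under [in RHS]eq_integral do rewrite mulr1; move=> ->.
have mhX : measurable_fun [set: T] (h \o X) by exact: measurableT_comp.
have mvX : measurable_fun [set: T] (v \o X) by exact: measurableT_comp.
have uc2 x : (`|u x + c| <= 2 * c)%R.
  by have := uc x; rewrite !ler_norml => /andP[? ?]; apply/andP; split; lra.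
have muc : measurable_fun [set: T] (fun x => u x + c)%R by exact: measurable_funD.
have i1 : P.-integrable setT (EFin \o (fun x => (u x + c) * h (X x))%R).
  apply: (@bounded_integrable _ _ _ P _ _ (2 * c * H)%R) => //; first exact: measurable_funM.
  by move=> x _; rewrite normrM ler_pM.
have i2 : P.-integrable setT (EFin \o (fun x => (u x + c))%R).
  exact: (@bounded_integrable _ _ _ P _ _ (2 * c)%R).
have i3 : P.-integrable setT (EFin \o (fun x => v (X x) * h (X x))%R).
  apply: (@bounded_integrable _ _ _ P _ _ (2 * c * H)%R) => //; first exact: measurable_funM.
  by move=> x _; rewrite normrM ler_pM.
have i4 : P.-integrable setT (EFin \o (fun x => v (X x))%R).
  by apply: (@bounded_integrable _ _ _ P _ _ (2 * c)%R).
have i5 : P.-integrable setT (EFin \o (fun x => h (X x))%R).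
  by apply: (@bounded_integrable _ _ _ P _ _ H).
have i6 (k : R) : P.-integrable setT (EFin \o (fun x => k * h (X x))%R).
  apply: (@bounded_integrable _ _ _ P _ _ (`|k| * H)%R) => //; first exact: measurable_funM.
  by move=> x _; rewrite normrM ler_pM.
have i7 (k : R) (f : T -> R) : P.-integrable setT (EFin \o f) ->
    P.-integrable setT (EFin \o (fun x => k * f x)%R).
  by move=> /(integrableZl measurableT k); apply: eq_integrable.
have -> : (\int[P]_x (u x * h (X x)) = \int[P]_x ((u x + c) * h (X x)) - c * \int[P]_x h (X x))%R.
  rewrite -RintegralZl// -RintegralB//; apply: eq_Rintegral => x _; ring.
have -> : (\int[P]_x ((v (X x) - c) * h (X x)) = \int[P]_x (v (X x) * h (X x)) - c * \int[P]_x h (X x))%R.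
  rewrite -RintegralZl// -RintegralB//; apply: eq_Rintegral => x _; ring.
congr (_ - _)%R; apply: (@addIr _ (H * \int[P]_x (u x + c))%R).
rewrite {2}E1 -!RintegralZl// -!RintegralD//; [|exact: i7..].
transitivity (\int[P]_x ((u x + c) * (h (X x) + H)))%R.
  by apply: eq_Rintegral => x _; ring.
by rewrite E; apply: eq_Rintegral => x _; ring.
Qed.

End conditional_expectation.

(** * Test functions along lines *)

Section increments.
Context {R : realType}.

Lemma mean_value_inequality (F : R -> R) (a b c e : R) :
  (forall r, derivable F r 1) ->
  (forall r, Num.min a b <= r <= Num.max a b -> `|derive1 F r - c| <= e) ->
  `|F b - F a - (b - a) * c| <= `|b - a| * e.
Proof.
move=> dF.
have dF' (r : R) : is_derive r 1 F (derive1 F r) by rewrite derive1E; exact: derivableP.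
have cF : continuous F.
  by move=> r; apply/differentiable_continuous/derivable1_diffP.
wlog ab : a b / a <= b => [H hr|hr].
  have [ab|/ltW ba] := leP a b; first exact: H.
  rewrite (_ : F b - F a - _ = - (F a - F b - (a - b) * c)); last by ring.
  by rewrite normrN (distrC b); apply: H => // r; rewrite minC maxC; exact: hr.
have [r rab E] := MVT_segment ab (fun x _ => dF' x) (continuous_subspaceT cF).
rewrite E (_ : _ - _ = (b - a) * (derive1 F r - c)); last by ring.
rewrite normrM ler_wpM2l//; apply: hr.
by move: rab; rewrite in_itv /= (min_idPl ab) (max_idPr ab).
Qed.

Context {d : nat}.
Implicit Types (f : 'rV[R]_d -> R) (x h : 'rV[R]_d).

Let trunc (k : nat) h : 'rV[R]_d := \row_i (if (i < k)%N then h ord0 i else 0).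

Lemma derivable_line f x i (r : R) :
  (forall y, derivable f y (delta_mx ord0 i)) ->
  derivable (fun r : R => f (x + r *: delta_mx ord0 i)) r 1 /\
  derive1 (fun r : R => f (x + r *: delta_mx ord0 i)) r =
    'D_(delta_mx ord0 i) f (x + r *: delta_mx ord0 i).
Proof.
move=> df; set v := delta_mx _ _.
have E : (fun h : R => h^-1 *: (((fun r : R => f (x + r *: v)) \o shift r) (h *: 1) - f (x + r *: v)))
   = (fun h : R => h^-1 *: ((f \o shift (x + r *: v)) (h *: v) - f (x + r *: v))).
  apply/funext => h /=; congr (_ *: (f _ - _)).
  by rewrite [h *: 1]mulr1 scalerDl addrCA addrC -addrA addrC.
split; first by rewrite /derivable E; exact: df.
by rewrite derive1E /derive E.
Qed.

(** The segment is replaced by a path along the axes: [trunc k h] keeps the first [k] coordinates of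
    [h], so consecutive corners differ in one coordinate and the mean value inequality applies on
    each edge. The path stays in the box spanned by [h], where the derivatives are controlled. *)
Lemma partial_increment f x h (c : 'I_d -> R) (e : R) :
  (forall i (y : 'rV[R]_d), derivable f y (delta_mx ord0 i)) ->
  (forall i (y : 'rV[R]_d), (forall j, `|y ord0 j - x ord0 j| <= `|h ord0 j|) ->
     `|'D_(delta_mx ord0 i) f y - c i| <= e) ->
  `|f (x + h) - f x - \sum_i h ord0 i * c i| <= (\sum_i `|h ord0 i|) * e.
Proof.
move=> df hc.
have H k : (k <= d)%N ->
    `|f (x + trunc k h) - f x - \sum_(i < d | (i < k)%N) h ord0 i * c i| <=
    (\sum_(i < d | (i < k)%N) `|h ord0 i|) * e.
  elim: k => [_|k IH kd].
    rewrite !big_pred0//; rewrite (_ : trunc 0 h = 0) ?addr0 ?subrr ?subr0 ?normr0 ?mul0r//.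
    by apply/rowP => i; rewrite !mxE.
  have {}IH := IH (ltnW kd); pose i0 := Ordinal kd.
  have pE (i : 'I_d) : (i < k.+1)%N && (i != i0) = (i < k)%N.
    by rewrite ltnS leq_eqVlt -val_eqE /=; case: ltngtP.
  rewrite (bigD1 i0)//= [in leRHS](bigD1 i0)//=.
  rewrite (eq_bigl _ _ pE) [in leRHS](eq_bigl _ _ pE).
  have tE : trunc k.+1 h = trunc k h + h ord0 i0 *: delta_mx ord0 i0.
    apply/rowP => i; rewrite !mxE eqxx /= ltnS leq_eqVlt -val_eqE /=.
    case: (ltngtP i k) => /= ik; rewrite ?mulr0 ?addr0// mulr1 add0r.
    by congr (h _ _); exact: val_inj.
  set S := \sum_(i | _) _ in IH *; set N := \sum_(i | _) _ in IH *.
  have H := @mean_value_inequality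
    (fun r : R => f (x + trunc k h + r *: delta_mx ord0 i0)) 0 (h ord0 i0) (c i0) e.
  rewrite -!addrA -tE scale0r addr0 !subr0 !addrA in H.
  rewrite (_ : _ - _ = (f (x + trunc k.+1 h) - f (x + trunc k h) - h ord0 i0 * c i0)
     + (f (x + trunc k h) - f x - S)); last by ring.
  rewrite mulrDl; apply: (le_trans (ler_normD _ _)); apply: lerD => //.
  apply: H => r; first by have [] := derivable_line (x + trunc k h) r (df i0).
  have [_ ->] := derivable_line (x + trunc k h) r (df i0).
  move=> rh; apply: hc => j; rewrite !mxE eqxx /=.
  have [->|ji] := eqVneq j i0.
    rewrite ltnn mulr1 addr0 addrAC subrr add0r.
    move: rh; case: (leP 0 (h ord0 i0)) => h0 /andP[r1 r2].
      by rewrite !ger0_norm.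
    by rewrite !ler0_norm ?lerN2// ltW.
  by rewrite mulr0 addr0 addrAC subrr add0r; case: ifP; rewrite ?normr0.
have := H d (leqnn d).
have pT (i : 'I_d) : (i < d)%N = true by rewrite ltn_ord.
rewrite !(eq_bigl _ _ pT); congr (`|f (x + _) - _ - _| <= _).
by apply/rowP => i; rewrite mxE ltn_ord.
Qed.

End increments.

Section C1_test_calculus.
Context {R : realType} {d : nat}.
Variable phi : R -> torus R d -> R.
Hypothesis hphi : C1_test phi.
Local Notation pi := (@torus_proj R d).

Lemma continuous_dt_proj :
  continuous (fun p : R * 'rV[R]_d => dt phi p.1 (pi p.2)).
Proof.
have [_ cdt _ _] := hphi.
move=> p; apply: (@continuous_comp _ _ _ (fun p : R * 'rV[R]_d => (p.1, pi p.2))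
  (fun p : R * torus R d => dt phi p.1 p.2)); last exact: cdt.
have h2 : pi q.2 @[q --> p] --> pi p.2.
  by apply: continuous_comp; [exact: cvg_snd|exact: continuous_torus_proj].
exact: (cvg_pair cvg_fst h2).
Qed.

(** [C1_test] only provides partial derivatives; their joint continuity yields this first-order
    expansion. The increment is split at the point (s, x + h): in space at the fixed time [s], then
    in time at the fixed position x + h. *)
Lemma C1_test_increment (s : R) (x : 'rV[R]_d) (e : R) : 0 < e ->
  exists2 del, 0 < del & forall (r : R) (h : 'rV[R]_d), `|r| < del -> (forall i, `|h ord0 i| < del) ->
  `|phi (s + r) (pi (x + h)) - phi s (pi x) -
    (r * dt phi s (pi x) + \sum_i h ord0 i * dx phi s i x)| <=
    (`|r| + \sum_i `|h ord0 i|) * e.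
Proof.
move=> e0; have [dphi cdt dphix cdx] := hphi.
have : \forall p \near (s, x), `|dt phi p.1 (pi p.2) - dt phi s (pi x)| <= e /\
    forall i, `|dx phi p.1 i p.2 - dx phi s i x| <= e.
  apply: filterI.
    have /cvgrPdist_le := @continuous_dt_proj (s, x).
    by move=> /(_ e e0); apply: filterS => p; rewrite distrC.
  suff : forall i, \forall p \near (s, x), `|dx phi p.1 i p.2 - dx phi s i x| <= e.
    by move=> /filter_forall; apply.
  move=> i; have /cvgrPdist_le := cdx i (s, x).
  by move=> /(_ e e0); apply: filterS => p; rewrite distrC.
move=> /nbhs_ballP[del /= del0 H].
have {}H (s' : R) (y : 'rV[R]_d) : `|s' - s| < del -> (forall j, `|y ord0 j - x ord0 j| < del) ->
   `|dt phi s' (pi y) - dt phi s (pi x)| <= e /\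
    forall i, `|dx phi s' i y - dx phi s i x| <= e.
  move=> sr yx; apply: (H (s', y)); split; rewrite /ball /=.
    by rewrite distrC.
  by split => // a j; rewrite ord1 /ball /= distrC.
exists del => // r h rdel hdel.
have Hx : `|phi s (pi (x + h)) - phi s (pi x) - \sum_i h ord0 i * dx phi s i x|
    <= (\sum_i `|h ord0 i|) * e.
  apply: (@partial_increment _ _ (phi s \o pi)) => [i y|i y hy]; first exact: dphix.
  have [|j|_] := H s y; first by rewrite subrr normr0.
    by apply: le_lt_trans (hy j) _.
  exact.
have Ht : `|phi (s + r) (pi (x + h)) - phi s (pi (x + h)) - (s + r - s) * dt phi s (pi x)|
    <= `|s + r - s| * e.
  apply: (@mean_value_inequality _ (phi ^~ (pi (x + h)))) => [r'|r' hr']; first exact: dphi.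
  have [||] // := H r' (x + h).
    move: rdel hr'; rewrite !ltr_norml => /andP[? ?].
    by case: (leP s (s + r)) => ? /andP[? ?]; apply/andP; split; lra.
  by move=> j; rewrite mxE addrAC subrr add0r.
rewrite mulrDl (_ : _ - _ = (phi (s + r) (pi (x + h)) - phi s (pi (x + h)) - (s + r - s) * dt phi s (pi x))
  + (phi s (pi (x + h)) - phi s (pi x) - \sum_i h ord0 i * dx phi s i x)); last by ring.
apply: (le_trans (ler_normD _ _)); apply: lerD => //.
by move: Ht; rewrite [s + r - s]addrAC subrr add0r.
Qed.

Lemma continuous_test : continuous (fun p : R * 'rV[R]_d => phi p.1 (pi p.2)).
Proof.
move=> [s x]; apply/cvgrPdist_le => e e0 /=.
have [del del0 H] := C1_test_increment s x ltr01.
(* A local Lipschitz constant: the sizes of the partial derivatives, and 1 + d for the error of the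
   expansion taken with e = 1. *)
pose G := `|dt phi s (pi x)| + \sum_i `|dx phi s i x| + (1 + d%:R).
have G0 : 0 < G by rewrite ltr_wpDl// ?addr_ge0 ?sumr_ge0// ltr_pwDl.
pose eta := Num.min del (e / G).
have eta0 : 0 < eta by rewrite lt_min del0 divr_gt0.
suff : nbhs (s, x) (fun q : R * 'rV[R]_d => `|phi s (pi x) - phi q.1 (pi q.2)| <= e) by [].
apply/nbhs_ballP; exists eta => //= -[r y] [] /=.
rewrite /ball /= => sr [_ xy].
have rE : r = s + (r - s) by ring.
have yE : y = x + (y - x) by rewrite addrC subrK.
have sr' : `|r - s| < eta by rewrite distrC.
have xy' i : `|(y - x) ord0 i| < eta by have := xy ord0 i; rewrite !mxE distrC.
have etad : eta <= del by rewrite ge_min lexx.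
have := H (r - s) (y - x) (lt_le_trans sr' etad) (fun i => lt_le_trans (xy' i) etad).
rewrite -rE -yE mulr1 => {}H; rewrite distrC.
have : `|phi r (pi y) - phi s (pi x)| <= eta * G.
  rewrite -[X in `|X|](subrK ((r - s) * dt phi s (pi x) + \sum_i (y - x) ord0 i * dx phi s i x)).
  apply: (le_trans (ler_normD _ _)); rewrite /G mulrDr addrC; apply: lerD.
    apply: (le_trans (ler_normD _ _)); rewrite mulrDr; apply: lerD.
      by rewrite normrM ler_wpM2r// ltW.
    apply: (le_trans (ler_norm_sum _ _ _)); rewrite mulr_sumr; apply: ler_sum => i _.
    by rewrite normrM ler_wpM2r// ltW.
  apply: (le_trans H); rewrite mulrDr mulr1; apply: lerD; first exact: ltW.
  apply: (@le_trans _ _ (\sum_(i < d) eta)); first by apply: ler_sum => i _; exact: ltW.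
  by rewrite sumr_const card_ord mulr_natr.
move/le_trans; apply; rewrite -ler_pdivlMr//.
by rewrite /eta ge_min lexx orbT.
Qed.

(** The chain rule, from the joint expansion with time increment h and displacement h v. In the
    proof [N] is the size of this increment per unit of h, so an error e / N in the expansion
    becomes e in the difference quotient. *)
Lemma is_derive_along_line (p v : 'rV[R]_d) (s : R) :
  is_derive (s : R) (1 : R) (fun s : R => phi s (pi (p + s *: v)))
    (dt phi s (pi (p + s *: v)) + \sum_i v ord0 i * dx phi s i (p + s *: v)).
Proof.
set l := _ + \sum_i _.
have H : (fun h : R => h^-1 *: (((fun s : R => phi s (pi (p + s *: v))) \o shift s) (h *: 1)
       - phi s (pi (p + s *: v)))) h @[h --> 0^'] --> l.
  apply/cvgrPdist_le => e e0.
  pose N := 1 + \sum_i `|v ord0 i|.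
  have N0 : 0 < N by rewrite ltr_pwDl// sumr_ge0.
  have [del del0 Hd] := C1_test_increment s (p + s *: v) (divr_gt0 e0 N0).
  near=> h.
  have h0 : h != 0 by near: h; exact: nbhs_dnbhs_neq.
  have hd : `|h| < del / N.
    by near: h; apply: dnbhs0_lt; rewrite divr_gt0.
  have hd1 : `|h| < del.
    apply: lt_le_trans hd _; rewrite ler_pdivrMr// ler_peMr//; first exact: ltW.
    by rewrite lerDl sumr_ge0.
  have hv i : `|(h *: v) ord0 i| < del.
    rewrite mxE normrM; rewrite ltr_pdivlMr// in hd; apply: le_lt_trans hd.
    rewrite ler_wpM2l// /N (bigD1 i)//= addrCA lerDl addr_ge0// sumr_ge0//.
  have := Hd h (h *: v) hd1 hv.
  rewrite /= [h *: 1]mulr1 -[p + s *: v + h *: v]addrA -scalerDl [s + h]addrC distrC.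
  set A := phi _ _; set B := phi _ _.
  rewrite (_ : h * _ + _ = h * l); last first.
    rewrite /l mulrDr; congr (_ + _); rewrite mulr_sumr; apply: eq_bigr => i _.
    by rewrite mxE mulrA.
  rewrite (_ : \sum_i `|_| = `|h| * \sum_i `|v ord0 i|); last first.
    by rewrite mulr_sumr; apply: eq_bigr => i _; rewrite mxE normrM.
  move=> HA.
  rewrite (_ : l - h^-1 *: (A - B) = h^-1 * (h * l - (A - B))); last first.
    by rewrite mulrBr mulKf.
  rewrite normrM normfV -[leRHS]mulr1 mulrC ler_pdivrMr ?normr_gt0//.
  apply: (le_trans HA).
  rewrite (_ : `|h| + _ = `|h| * N); last by rewrite /N mulrDr mulr1.
  by rewrite mulr1 -mulrA [N * _]mulrC divfK ?gt_eqF// mulrC.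
split; first by apply/cvg_ex; exists l.
exact: cvg_lim H.
Unshelve. all: by end_near. Qed.

Lemma continuous_along_line (p v : 'rV[R]_d) :
  continuous (fun s : R => dt phi s (pi (p + s *: v)) + \sum_i v ord0 i * dx phi s i (p + s *: v)).
Proof.
have [_ _ _ cdx] := hphi.
have cl : continuous (fun s : R => (s, p + s *: v) : R * 'rV[R]_d).
  move=> s; have h2 : p + r *: v @[r --> s] --> p + s *: v.
    by apply: cvgD; [exact: cvg_cst|apply: cvgZr_tmp; exact: cvg_id].
  exact: (cvg_pair cvg_id h2).
move=> s; apply: cvgD.
  exact: (continuous_comp (cl s) (@continuous_dt_proj (s, p + s *: v))).
apply: (@cvg_big _ _ +%R 0) => [|i _]; first exact: add_continuous.
have h : dx phi r i (p + r *: v) @[r --> s] --> dx phi s i (p + s *: v).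
  exact: (continuous_comp (cl s) (@cdx i (s, p + s *: v))).
exact: (cvgM (cvg_cst _) h).
Qed.

Lemma increment_along_line (p v : 'rV[R]_d) (a b : R) : a < b ->
  \int[lebesgue_measure]_(s in `[a, b])
    (dt phi s (pi (p + s *: v)) + \sum_i v ord0 i * dx phi s i (p + s *: v)) =
  phi b (pi (p + b *: v)) - phi a (pi (p + a *: v)).
Proof.
move=> ab; rewrite /Rintegral.
rewrite (@continuous_FTC2 _ _ (fun s => phi s (pi (p + s *: v))))//.
- exact/continuous_subspaceT/continuous_along_line.
- have dF (s : R) : derivable (fun s : R => phi s (pi (p + s *: v))) s 1.
    by have [] := is_derive_along_line p v s.
  have cF : continuous (fun s : R => phi s (pi (p + s *: v))).
    by move=> s; apply/differentiable_continuous/derivable1_diffP.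
  split => //.
  + exact/cvg_at_right_filter/cF.
  + exact/cvg_at_left_filter/cF.
- move=> s _; rewrite derive1E.
  by have [_ ->] := is_derive_along_line p v s.
Qed.

End C1_test_calculus.

Section continuous_functions_of_time_and_space.
Context {R : realType} {d : nat}.

Lemma continuous_rV (X : topologicalType) n (f : X -> 'rV[R]_n) :
  (forall i, continuous (fun x => f x ord0 i)) -> continuous f.
Proof.
move=> cf x A [U xU UA].
have : \forall y \near x, forall i, U ord0 i (f y ord0 i).
  suff : forall i, \forall y \near x, U ord0 i (f y ord0 i) by move=> /filter_forall; apply.
  by move=> i; exact: cf (xU ord0 i).
by apply: filterS => y yU; apply: UA => k i; rewrite ord1.
Qed.

(** The pair is packed into one row of length d + 1, where measurability is checked by coordinates
    and continuous functions are Borel. *)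
Lemma measurable_continuous_pair d' (X : measurableType d') (D : set X)
    (g : R * 'rV[R]_d -> R) (f1 : X -> R) (f2 : X -> 'rV[R]_d) :
  continuous g -> measurable_fun D f1 -> measurable_fun D (f2 : X -> Rd R d) ->
  measurable_fun D (fun x => g (f1 x, f2 x)).
Proof.
move=> cg mf1 mf2.
pose split (w : 'rV[R]_d.+1) : R * 'rV[R]_d := (w ord0 ord0, \row_i w ord0 (lift ord0 i)).
have csplit : continuous split.
  move=> w; have h2 : (\row_i (w' : 'rV[R]_d.+1) ord0 (lift ord0 i) : 'rV[R]_d) @[w' --> w]
     --> \row_i w ord0 (lift ord0 i).
    apply: continuous_rV => i; under [X in continuous X]eq_fun do rewrite mxE.
    exact: coord_continuous.
  have h1 : (w' : 'rV[R]_d.+1) ord0 ord0 @[w' --> w] --> w ord0 ord0 by exact: coord_continuous.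
  exact: (cvg_pair h1 h2).
have mgs : measurable_fun [set: Rd R d.+1] (g \o split : Rd R d.+1 -> R).
  by apply: continuous_measurable_real => w; apply: continuous_comp; [exact: csplit|exact: cg].
pose join x : 'rV[R]_d.+1 := \row_i (if unlift ord0 i is Some j then f2 x ord0 j else f1 x).
have mjoin : measurable_fun D (join : X -> Rd R d.+1).
  apply: measurable_fun_rV => i; rewrite /join; under eq_fun do rewrite mxE.
  by case: (unlift ord0 i) => [j|//]; have /measurable_fun_rVP := mf2; exact.
have := measurableT_comp mgs mjoin; congr (measurable_fun _ _).
apply/funext => x /=; rewrite /split /join; congr (g (_, _)); rewrite ?mxE ?unlift_none//.
by apply/rowP => i; rewrite !mxE liftK.
Qed.

(** Plays the part of compactness of the torus: the closed unit cube is compact and contains all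
    values of [torus_rep]. *)
Lemma continuous_bounded_cell (g : R * 'rV[R]_d -> R) (a b : R) : continuous g ->
  exists C, forall (s : R) (v : 'rV[R]_d), s \in `[a, b] ->
    (forall i, 0 <= v ord0 i <= 1) -> `|g (s, v)| <= C.
Proof.
move=> cg.
pose K : set 'rV[R]_d := [set v | forall i, `[0, 1]%classic (v ord0 i)].
have cK : compact K.
  by apply: (@rV_compact R d (fun=> `[0 : R, 1]%classic)) => i; exact: segment_compact.
have cKK : compact (`[a, b]%classic `*` K).
  by apply: compact_setX => //; exact: segment_compact.
have : compact (g @` (`[a, b]%classic `*` K)).
  by apply: continuous_compact => //; exact: continuous_subspaceT.
move=> /compact_bounded [M [_ HM]]; exists (M + 1) => s v sab v01.
apply: (HM (M + 1)); first by rewrite ltrDl.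
by exists (s, v) => //; split => //= i; rewrite in_itv /=; exact: v01.
Qed.

End continuous_functions_of_time_and_space.

Section C1_test_bounds.
Context {R : realType} {d : nat}.
Variable phi : R -> torus R d -> R.
Hypothesis hphi : C1_test phi.
Local Notation pi := (@torus_proj R d).

Lemma grad_proj s v i : grad phi s (pi v) ord0 i = dx phi s i v.
Proof.
rewrite mxE /dx /derive; congr (lim (_ @ 0^')).
have E (y : 'rV[R]_d) : pi (y + torus_repr (pi v)) = pi (y + v).
  by rewrite -!torus_projD torus_projK.
apply/funext => h /=; congr (_ *: (phi s _ - phi s _)); first exact: E.
by rewrite torus_projK.
Qed.

Lemma gradE s x i : grad phi s x ord0 i = dx phi s i (torus_rep x).
Proof. by rewrite -grad_proj torus_repK. Qed.

Lemma measurable_test d' (X : measurableType d') (D : set X) (f1 : X -> R)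
    (f2 : X -> Torus R d) : measurable_fun D f1 -> measurable_fun D f2 ->
  measurable_fun D (fun x => phi (f1 x) (f2 x)).
Proof.
move=> m1 m2; have := measurable_continuous_pair (continuous_test hphi) m1
  (measurableT_comp measurable_torus_rep m2).
by congr (measurable_fun _ _); apply/funext => x /=; rewrite torus_repK.
Qed.

Lemma measurable_dt d' (X : measurableType d') (D : set X) (f1 : X -> R)
    (f2 : X -> Torus R d) : measurable_fun D f1 -> measurable_fun D f2 ->
  measurable_fun D (fun x => dt phi (f1 x) (f2 x)).
Proof.
move=> m1 m2; have := measurable_continuous_pair (continuous_dt_proj hphi) m1
  (measurableT_comp measurable_torus_rep m2).
by congr (measurable_fun _ _); apply/funext => x /=; rewrite torus_repK.
Qed.

Lemma measurable_grad i d' (X : measurableType d') (D : set X) (f1 : X -> R)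
    (f2 : X -> Torus R d) : measurable_fun D f1 -> measurable_fun D f2 ->
  measurable_fun D (fun x => grad phi (f1 x) (f2 x) ord0 i).
Proof.
have [_ _ _ cdx] := hphi.
move=> m1 m2; have := measurable_continuous_pair (cdx i) m1
  (measurableT_comp measurable_torus_rep m2).
by congr (measurable_fun _ _); apply/funext => x /=; rewrite gradE.
Qed.

Lemma test_bounded (a b : R) : exists C, forall s x, s \in `[a, b] ->
  [/\ `|phi s x| <= C, `|dt phi s x| <= C & forall i, `|grad phi s x ord0 i| <= C].
Proof.
have [_ _ _ cdx] := hphi.
have [C1 h1] := continuous_bounded_cell a b (continuous_test hphi).
have [C2 h2] := continuous_bounded_cell a b (continuous_dt_proj hphi).
have /choice[C3 h3] : forall i, exists C, forall (s : R) (v : 'rV[R]_d), s \in `[a, b] ->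
    (forall i, 0 <= v ord0 i <= 1) -> `|dx phi s i v| <= C.
  by move=> i; have [C h] := continuous_bounded_cell a b (cdx i); exists C.
have cell (x : torus R d) i : 0 <= torus_rep x ord0 i <= 1.
  by have /andP[-> /ltW] := torus_rep_itv x i.
exists (`|C1| + `|C2| + \sum_i `|C3 i|) => s x sab; split.
- have := h1 s (torus_rep x) sab (cell x); rewrite /= torus_repK => /le_trans; apply.
  by rewrite (le_trans (ler_norm _))// -addrA lerDl addr_ge0// sumr_ge0.
- have := h2 s (torus_rep x) sab (cell x); rewrite /= torus_repK => /le_trans; apply.
  by rewrite (le_trans (ler_norm _))// addrAC lerDr addr_ge0// sumr_ge0.
- move=> i; have := h3 i s (torus_rep x) sab (cell x); rewrite -gradE => /le_trans; apply.
  rewrite (le_trans (ler_norm _))// (bigD1 i)//= addrCA lerDl addr_ge0 ?sumr_ge0//.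
Qed.

End C1_test_bounds.

(** * The mean velocity *)

Section product_integrals.
Context {R : realType} {dZ : measure_display} {Z : measurableType dZ}.
Variables (Q : probability Z R) (D : set (measurableTypeR R)).
Hypothesis mD : measurable D.
Local Notation leb := (@lebesgue_measure R).

Local Notation prodRZ := (leb \x Q)%E.

Let measurableDT : measurable (D `*` [set: Z]).
Proof. exact: measurableX. Qed.

Lemma patch_prod (f : measurableTypeR R * Z -> R) s z : D s ->
  ((EFin \o f) \_ (D `*` [set: Z])) (s, z) = (f (s, z))%:E.
Proof. by move=> Ds; rewrite patchE mem_set. Qed.

Lemma patch_prod_out (f : measurableTypeR R * Z -> R) s z : ~ D s ->
  ((EFin \o f) \_ (D `*` [set: Z])) (s, z) = 0%E.
Proof. by move=> Ds; rewrite patchE memNset// => -[]. Qed.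

Lemma integrable_prod (f : measurableTypeR R * Z -> R) (b : measurableTypeR R -> R) :
  measurable_fun (D `*` [set: Z]) f -> leb.-integrable D (EFin \o b) ->
  (forall s z, D s -> `|f (s, z)| <= b s) ->
  prodRZ.-integrable (D `*` [set: Z]) (EFin \o f).
Proof.
move=> mf ib fb; apply/integrable_mkcond; first exact: measurableX.
have mff : measurable_fun setT ((EFin \o f) \_ (D `*` [set: Z])).
  by apply/(measurable_restrictT _ measurableDT); exact/measurable_EFinP.
apply/(@integrable12ltyP _ _ _ _ _ leb Q _ mff).
apply: (@le_lt_trans _ _ (\int[leb]_(s in D) (b s)%:E)%E); last first.
  exact: integrable_lty.
rewrite [leRHS]integral_mkcond; apply: le_integral_ge0 => s _.
  by apply: integral_ge0 => z _; exact: abse_ge0.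
rewrite patchE; case: ifPn => [/set_mem Ds|]; last rewrite notin_setE => nDs.
  apply: (@le_trans _ _ (\int[Q]_z (b s)%:E)%E).
    apply: le_integral_ge0 => z _; first exact: abse_ge0.
    by rewrite patch_prod//= lee_fin fb.
  by rewrite integral_probability_cst.
by rewrite integral0_eq// => z _; rewrite patch_prod_out ?abse0.
Qed.

Variable f : measurableTypeR R * Z -> R.
Hypothesis intf : prodRZ.-integrable (D `*` [set: Z]) (EFin \o f).

(** Extension by zero, so that Fubini's theorem can be applied on the whole product space. *)
Let g := (EFin \o f) \_ (D `*` [set: Z]).

Let intg : prodRZ.-integrable setT g.
Proof. by rewrite /g -integrable_mkcond. Qed.

Lemma prod_iterated_QD :
  (forall z, leb.-integrable D (fun s => (f (s, z))%:E)) ->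
  \int[prodRZ]_(p in D `*` [set: Z]) f p = \int[Q]_z \int[leb]_(s in D) f (s, z).
Proof.
move=> fz.
rewrite /Rintegral [in LHS]integral_mkcond -/g.
rewrite -(integral21_prod_meas1 intg); congr fine; apply: eq_integral => z _.
rewrite fineK; last exact: integrable_fin_num.
rewrite [RHS]integral_mkcond; apply: eq_integral => s _.
rewrite patchE; case: ifPn => [/set_mem Ds|]; first by rewrite /g patch_prod.
by rewrite notin_setE => nDs; rewrite /g patch_prod_out.
Qed.

Lemma prod_iterated_DQ :
  (forall s, D s -> Q.-integrable setT (fun z => (f (s, z))%:E)) ->
  \int[prodRZ]_(p in D `*` [set: Z]) f p = \int[leb]_(s in D) \int[Q]_z f (s, z).
Proof.
move=> fz.
rewrite /Rintegral [in LHS]integral_mkcond -/g.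
rewrite -(integral12_prod_meas1 intg); congr fine.
rewrite [RHS]integral_mkcond; apply: eq_integral => s _.
rewrite patchE; case: ifPn => [/set_mem Ds|]; last rewrite notin_setE => nDs.
  rewrite fineK; last by apply: integrable_fin_num => //; exact: fz.
  by apply: eq_integral => z _; rewrite /g patch_prod.
by apply: integral0_eq => z _; rewrite /g patch_prod_out.
Qed.

End product_integrals.

Section velocity.
Context {R : realType} {dZ dS : measure_display} {Z : measurableType dZ}
  {S : measurableType dS}.
Variables (Q : probability Z R) (t T : R).
Hypothesis tT : t < T.
Local Notation leb := (@lebesgue_measure R).
Local Notation unif := (uniform_prob tT).

Lemma Rintegral_uniform (F : measurableTypeR R -> R) (C : R) :
  measurable_fun [set: measurableTypeR R] F -> (forall s, `|F s| <= C) ->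
  \int[unif]_s F s = (T - t)^-1 * \int[leb]_(s in `[t, T]) F s.
Proof.
move=> mF FC.
have iu : unif.-integrable setT (EFin \o F) by exact: (@bounded_integrable _ _ _ unif _ _ C).
have il : leb.-integrable `[t, T] (EFin \o F).
  apply: measurable_bounded_integrable => //.
  - by rewrite /= lebesgue_measure_itv/= lte_fin tT -EFinB ltry.
  - exact: measurable_funTS.
  - exists C; split; first exact: num_real.
    by move=> e /ltW Ce x _; exact: le_trans Ce.
have mE : measurable_fun setT (EFin \o F) by exact/measurable_EFinP.
rewrite /Rintegral [in LHS]integralE [in RHS]integralE.
have mitv : measurable (`[t, T]%classic : set (measurableTypeR R)) by exact: measurable_itv.
have ip := integrable_funepos mitv il.
have im := integrable_funeneg mitv il.
have fp := integrable_fin_num mitv ip.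
have fm := integrable_fin_num mitv im.
rewrite !integral_uniform//; [|exact: measurable_funeneg|exact: measurable_funepos].
by rewrite -(fineK fp) -(fineK fm) -!EFinM -!EFinB /= mulrBr.
Qed.

Lemma Rintegral_uniform_prod (f : measurableTypeR R * Z -> R) (C : R) :
  measurable_fun setT f -> (forall p, `|f p| <= C) ->
  \int[(unif \x Q)%E]_p f p =
    (T - t)^-1 * \int[(leb \x Q)%E]_(p in `[t, T] `*` [set: Z]) f p.
Proof.
move=> mf fC.
have iQ s : Q.-integrable setT (fun z => (f (s, z))%:E).
  apply: (@bounded_integrable _ _ _ Q _ (fun z => f (s, z)) C) => //.
  by apply: measurableT_comp mf _; exact: measurable_pair1.
have iu : (unif \x Q)%E.-integrable setT (EFin \o f).
  pose UQ : probability (measurableTypeR R * Z)%type R := (unif \x Q)%E.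
  exact: (@bounded_integrable _ _ _ UQ _ _ C).
have icst : leb.-integrable `[t, T] (EFin \o cst C).
  apply: measurable_bounded_integrable => //.
  - by rewrite /= lebesgue_measure_itv/= lte_fin tT -EFinB ltry.
  - by exists `|C|; split => // e /ltW Ce x _; exact: le_trans Ce.
have mitv : measurable (`[t, T]%classic : set (measurableTypeR R)) by exact: measurable_itv.
rewrite (prod_iterated_DQ mitv _ (fun s _ => iQ s)); last first.
  by apply: (@integrable_prod _ _ _ Q _ mitv f (cst C)) => //; exact: measurable_funTS.
have FE : (fun s => \int[Q]_z f (s, z)) = fine \o fubini_F Q (EFin \o f) by [].
rewrite -(@Rintegral_uniform (fun s => \int[Q]_z f (s, z)) C); last 2 first.
- rewrite FE; apply: measurableT_comp => //; apply: (@measurable_fubini_F _ _ _ _ _ unif).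
  exact: iu.
- move=> s; rewrite (le_trans (le_normr_Rintegral _ (iQ s)))//.
  rewrite -lee_fin fineK; last first.
    by apply: integrable_fin_num => //; apply: integrable_norm => //; exact: iQ.
  rewrite -(integral_probability_cst Q C); apply: le_integral_ge0 => z _ //.
  by rewrite lee_fin.
rewrite /Rintegral -(integral12_prod_meas1 iu); congr fine; apply: eq_integral => s _.
by rewrite fineK//; exact: integrable_fin_num.
Qed.

(** Time is made random: the uniform law on [t, T] times [Q] is a probability, so one conditional
    expectation serves all times at once and is a single measurable function. The factor 1 / (T - t)
    cancels from both sides. *)
Lemma mean_velocity (X : measurableTypeR R * Z -> S) (u : Z -> R) (c : R) :
  measurable_fun setT X -> measurable_fun setT u -> (forall z, `|u z| <= c) ->
  exists v : S -> R, [/\ measurable_fun [set: S] v, forall y, (`|v y| <= c)%R &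
    forall (h : S -> R) (H : R), measurable_fun [set: S] h ->
      (forall y, `|h y| <= H) ->
    \int[(leb \x Q)%E]_(p in `[t, T] `*` [set: Z]) (u p.2 * h (X p)) =
    \int[(leb \x Q)%E]_(p in `[t, T] `*` [set: Z]) (v (X p) * h (X p))].
Proof.
move=> mX mu uc.
have mu2 : measurable_fun setT (fun p : measurableTypeR R * Z => u p.2).
  by apply: measurableT_comp mu _; exact: measurable_snd.
have [v [mv vc hv]] := @bounded_conditional_expectation _ _ _ _ _ (unif \x Q)%E X mX
  (fun p => u p.2) c mu2 (fun p => uc p.2).
exists v; split => // h H mh hH.
have H0 : 0 <= H by exact: le_trans (hH point).
have c0 : 0 <= c by exact: le_trans (uc point).
have := hv h H mh hH.
rewrite (@Rintegral_uniform_prod _ (c * H)); last 2 first.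
- by apply: measurable_funM => //; exact: measurableT_comp.
- by move=> p; rewrite normrM ler_pM.
rewrite (@Rintegral_uniform_prod _ (c * H)); last 2 first.
- by apply: measurable_funM => //; exact: measurableT_comp.
- by move=> p; rewrite normrM ler_pM.
by apply: mulfI; rewrite invr_eq0 subr_eq0 gt_eqF.
Qed.

End velocity.

(** * The flow and its continuity equation *)

Lemma measurable_translate {R : realType} {d : nat} d' (X : measurableType d')
    (f : X -> Rd R d) (g : X -> Torus R d) :
  measurable_fun setT f -> measurable_fun setT g ->
  measurable_fun setT (fun x => translate (torus_proj (f x)) (g x) : Torus R d).
Proof.
move=> mf mg.
have -> : (fun x => translate (torus_proj (f x)) (g x)) =
    (fun x => torus_proj (torus_rep (g x) + f x)).
  by apply/funext => x; rewrite -torus_projD torus_repK.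
apply: (measurableT_comp measurable_torus_proj); apply: measurable_fun_rV => i.
under eq_fun do rewrite !mxE.
apply: measurable_funD; last by move/measurable_fun_rVP : mf.
have /measurable_fun_rVP/(_ i) := measurableT_comp measurable_torus_rep mg.
by under eq_fun do rewrite !mxE.
Qed.

Lemma measurable_rVN {R : realType} {d : nat} d' (X : measurableType d') (f : X -> Rd R d) :
  measurable_fun setT f -> measurable_fun setT (fun x => - (f x : 'rV[R]_d) : Rd R d).
Proof.
move=> /measurable_fun_rVP mf; apply: measurable_fun_rV => i.
by under eq_fun do rewrite mxE; apply: measurable_funN; exact: mf.
Qed.

Lemma enorm_le_sum {R : realType} {d : nat} (z : 'rV[R]_d) :
  enorm z <= \sum_i `|z ord0 i|.
Proof.
have S0 : 0 <= \sum_i `|z ord0 i| by exact: sumr_ge0.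
rewrite /enorm -[leRHS](ger0_norm S0) -sqrtr_sqr ler_wsqrtr// expr2 mulr_suml.
apply: ler_sum => i _; rewrite -real_normK ?num_real// expr2 ler_wpM2l//.
by rewrite (bigD1 i)//= lerDl sumr_ge0.
Qed.

Lemma measurable_enorm {R : realType} {d : nat} :
  measurable_fun [set: Rd R d] (fun z : Rd R d => enorm (z : 'rV[R]_d)).
Proof.
apply: (measurableT_comp (@continuous_measurable_fun _ _ (@sqrt_continuous R))).
apply: measurable_sum => i; exact: (measurable_funX 2 (measurable_coord i)).
Qed.

Section transport.
Context {R : realType} {d : nat} {dZ : measure_display} {Z : measurableType dZ}.
Local Notation leb := (@lebesgue_measure R).
Local Notation pi := (@torus_proj R d).
Local Notation PT := (probability (Torus R d) R).
Local Notation PRd := (probability (Rd R d) R).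
Variables (Q : probability Z R) (t T : R) (x0 u : Z -> 'rV[R]_d) (c : R).
Hypothesis tT : t < T.
Hypothesis mx0 : measurable_fun [set: Z] (x0 : Z -> Rd R d).
Hypothesis mu_ : measurable_fun [set: Z] (u : Z -> Rd R d).
Hypothesis uc : forall z i, `|u z ord0 i| <= c.

Definition base_pos (s : R) (z : Z) : 'rV[R]_d := x0 z + (s - t) *: u z.

(** Time is kept as first component, so that conditioning on this variable yields a field depending
    on time and position, and test functions may depend on both. *)
Definition base_curve (p : measurableTypeR R * Z) : measurableTypeR R * Torus R d :=
  (p.1, pi (base_pos p.1 p.2)).

Let mx0i i : measurable_fun [set: Z] (fun z => x0 z ord0 i).
Proof. by have /measurable_fun_rVP := mx0; exact. Qed.

Let mui i : measurable_fun [set: Z] (fun z => u z ord0 i).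
Proof. by have /measurable_fun_rVP := mu_; exact. Qed.

Lemma measurable_shifted_pos d' (X : measurableType d') (f1 : X -> measurableTypeR R)
    (f2 : X -> Z) (f3 : X -> Rd R d) : measurable_fun setT f1 -> measurable_fun setT f2 ->
  measurable_fun setT f3 ->
  measurable_fun setT (fun x => pi (base_pos (f1 x) (f2 x) + f3 x) : Torus R d).
Proof.
move=> m1 m2 /measurable_fun_rVP m3.
apply: (measurableT_comp measurable_torus_proj); apply: measurable_fun_rV => i.
under eq_fun do rewrite !mxE.
apply: measurable_funD; last exact: m3.
apply: measurable_funD; first exact: (measurableT_comp (mx0i i) m2).
apply: measurable_funM; last exact: (measurableT_comp (mui i) m2).
by apply: measurable_funB; [exact: m1|exact: measurable_cst].
Qed.

Lemma measurable_base_curve : measurable_fun setT base_curve.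
Proof.
apply/measurable_fun_pairP; split; first exact: measurable_fst.
have := @measurable_shifted_pos _ _ fst snd (fun=> 0)
  (@measurable_fst _ _ _ _) (@measurable_snd _ _ _ _) (measurable_cst _).
by congr (measurable_fun _ _); apply/funext => p /=; rewrite addr0.
Qed.

(* [v] is the conditional expectation of the velocity [u] given time and position. *)
Lemma exists_velocity : exists v : measurableTypeR R * Torus R d -> 'rV[R]_d,
  [/\ measurable_fun setT (v : _ -> Rd R d), forall y i, `|v y ord0 i| <= c &
    forall i (h : measurableTypeR R * Torus R d -> R) (H : R), measurable_fun setT h ->
      (forall y, `|h y| <= H) ->
    \int[(leb \x Q)%E]_(p in `[t, T] `*` [set: Z]) (u p.2 ord0 i * h (base_curve p)) =
    \int[(leb \x Q)%E]_(p in `[t, T] `*` [set: Z])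
      (v (base_curve p) ord0 i * h (base_curve p))].
Proof.
have /choice[v hv] : forall i, exists v : measurableTypeR R * Torus R d -> R,
  [/\ measurable_fun setT v, forall y, (`|v y| <= c)%R &
    forall (h : measurableTypeR R * Torus R d -> R) (H : R), measurable_fun setT h ->
      (forall y, `|h y| <= H) ->
    \int[(leb \x Q)%E]_(p in `[t, T] `*` [set: Z]) (u p.2 ord0 i * h (base_curve p)) =
    \int[(leb \x Q)%E]_(p in `[t, T] `*` [set: Z])
      (v (base_curve p) * h (base_curve p))].
  move=> i; have [v [h1 h2 h3]] := mean_velocity Q tT measurable_base_curve (mui i) (fun z => uc z i).
  by exists v.
exists (fun y => \row_i v i y); split.
- by apply: measurable_fun_rV => i; under eq_fun do rewrite mxE; have [] := hv i.
- by move=> y i; rewrite mxE; have [] := hv i.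
- move=> i h H mh hH; have [_ _ /(_ h H mh hH) ->] := hv i.
  by apply: eq_Rintegral => p _; rewrite mxE.
Qed.

Definition pos (A : R -> 'rV[R]_d) (s : R) (z : Z) : Torus R d := pi (base_pos s z + A s).

Lemma measurable_pos A s : measurable_fun [set: Z] (pos A s).
Proof.
exact: (@measurable_shifted_pos _ _ (cst s) id (cst (A s))
  (measurable_cst _) (@measurable_id _ _ _) (measurable_cst _)).
Qed.

Definition flow (A : R -> 'rV[R]_d) (s : R) : PT := law Q (measurable_pos A s).

Variable v : measurableTypeR R * Torus R d -> 'rV[R]_d.

(* Shifting all particles by [A s] adds [a s], the derivative of [A], to the
   velocity field seen at the shifted position. *)
Definition velocity (A a : R -> 'rV[R]_d) (s : R) (x : torus R d) : Rd R d :=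
  v (s, translate (pi (- A s)) x) + a s.

Hypothesis mv : measurable_fun setT (v : _ -> Rd R d).
Hypothesis vc : forall y i, `|v y ord0 i| <= c.

Lemma measurable_velocity d' (X : measurableType d') (f1 : X -> measurableTypeR R)
    (f2 : X -> Torus R d) (f3 f4 : X -> Rd R d) :
  measurable_fun setT f1 -> measurable_fun setT f2 ->
  measurable_fun setT f3 -> measurable_fun setT f4 ->
  measurable_fun setT (fun x => v (f1 x, translate (pi (- f3 x)) (f2 x)) + f4 x : Rd R d).
Proof.
move=> m1 m2 m3 /measurable_fun_rVP m4.
have mtr := measurable_translate (measurable_rVN m3) m2.
apply: measurable_fun_rV => i; under eq_fun do rewrite !mxE.
apply: measurable_funD; last exact: m4.
have /measurable_fun_rVP/(_ i) mvi := mv.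
by apply: (measurableT_comp mvi); apply/measurable_fun_pairP.
Qed.

Lemma velocity_pos A a s z :
  velocity A a s (pos A s z) = v (base_curve (s, z)) + a s.
Proof. by rewrite /velocity /pos torus_projD addrK. Qed.

Lemma velocity_le A a s x i : `|velocity A a s x ord0 i| <= c + `|a s ord0 i|.
Proof. by rewrite /velocity mxE (le_trans (ler_normD _ _))// lerD2r. Qed.

Definition dirac_velocity (A a : R -> 'rV[R]_d) (s : R) (x : torus R d) : PRd :=
  \d_(velocity A a s x)%R.

Hypothesis hv : forall i (h : measurableTypeR R * Torus R d -> R) (H : R),
  measurable_fun setT h -> (forall y, `|h y| <= H) ->
  \int[(leb \x Q)%E]_(p in `[t, T] `*` [set: Z]) (u p.2 ord0 i * h (base_curve p)) =
  \int[(leb \x Q)%E]_(p in `[t, T] `*` [set: Z])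
    (v (base_curve p) ord0 i * h (base_curve p)).

Section admissibility.
Variables (A a : R -> 'rV[R]_d) (tau : nat -> R).
Hypothesis mA : measurable_fun setT (A : measurableTypeR R -> Rd R d).
Hypothesis ma : measurable_fun setT (a : measurableTypeR R -> Rd R d).
Hypothesis cA : {within `[t, T], continuous A}.
Hypothesis ia : forall i, leb.-integrable `[t, T] (EFin \o (fun s => a s ord0 i)).
Hypothesis tau0 : tau 0%N = t.
Hypothesis tau_lt : forall n, tau n < tau n.+1.
Hypothesis tauT : tau @ \oo --> T.
Hypothesis A_affine : forall n s, tau n <= s <= tau n.+1 ->
  A s = A (tau n) + (s - tau n) *: a (tau n).
Hypothesis a_constant : forall n s, tau n <= s < tau n.+1 -> a s = a (tau n).

Let mitv : measurable (`[t, T]%classic : set (measurableTypeR R)).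
Proof. exact: measurable_itv. Qed.

Let icst (k : R) : leb.-integrable `[t, T] (EFin \o cst k).
Proof.
by apply: integrable_cst_lty => //; rewrite /= lebesgue_measure_itv/= lte_fin tT -EFinB ltry.
Qed.

Let mai i : measurable_fun setT (fun s : measurableTypeR R => a s ord0 i).
Proof. by move/measurable_fun_rVP : ma. Qed.

Let tau_ge n : t <= tau n.
Proof. by elim: n => [|n IH]; [rewrite tau0|rewrite (le_trans IH)// ltW]. Qed.

Let tau_le n : tau n <= T.
Proof.
have nd : nondecreasing_seq tau by apply/nondecreasing_seqP => k; exact/ltW/tau_lt.
by have := nondecreasing_cvgn_le nd (cvgP _ tauT) n; rewrite (cvg_lim _ tauT).
Qed.

Let tau_in n : tau n \in `[t, T].
Proof. by rewrite in_itv /= tau_ge tau_le. Qed.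

(** A common integrable majorant in time: [C] bounds the derivatives of the test function and c +
    |a_i| the velocity coordinates. It relies on integrability of [a] alone, as [a] may be unbounded
    near [T]. *)
Let bound (C : R) (s : R) : R := C * (1 + \sum_i (c + `|a s ord0 i|)).

Let integrable_bound C : leb.-integrable `[t, T] (EFin \o bound C).
Proof.
apply: (integrable_EFinZl mitv); apply: (integrable_EFinD mitv (icst 1)).
apply: (integrable_EFin_sum mitv) => i; apply: (integrable_EFinD mitv (icst c)).
exact: (integrable_norm (ia i)).
Qed.

Section continuity_equation.
Variable phi : R -> torus R d -> R.
Hypothesis hphi : C1_test phi.

(** Inside a grid cell this is the time derivative of [phi] along the trajectory of [z], each
    particle moving with its own velocity. *)
Let along (z : Z) (s : R) : R :=
  dt phi s (pos A s z) + \sum_i (u z ord0 i + a s ord0 i) * grad phi s (pos A s z) ord0 i.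

Let mpos2 : measurable_fun setT (fun p : measurableTypeR R * Z => pos A p.1 p.2).
Proof.
apply: measurable_shifted_pos; [exact: measurable_fst|exact: measurable_snd|].
exact: (measurableT_comp mA (@measurable_fst _ _ _ _)).
Qed.

Let malong : measurable_fun setT (fun p : measurableTypeR R * Z => along p.2 p.1).
Proof.
apply: measurable_funD.
  apply: (measurable_dt hphi) => //; exact: measurable_fst.
apply: measurable_sum => i; apply: measurable_funM.
  apply: measurable_funD; first exact: (measurableT_comp (mui i) (@measurable_snd _ _ _ _)).
  exact: (measurableT_comp (mai i) (@measurable_fst _ _ _ _)).
apply: (measurable_grad hphi) => //; exact: measurable_fst.
Qed.

Let along_le C z s :
  (forall s x, s \in `[t, T] ->
  [/\ `|phi s x| <= C, `|dt phi s x| <= C & forall i, `|grad phi s x ord0 i| <= C]) ->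
  s \in `[t, T] -> `|along z s| <= bound C s.
Proof.
move=> hC sD; have [h1 h2 h3] := hC s (pos A s z) sD.
rewrite (le_trans (ler_normD _ _))// /bound mulrDr mulr1 lerD//.
rewrite (le_trans (ler_norm_sum _ _ _))// mulr_sumr ler_sum// => i _.
by rewrite mulrC normrM ler_pM// (le_trans (ler_normD _ _))// lerD2r.
Qed.

Let integrable_along z : leb.-integrable `[t, T] (EFin \o along z).
Proof.
have [C hC] := test_bounded hphi t T.
apply: le_integrable (integrable_bound C) => //.
  apply/measurable_EFinP/measurable_funTS.
  by apply: (measurableT_comp malong (measurable_pair2 z)).
by move=> s sD /=; rewrite lee_fin (le_trans (along_le z hC sD))// ler_norm.
Qed.

(** On a cell the trajectory is a straight line p + s w, so the fundamental theorem of calculus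
    applies; [p] is the line extrapolated to time 0. *)
Let increment_piece z n :
  \int[leb]_(s in `[tau n, tau n.+1]) along z s =
  phi (tau n.+1) (pos A (tau n.+1) z) - phi (tau n) (pos A (tau n) z).
Proof.
pose w := u z + a (tau n).
pose p := x0 z - t *: u z + A (tau n) - tau n *: a (tau n).
have lineE s : tau n <= s <= tau n.+1 -> base_pos s z + A s = p + s *: w.
  move=> sn; rewrite (A_affine sn) /base_pos /p /w; apply/rowP => i; rewrite !mxE; ring.
have sub : `[tau n, tau n.+1]%classic `<=` `[t, T]%classic.
  move=> s /=; rewrite !in_itv /= => /andP[h1 h2].
  by rewrite (le_trans (tau_ge n))// (le_trans h2 (tau_le _)).
(* The right endpoint, a null set, is dropped because [a] has the slope of this cell only on the
   half-open interval. *)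
rewrite -(Rintegral_itv_bndo_bndc (f := along z)); last first.
  apply: integrableS (integrable_along z) => //; apply: subset_trans sub => s /=.
  by rewrite !in_itv /= => /andP[-> /ltW].
transitivity (\int[leb]_(s in `[tau n, tau n.+1[) (dt phi s (pi (p + s *: w)) +
    \sum_i w ord0 i * dx phi s i (p + s *: w))).
  apply: eq_Rintegral => s /set_mem/=; rewrite in_itv /= => /andP[s1 s2].
  rewrite /along /pos lineE ?s1 ?ltW//; congr (_ + _); apply: eq_bigr => i _.
  by rewrite grad_proj mxE (@a_constant n s) ?s1.
rewrite Rintegral_itv_bndo_bndc; last first.
  apply: (@integrableS _ _ _ _ (`[tau n, tau n.+1]%classic : set (measurableTypeR R))) => //.
    by move=> s /=; rewrite !in_itv /= => /andP[-> /ltW].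
  apply: continuous_compact_integrable; first exact: segment_compact.
  exact/continuous_subspaceT/continuous_along_line.
by rewrite (increment_along_line hphi)// /pos !lineE// lexx ltW.
Qed.

Let increment_upto z n :
  \int[leb]_(s in `[t, tau n]) along z s = phi (tau n) (pos A (tau n) z) - phi t (pos A t z).
Proof.
elim: n => [|n IH]; first by rewrite tau0 set_itv1 Rintegral_set1 subrr.
have isub x y : t <= x -> y <= T -> leb.-integrable `[x, y] (EFin \o along z).
  move=> tx yT; apply: integrableS (integrable_along z) => // s /=.
  by rewrite !in_itv /= => /andP[h1 h2]; rewrite (le_trans tx)// (le_trans h2).
have := @Rintegral_itvB _ (along z) (BLeft t) (BRight (tau n.+1)) (tau n) (isub _ _ (lexx t) (tau_le n.+1)).
rewrite !bnd_simp => /(_ (tau_ge n) (ltW (tau_lt n))).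
rewrite Rintegral_itv_obnd_cbnd; last first.
  apply: integrableS (isub _ _ (tau_ge n) (tau_le n.+1)) => // s /=.
  by rewrite !in_itv /= => /andP[/ltW ->].
by rewrite increment_piece IH => /eqP; rewrite subr_eq => /eqP ->; ring.
Qed.

(** The time [T] is the limit of the cells and belongs to none. Both sides of [increment_upto]
    converge along [tau n]: the integral because [along z] is integrable, the other side because [A]
    is continuous up to [T]. *)
Let increment_along z :
  \int[leb]_(s in `[t, T]) along z s = phi T (pos A T z) - phi t (pos A t z).
Proof.
have tDT : (T : R) \in `[t, T] by rewrite in_itv /= lexx ltW.
have tau_within (G : R -> R) : {within `[t, T], continuous G} -> G (tau n) @[n --> \oo] --> G T.
  move=> /subspace_continuousP/(_ T tDT) H W /H HW.
  have {}HW : nbhs T (fun x => `[t, T]%classic x -> W (G x)) := HW.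
  have hn : \forall n \near \oo, `[t, T]%classic (tau n) -> W (G (tau n)) := tauT HW.
  suff : \forall n \near \oo, W (G (tau n)) by [].
  by apply: filterS hn => n; apply; exact: tau_in.
have l1 : (\int[leb]_(s in `[t, tau n]) along z s) @[n --> \oo] --> \int[leb]_(s in `[t, T]) along z s.
  apply: (tau_within (fun x => \int[leb]_(s in `[t, x]) along z s)).
  exact: (parameterized_integral_continuous (ltW tT) (integrable_along z)).
have l2 : (\int[leb]_(s in `[t, tau n]) along z s) @[n --> \oo] --> phi T (pos A T z) - phi t (pos A t z).
  under eq_cvg do rewrite increment_upto.
  apply: cvgB; last exact: cvg_cst.
  apply: (tau_within (fun s => phi s (pos A s z))).
  apply/subspace_continuousP => s sD.
  have hA := (subspace_continuousP _ A).1 cA s sD.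
  have h1 : (r : R) @[r --> within `[t, T] (nbhs s)] --> s by exact: cvg_within.
  have h2 : base_pos r z + A r @[r --> within `[t, T] (nbhs s)] --> base_pos s z + A s.
    apply: cvgD => //; apply: cvgD; first exact: cvg_cst.
    by apply: cvgZr_tmp; apply: cvgB => //; exact: cvg_cst.
  have h3 : phi r (pi (base_pos r z + A r)) @[r --> within `[t, T] (nbhs s)] -->
      phi s (pi (base_pos s z + A s)).
    have h12 : (r, base_pos r z + A r) @[r --> within `[t, T] (nbhs s)] -->
        (s, base_pos s z + A s) by exact: (cvg_pair h1 h2).
    move=> W HW.
    have HW2 : nbhs (s, base_pos s z + A s) (fun p : R * 'rV[R]_d => W (phi p.1 (pi p.2))).
      exact: (@continuous_test _ _ _ hphi (s, base_pos s z + A s) W HW).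
    exact: (h12 _ HW2).
  exact: h3.
exact: (cvg_unique _ l1 l2).
Qed.

(** The analogue of [along] with the particle's velocity replaced by the field; it depends on [z]
    only through the position. *)
Let alongv (z : Z) (s : R) : R :=
  dt phi s (pos A s z) +
  \sum_i velocity A a s (pos A s z) ord0 i * grad phi s (pos A s z) ord0 i.

Let along0 (p : measurableTypeR R * Z) : R :=
  dt phi p.1 (pos A p.1 p.2) + \sum_i a p.1 ord0 i * grad phi p.1 (pos A p.1 p.2) ord0 i.

(** The test function given to the conditional expectation: the gradient at the shifted position, as
    a function of the unshifted one. The indicator makes it bounded, since [test_bounded] controls
    only a compact time interval. *)
Let h i (y : measurableTypeR R * Torus R d) : R :=
  \1_(`[t, T]%classic : set (measurableTypeR R)) y.1 *
  grad phi y.1 (translate (pi (A y.1)) y.2) ord0 i.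

Let h_base_curve i p : (`[t, T] `*` [set: Z]) p ->
  h i (base_curve p) = grad phi p.1 (pos A p.1 p.2) ord0 i.
Proof.
by move=> [sD _]; rewrite /h /= indicE mem_set// mul1r torus_projD.
Qed.

Let mh i : measurable_fun setT (h i).
Proof.
apply: measurable_funM.
  by apply: (measurableT_comp (measurable_indic mitv)); exact: measurable_fst.
apply: (measurable_grad hphi); first exact: measurable_fst.
apply: measurable_translate; last exact: measurable_snd.
exact: (measurableT_comp mA (@measurable_fst _ _ _ _)).
Qed.

Let mi i (w : measurableTypeR R * Z -> 'rV[R]_d) :
  measurable_fun setT (w : _ -> Rd R d) ->
  measurable_fun setT (fun p => w p ord0 i).
Proof. by move/measurable_fun_rVP. Qed.

Let measurable_along0 : measurable_fun setT along0.
Proof.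
apply: measurable_funD.
  by apply: (measurable_dt hphi) => //; exact: measurable_fst.
apply: measurable_sum => i; apply: measurable_funM.
  exact: (measurableT_comp (mai i) (@measurable_fst _ _ _ _)).
by apply: (measurable_grad hphi) => //; exact: measurable_fst.
Qed.

Let integrable_along0 : (leb \x Q)%E.-integrable (`[t, T] `*` [set: Z]) (EFin \o along0).
Proof.
have [C hC] := test_bounded hphi t T.
apply: (integrable_prod Q mitv _ (integrable_bound C)).
  exact: (measurable_funTS measurable_along0).
move=> s z sD; have [h1 h2 h3] := hC s (pos A s z) sD.
rewrite (le_trans (ler_normD _ _))// /bound mulrDr mulr1 lerD//.
rewrite (le_trans (ler_norm_sum _ _ _))// mulr_sumr ler_sum// => i _.
rewrite mulrC normrM ler_pM// lerDr.
by have := uc z i; exact: le_trans.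
Qed.

Let integrable_wh i (w : measurableTypeR R * Z -> 'rV[R]_d) :
  measurable_fun setT (w : _ -> Rd R d) -> (forall p, `|w p ord0 i| <= c) ->
  (leb \x Q)%E.-integrable (`[t, T] `*` [set: Z])
    (EFin \o (fun p => w p ord0 i * h i (base_curve p))).
Proof.
move=> mw wc; have [C hC] := test_bounded hphi t T.
apply: (integrable_prod Q mitv _ (icst (c * C))).
  apply: measurable_funTS; apply: measurable_funM; first exact: mi.
  exact: (measurableT_comp (mh i) measurable_base_curve).
move=> s z sD; rewrite h_base_curve//= normrM ler_pM//.
by have [_ _] := hC s (pos A s z) sD; exact.
Qed.

Let h_le : exists H, forall i y, `|h i y| <= H.
Proof.
have [C hC] := test_bounded hphi t T.
exists `|C| => i y; rewrite /h indicE; have [|_] := boolP (_ \in _); last by rewrite mul0r normr0.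
move=> /set_mem sD; rewrite mul1r; have [_ _ /(_ i)] := hC y.1 (translate (pi (A y.1)) y.2) sD.
by move/le_trans; apply; exact: ler_norm.
Qed.

Let mu2 : measurable_fun setT ((fun p : measurableTypeR R * Z => u p.2) : _ -> Rd R d).
Proof. exact: (measurableT_comp mu_ (@measurable_snd _ _ _ _)). Qed.

Let mv2 : measurable_fun setT ((fun p : measurableTypeR R * Z => v (base_curve p)) : _ -> Rd R d).
Proof. exact: (measurableT_comp mv measurable_base_curve). Qed.

(** Isolates the part linear in the particle velocity, the only one that conditioning affects.
    Taking for [w] the velocity [u] gives [along], taking [v] at [base_curve] gives [alongv]. *)
Let along_decomp (w : measurableTypeR R * Z -> 'rV[R]_d) :
  measurable_fun setT (w : _ -> Rd R d) -> (forall p i, `|w p ord0 i| <= c) ->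
  \int[(leb \x Q)%E]_(p in `[t, T] `*` [set: Z])
    (dt phi p.1 (pos A p.1 p.2) + \sum_i (w p ord0 i + a p.1 ord0 i) * grad phi p.1 (pos A p.1 p.2) ord0 i) =
  \int[(leb \x Q)%E]_(p in `[t, T] `*` [set: Z]) along0 p +
  \sum_i \int[(leb \x Q)%E]_(p in `[t, T] `*` [set: Z]) (w p ord0 i * h i (base_curve p)).
Proof.
move=> mw wc; have mDT : measurable (`[t, T]%classic `*` [set: Z] : set (measurableTypeR R * Z)).
  exact: measurableX.
rewrite -(Rintegral_sum mDT); last by move=> i; apply: integrable_wh.
rewrite -(RintegralD mDT integrable_along0); last first.
  by apply: (integrable_EFin_sum mDT) => i; apply: integrable_wh.
apply: eq_Rintegral => p /set_mem pD; rewrite /along0 -addrA; congr (_ + _).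
rewrite -big_split /=; apply: eq_bigr => i _; rewrite h_base_curve//; ring.
Qed.

Let alongE : \int[(leb \x Q)%E]_(p in `[t, T] `*` [set: Z]) along p.2 p.1 =
  \int[(leb \x Q)%E]_(p in `[t, T] `*` [set: Z]) alongv p.2 p.1.
Proof.
rewrite /along (along_decomp mu2 (fun p => uc p.2)).
transitivity (\int[(leb \x Q)%E]_(p in `[t, T] `*` [set: Z])
    (dt phi p.1 (pos A p.1 p.2) + \sum_i (v (base_curve p) ord0 i + a p.1 ord0 i) *
      grad phi p.1 (pos A p.1 p.2) ord0 i)).
  rewrite (along_decomp mv2 (fun p => vc (base_curve p))); congr (_ + _).
  apply: eq_bigr => i _; have [H hH] := h_le.
  by have := hv i (mh i) (hH i).
apply: eq_Rintegral => -[s z] _; rewrite /alongv; congr (_ + _); apply: eq_bigr => i _.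
by congr (_ * _); rewrite [in RHS]/= velocity_pos [RHS]mxE.
Qed.

(** The increment along each particle is integrated over [Q], Fubini exchanges the integrals, and
    [u] is replaced by [v]. Only then is the integrand a function of the position, so that at each
    time it can be integrated against the law [flow A s]. *)
Lemma flow_continuity_equation :
  \int[Q]_z phi T (pos A T z) - \int[Q]_z phi t (pos A t z) =
  \int[leb]_(s in `[t, T]) \int[flow A s]_x
    (dt phi s x +
     \sum_i (\int[dirac_velocity A a s x]_z (z : 'rV[R]_d) ord0 i) * grad phi s x ord0 i).
Proof.
have [C hC] := test_bounded hphi t T.
have mD : measurable_fun (`[t, T]%classic `*` [set: Z] : set (measurableTypeR R * Z))
  (fun p => along p.2 p.1) by exact: measurable_funTS.
have inta := integrable_prod Q mitv mD (integrable_bound C) (fun s z sD => along_le z hC sD).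
have malongv : measurable_fun setT (fun p : measurableTypeR R * Z => alongv p.2 p.1).
  apply: measurable_funD; first by apply: (measurable_dt hphi) => //; exact: measurable_fst.
  apply: measurable_sum => i; apply: measurable_funM; last first.
    by apply: (measurable_grad hphi) => //; exact: measurable_fst.
  have := @measurable_velocity _ _ fst (fun p : measurableTypeR R * Z => pos A p.1 p.2)
    (A \o fst) (a \o fst) (@measurable_fst _ _ _ _) mpos2
    (measurableT_comp mA (@measurable_fst _ _ _ _))
    (measurableT_comp ma (@measurable_fst _ _ _ _)).
  by move/measurable_fun_rVP.
have alongv_le s z : s \in `[t, T] -> `|alongv z s| <= bound C s.
  move=> sD; have [h1 h2 h3] := hC s (pos A s z) sD.
  rewrite (le_trans (ler_normD _ _))// /bound mulrDr mulr1 lerD//.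
  rewrite (le_trans (ler_norm_sum _ _ _))// mulr_sumr ler_sum// => i _.
  by rewrite mulrC normrM ler_pM// velocity_le.
have intv : (leb \x Q)%E.-integrable (`[t, T] `*` [set: Z]) (EFin \o (fun p => alongv p.2 p.1)).
  by apply: (integrable_prod Q mitv _ (integrable_bound C)) => //; exact: measurable_funTS.
have iphi s : s \in `[t, T] -> Q.-integrable setT (EFin \o (fun z => phi s (pos A s z))).
  move=> sD; apply: (@bounded_integrable _ _ _ Q _ _ C) => //.
    apply: (measurable_test hphi); [exact: measurable_cst|exact: measurable_pos].
  by move=> z _; have [] := hC s (pos A s z) sD.
rewrite -RintegralB//; [|apply: iphi; rewrite in_itv /= lexx ltW//..].
under eq_Rintegral do rewrite -increment_along.
rewrite -(prod_iterated_QD mitv inta); last by move=> z; exact: integrable_along.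
rewrite alongE (prod_iterated_DQ mitv intv); last first.
  move=> s sD; apply: (@bounded_integrable _ _ _ Q _ _ (bound C s)) => //.
    exact: (measurableT_comp malongv (measurable_pair1 s)).
  by move=> z _; exact: alongv_le.
apply: eq_Rintegral => s /set_mem sD.
have velE x i : \int[dirac_velocity A a s x]_z (z : 'rV[R]_d) ord0 i = velocity A a s x ord0 i.
  rewrite /Rintegral integral_dirac// ?diracT ?mul1e//.
  by apply/measurable_EFinP; exact: measurable_coord.
under [in RHS]eq_Rintegral do under eq_bigr do rewrite velE.
have mint : measurable_fun [set: Torus R d] (fun x =>
    dt phi s x + \sum_i velocity A a s x ord0 i * grad phi s x ord0 i).
  apply: measurable_funD; first by apply: (measurable_dt hphi) => //; exact: measurable_cst.
  apply: measurable_sum => i; apply: measurable_funM; last first.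
    by apply: (measurable_grad hphi) => //; exact: measurable_cst.
  have := @measurable_velocity _ _ (cst s) id (cst (A s)) (cst (a s)) (measurable_cst _)
    (@measurable_id _ _ _) (measurable_cst _) (measurable_cst _).
  by move/measurable_fun_rVP.
apply/esym/(Rintegral_law (measurable_pos A s) mint).
apply: (@bounded_integrable _ _ _ Q _ _ (bound C s)) => //.
  exact: (measurableT_comp malongv (measurable_pair1 s)).
by move=> z _; exact: alongv_le.
Qed.

End continuity_equation.

Lemma flow_weakly_continuous : weakly_continuous t T (flow A).
Proof.
move=> f cf.
(* Freezing time outside [t, T] gives a path continuous on the whole line, so that continuity under
   the integral applies on an open interval around [t, T], with the bound of [f] as dominating
   constant. *)
pose clamp (s : R) := Num.max t (Num.min s T).
have clamp_id s : s \in `[t, T] -> clamp s = s.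
  by rewrite in_itv /= => /andP[ts sT]; rewrite /clamp (min_idPl sT) (max_idPr ts).
have clamp_in s : clamp s \in `[t, T].
  by rewrite in_itv /= /clamp le_max lexx /= ge_max ge_min lexx orbT (ltW tT).
have cclamp : continuous clamp.
  move=> s; apply: (@continuous_max _ _ (cst t) (fun s => Num.min s T)); first exact: cvg_cst.
  by apply: (@continuous_min _ _ id (cst T)); [exact: cvg_id|exact: cvg_cst].
have cg : continuous (fun p : R * 'rV[R]_d => f (pi p.2)).
  move=> p; apply: continuous_comp; last exact: cf.
  by apply: continuous_comp; [exact: cvg_snd|exact: continuous_torus_proj].
have [C hC] := continuous_bounded_cell t T cg.
have fC x : `|f x| <= C.
  have := hC t (torus_rep x); rewrite /= torus_repK; apply; first by rewrite in_itv /= lexx ltW.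
  by move=> i; have /andP[-> /ltW] := torus_rep_itv x i.
have mf : measurable_fun [set: Torus R d] f by exact: continuous_measurable_real.
have cAc : continuous (A \o clamp).
  move=> s W /= HW.
  have := (subspace_continuousP _ A).1 cA (clamp s) (clamp_in s) W HW => {}HW.
  have {}HW : \forall r \near s, clamp r \in `[t, T] -> W (A (clamp r)) := cclamp s _ HW.
  suff : \forall r \near s, W (A (clamp r)) by [].
  by apply: filterS HW => r; apply; exact: clamp_in.
pose F s z := f (pos A (clamp s) z).
have cF : {in `]t - 1, T + 1[%classic, continuous (fun s => \int[Q]_z F s z)}.
  apply: (@continuity_under_integral _ _ _ Q F setT measurableT (t - 1) (T + 1) _ _ (cst C)).
  - move=> s _; apply: (@bounded_integrable _ _ _ Q _ _ C) => //.
      exact: (measurableT_comp mf (measurable_pos A (clamp s))).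
    by move=> z _; exact: fC.
  - apply: aeW => z _ s _ /=.
    apply: continuous_comp; last exact: cf.
    apply: continuous_comp; last exact: continuous_torus_proj.
    apply: continuousD; last exact: cAc.
    apply: continuousD; first exact: cst_continuous.
    by apply: cvgZr_tmp; apply: cvgB; [exact: cclamp|exact: cvg_cst].
  - exact: finite_measure_integrable_cst.
  - by move=> s _; apply: aeW => z _; exact: fC.
have E s : s \in `[t, T] -> \int[flow A s]_x f x = \int[Q]_z F s z.
  move=> sD; rewrite Rintegral_law//; last first.
    apply: (@bounded_integrable _ _ _ Q _ _ C) => //.
    exact: (measurableT_comp mf (measurable_pos A s)).
  by apply: eq_Rintegral => z _; rewrite /F clamp_id.
apply/subspace_continuousP => s sD.
suff : \int[flow A r]_x f x @[r --> within `[t, T] (nbhs s)] --> \int[flow A s]_x f x by [].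
rewrite E//.
have HF : \int[Q]_z F r z @[r --> within `[t, T] (nbhs s)] --> \int[Q]_z F s z.
  apply: cvg_trans (cF s _); last first.
    by apply/mem_set; move: sD; rewrite /= !in_itv /= => /andP[? ?]; apply/andP; split; lra.
  exact: cvg_app (cvg_within _).
apply: cvg_trans HF; apply: near_eq_cvg.
by apply: filterS (withinT _ _) => r rD; rewrite E.
Qed.

Lemma flow_integrable_speed :
  (\int[leb]_(s in `[t, T]) \int[flow A s]_x \int[dirac_velocity A a s x]_z
     (enorm (z : 'rV[R]_d))%:E < +oo)%E.
Proof.
apply: le_lt_trans (integrable_lty mitv (integrable_bound 1)).
apply: le_integral_ge0 => s sD.
  by apply: integral_ge0 => x _; apply: integral_ge0 => z _; rewrite lee_fin sqrtr_ge0.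
rewrite [leRHS]/= -(integral_probability_cst (flow A s) (bound 1 s)).
apply: le_integral_ge0 => x _.
  by apply: integral_ge0 => z _; rewrite lee_fin sqrtr_ge0.
rewrite integral_dirac//; last first.
  by apply/measurable_EFinP; exact: measurable_enorm.
rewrite diracT mul1e lee_fin /bound mul1r (le_trans (enorm_le_sum _))//.
apply: (@le_trans _ _ (\sum_i (c + `|a s ord0 i|))); last by rewrite lerDr.
by apply: ler_sum => i _; exact: velocity_le.
Qed.

Lemma flow_admissible (mu0 nu0 : PT) :
  (forall B, measurable B -> mu0 B = Q (pos A t @^-1` B)) ->
  (forall B, measurable B -> nu0 B = Q (pos A T @^-1` B)) ->
  Adm t T mu0 nu0 (dirac_velocity A a) (flow A).
Proof.
move=> hmu hnu; split.
- split; first exact: flow_weakly_continuous.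
  + by move=> B mB; rewrite hmu.
  + by move=> B mB; rewrite hnu.
- apply: measurable_fun_dirac_comp; apply: measurable_funTS.
  have := @measurable_velocity _ _ fst snd (A \o fst) (a \o fst) (@measurable_fst _ _ (measurableTypeR R) _)
    (@measurable_snd _ _ _ (Torus R d))
    (measurableT_comp mA (@measurable_fst _ _ _ _))
    (measurableT_comp ma (@measurable_fst _ _ _ _)).
  exact.
- exact: flow_integrable_speed.
- move=> phi hphi; rewrite -(flow_continuity_equation hphi).
  have [C hC] := test_bounded hphi t T.
  have ER (m : PT) s : s \in `[t, T] -> (forall B, measurable B -> m B = Q (pos A s @^-1` B)) ->
      \int[m]_x phi s x = \int[Q]_z phi s (pos A s z).
    move=> sD hm; have mphi : measurable_fun [set: Torus R d] (phi s).
      by apply: (measurable_test hphi); [exact: measurable_cst|exact: measurable_id].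
    rewrite -(Rintegral_law (measurable_pos A s)); [|exact: mphi|]; last first.
      apply: (@bounded_integrable _ _ _ Q _ _ C) => //.
        exact: (measurableT_comp mphi (measurable_pos A s)).
      by move=> z _; have [] := hC s (pos A s z) sD.
    by rewrite /Rintegral; congr fine; apply: eq_measure_integral => B mB _; exact: hm.
  by congr (_ - _); apply: ER => //; rewrite in_itv /= lexx ltW.
Qed.

End admissibility.
End transport.

(** * Second moments of Ito integrals *)

Section normal_moments.
Context {R : realType}.
Local Notation leb := (@lebesgue_measure R).

Lemma ge0_integral_normal_prob (m s : R) (g : measurableTypeR R -> \bar R) :
  (forall x, 0 <= g x)%E -> measurable_fun [set: measurableTypeR R] g ->
  (\int[normal_prob m s]_x g x = \int[leb]_x (g x * (normal_pdf m s x)%:E))%E.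
Proof.
move=> g0 mg; have ipdf := integrable_normal_pdf m s.
have nP := @normal_prob_dominates R m s.
rewrite -(Radon_Nikodym_SigmaFinite.change_of_variables nP)//.
have mf := measurable_int _ ipdf.
apply: ge0_ae_eq_integral => //.
- apply: emeasurable_funM => //.
  exact: measurable_int (Radon_Nikodym_SigmaFinite.f_integrable _).
- exact: emeasurable_funM.
- by move=> x _; apply: mule_ge0 => //; exact: Radon_Nikodym_SigmaFinite.f_ge0.
- by move=> x _; apply: mule_ge0 => //; rewrite lee_fin normal_pdf_ge0.
- apply: ae_eqe_mul2l; apply: integral_ae_eq => //.
    exact: Radon_Nikodym_SigmaFinite.f_integrable.
  by move=> A _ mA; rewrite -Radon_Nikodym_SigmaFinite.f_integral.
Qed.

(** With y = x^2 / (4 s^2) the Gaussian exponent is -2 y. One factor exp(-y) absorbs y, since y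
    exp(-y) <= 1; the other is the shape of the Gaussian of deviation sqrt 2 s, whose peak is lower
    by a factor sqrt 2 <= 2. Hence the constant 4 times 2. *)
Lemma sqr_normal_pdf_le (s x : R) : 0 < s ->
  x ^+ 2 * normal_pdf 0 s x <= 8 * s ^+ 2 * normal_pdf 0 (Num.sqrt 2 * s) x.
Proof.
move=> s0; have s2 : 0 < Num.sqrt 2 * s by rewrite mulr_gt0// sqrtr_gt0.
rewrite !normal_pdfE ?gt_eqF// /normal_fun !subr0.
rewrite exprMn sqr_sqrtr//.
set y := x ^+ 2 / (4 * s ^+ 2).
have sN : s != 0 by rewrite gt_eqF.
have y0 : 0 <= y by apply: divr_ge0; [exact: sqr_ge0|apply: mulr_ge0 => //; exact: sqr_ge0].
have -> : - x ^+ 2 / (s ^+ 2 *+ 2) = - y + - y by rewrite /y; field.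
have -> : - x ^+ 2 / ((2 * s ^+ 2) *+ 2) = - y by rewrite /y; field.
have -> : x ^+ 2 = y * (4 * s ^+ 2) by rewrite /y; field.
rewrite expRD.
have pk : normal_peak s <= 2 * normal_peak (Num.sqrt 2 * s).
  rewrite /normal_peak exprMn sqr_sqrtr//.
  have p0 : 0 < s ^+ 2 * pi *+ 2 by rewrite pmulrn_lgt0// mulr_gt0 ?pi_gt0 ?exprn_gt0.
  have -> : 2 * s ^+ 2 * pi *+ 2 = 2 * (s ^+ 2 * pi *+ 2) by ring.
  rewrite sqrtrM// invfM mulrA -[leLHS]mul1r ler_pM2r ?invr_gt0 ?sqrtr_gt0//.
  rewrite ler_pdivlMr ?sqrtr_gt0// mul1r -[leRHS]ger0_norm// -sqrtr_sqr ler_sqrt ?exprn_ge0//.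
  by rewrite expr2; lra.
have ey : y * expR (- y) <= 1.
  rewrite expRN ler_pdivrMr ?expR_gt0// mul1r.
  by apply: le_trans (expR_ge1Dx y); lra.
have pk0 := normal_peak_ge0 (Num.sqrt 2 * s).
have s4 : 0 <= 4 * s ^+ 2 by apply: mulr_ge0 => //; exact: sqr_ge0.
apply: (@le_trans _ _ ((4 * s ^+ 2) * (y * expR (- y)) * (2 * normal_peak (Num.sqrt 2 * s)) * expR (- y))).
  rewrite [leLHS](_ : _ = (4 * s ^+ 2) * (y * expR (- y)) * normal_peak s * expR (- y)); last by ring.
  rewrite ler_wpM2r ?expR_ge0// ler_wpM2l// mulr_ge0//.
  by rewrite mulr_ge0 ?expR_ge0.
rewrite [leRHS](_ : _ = (4 * s ^+ 2) * 1 * (2 * normal_peak (Num.sqrt 2 * s)) * expR (- y)); last by ring.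
by rewrite ler_wpM2r ?expR_ge0// ler_wpM2r ?mulr_ge0// ler_wpM2l.
Qed.

Lemma normal_second_moment (s : R) : 0 < s ->
  (\int[normal_prob 0 s]_x (x ^+ 2)%:E <= (8 * s ^+ 2)%:E)%E.
Proof.
move=> s0; rewrite ge0_integral_normal_prob//; last 2 first.
- by move=> x; rewrite lee_fin sqr_ge0.
- by apply/measurable_EFinP; exact: exprn_measurable.
apply: (@le_trans _ _ (\int[leb]_x ((8 * s ^+ 2)%:E * (normal_pdf 0 (Num.sqrt 2 * s) x)%:E))%E).
  apply: le_integral_ge0 => x _.
    by rewrite -EFinM lee_fin mulr_ge0 ?sqr_ge0 ?normal_pdf_ge0.
  by rewrite -!EFinM lee_fin sqr_normal_pdf_le.
rewrite ge0_integralZl//; last 3 first.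
- by apply/measurable_EFinP; exact: measurable_normal_pdf.
- by move=> x _; rewrite lee_fin normal_pdf_ge0.
- by rewrite lee_fin mulr_ge0// sqr_ge0.
by rewrite integral_normal_pdf mule1.
Qed.

Lemma normal_prob_symmetric (s : R) (A : set (measurableTypeR R)) : s != 0 -> measurable A ->
  normal_prob 0 s (-%R @^-1` A) = normal_prob 0 s A.
Proof.
move=> s0 mA; have mN :
    measurable_fun [set: measurableTypeR R] (-%R : measurableTypeR R -> measurableTypeR R).
  exact: (@oppr_measurable R setT).
have mp : measurable_fun A (fun x => (normal_pdf 0 s x)%:E).
  by apply: measurable_funTS; apply/measurable_EFinP; exact: measurable_normal_pdf.
have p0 : {in A, forall x, 0 <= (normal_pdf 0 s x)%:E}%E.
  by move=> x _; rewrite lee_fin normal_pdf_ge0.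
rewrite /normal_prob; transitivity
    (\int[pushforward leb (-%R : measurableTypeR R -> measurableTypeR R)]_(x in A) (normal_pdf 0 s x)%:E)%E.
  rewrite (ge0_integral_pushforward mN leb mA mp p0).
  apply: eq_integral => x _; congr EFin.
  by rewrite !normal_pdfE// /normal_fun !subr0 sqrrN.
by apply: eq_measure_integral => //= B mB _; exact: lebesgue_measureN.
Qed.

End normal_moments.

Section independent_symmetric.
Context d (T : measurableType d) (R : realType) (P : probability T R).
Implicit Types X Y : T -> R.

Lemma normal_variable_sqr Y (s : R) : 0 < s -> measurable_fun [set: T] Y ->
  (forall A : set R, measurable A -> P (Y @^-1` A) = normal_prob 0 s A) ->
  (\int[P]_w (Y w ^+ 2)%:E <= (8 * s ^+ 2)%:E)%E.
Proof.
move=> s0 mY YE.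
have mY' : measurable_fun [set: T] (Y : T -> measurableTypeR R) by exact: mY.
apply: le_trans (normal_second_moment s0).
rewrite -(ge0_integral_law P mY' (f := fun x => (x ^+ 2)%:E)); last 2 first.
- by apply/measurable_EFinP; exact: exprn_measurable.
- by move=> y; rewrite lee_fin sqr_ge0.
rewrite (eq_measure_integral (normal_prob 0 s))// => A mA _.
by rewrite /= lawE YE.
Qed.

(* (X, Y) and (X, -Y) have the same law, so that X + Y and X - Y have the same
   second moment; conclude by the parallelogram identity, which needs no
   integrability. *)
Lemma integral_sqr_independentD X Y :
  measurable_fun [set: T] X -> measurable_fun [set: T] Y ->
  (forall A B : set R, measurable A -> measurable B ->
    P (X @^-1` A `&` Y @^-1` B) = (P (X @^-1` A) * P (Y @^-1` B))%E) ->
  (forall B : set R, measurable B ->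
    P (Y @^-1` (-%R @^-1` B)) = P (Y @^-1` B)) ->
  (\int[P]_w ((X w + Y w) ^+ 2)%:E =
   \int[P]_w (X w ^+ 2)%:E + \int[P]_w (Y w ^+ 2)%:E)%E.
Proof.
move=> mX mY XY symY.
have mNY : measurable_fun [set: T] (fun w => - Y w) by exact: measurableT_comp.
have mXY : measurable_fun [set: T] (fun w => (X w, Y w)) by exact: measurable_fun_pair.
have mXNY : measurable_fun [set: T] (fun w => (X w, - Y w)) by exact: measurable_fun_pair.
have mN (B : set R) : measurable B -> measurable (-%R @^-1` B : set R).
  by move=> mB; rewrite -[X in measurable X]setTI; exact: oppr_measurable.
have lawXY A : measurable A -> law P mXY A = law P mXNY A.
  move=> mA; rewrite -(product_measure_unique (m1 := law P mX) (m2 := law P mY))//.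
  apply: (product_measure_unique (m1 := law P mX) (m2 := law P mY)) => // {mA}A B mA mB.
  transitivity (P (X @^-1` A `&` Y @^-1` (-%R @^-1` B))) => //.
  rewrite XY//; last exact: mN.
  by rewrite symY.
pose f (p : R * R) : \bar R := ((p.1 + p.2) ^+ 2)%:E.
have mf : measurable_fun [set: R * R] f.
  by apply/measurable_EFinP; apply: measurable_funX; exact: measurable_funD.
have f0 p : (0 <= f p)%E by rewrite lee_fin sqr_ge0.
have SD : (\int[P]_w ((X w + Y w) ^+ 2)%:E = \int[P]_w ((X w - Y w) ^+ 2)%:E)%E.
  rewrite -(ge0_integral_law P mXY mf f0) -(ge0_integral_law P mXNY mf f0).
  by apply: eq_measure_integral => A mA _; exact: lawXY.
have mX2 : measurable_fun [set: T] (fun w => (X w ^+ 2)%:E).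
  by apply/measurable_EFinP; exact: measurable_funX.
have mY2 : measurable_fun [set: T] (fun w => (Y w ^+ 2)%:E).
  by apply/measurable_EFinP; exact: measurable_funX.
have E2 (x : \bar R) : (x + x = 2%:E * x)%E by rewrite -[2]/(1 + 1 : R) EFinD ge0_muleDl ?lee01// mul1e.
suff H : (2%:E * \int[P]_w ((X w + Y w) ^+ 2)%:E =
    2%:E * (\int[P]_w (X w ^+ 2)%:E + \int[P]_w (Y w ^+ 2)%:E))%E.
  by move/(congr1 (mule (2^-1)%:E)): H; rewrite !muleA -EFinM mulVf// !mul1e.
rewrite -!E2 {2}SD -ge0_integralD//; last 4 first.
- by move=> w _; rewrite lee_fin sqr_ge0.
- by apply/measurable_EFinP; apply: measurable_funX; exact: measurable_funD.
- by move=> w _; rewrite lee_fin sqr_ge0.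
- by apply/measurable_EFinP; apply: measurable_funX; exact: measurable_funB.
have X0 w : [set: T] w -> (0 <= (X w ^+ 2)%:E)%E by rewrite lee_fin sqr_ge0.
have Y0 w : [set: T] w -> (0 <= (Y w ^+ 2)%:E)%E by rewrite lee_fin sqr_ge0.
rewrite -(ge0_integralD P measurableT X0 mX2 Y0 mY2).
have XY0 w : [set: T] w -> (0 <= (X w ^+ 2)%:E + (Y w ^+ 2)%:E)%E.
  by move=> wT; exact: adde_ge0 (X0 w wT) (Y0 w wT).
have mXY2 := emeasurable_funD mX2 mY2.
rewrite -(ge0_integralD P measurableT XY0 mXY2 XY0 mXY2).
by apply: eq_integral => w _; rewrite -!EFinD; congr EFin; ring.
Qed.

End independent_symmetric.

Section brownian_increments.
Context {R : realType} {d : nat} {dO : measure_display} {Omega : measurableType dO}.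
Variables (P : probability Omega R) (F : R -> set (set Omega)).
Variable B : R -> Omega -> 'rV[R]_d.
Hypotheses (hF : filtration F) (hB : brownian_motion P F B).

Lemma filtration_measurableE s (A : set Omega) : 0 <= s ->
  measurable (A : set (g_sigma_algebraType (F s))) = F s A.
Proof.
move=> s0; have [+ _ _] := hF => /(_ s s0) sF.
by rewrite -[in RHS](sigma_algebra_id sF).
Qed.

Lemma measurable_fun_filtration_le d' (S : measurableType d') (s r : R) (f : Omega -> S) :
  0 <= s -> s <= r ->
  measurable_fun [set: g_sigma_algebraType (F s)] (f : g_sigma_algebraType (F s) -> S) ->
  measurable_fun [set: g_sigma_algebraType (F r)] (f : g_sigma_algebraType (F r) -> S).
Proof.
move=> s0 sr mf _ A mA.
have mA' : measurable ([set: g_sigma_algebraType (F s)] `&` f @^-1` A) by exact: mf.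
rewrite filtration_measurableE// in mA'.
rewrite filtration_measurableE//; last exact: le_trans sr.
by have [_ _ /(_ s r s0 sr)] := hF; apply.
Qed.

Lemma measurable_fun_filtration d' (S : measurableType d') (s : R) (f : Omega -> S) :
  0 <= s ->
  measurable_fun [set: g_sigma_algebraType (F s)] (f : g_sigma_algebraType (F s) -> S) ->
  measurable_fun [set: Omega] f.
Proof.
move=> s0 mf _ A mA.
have mA' : measurable ([set: g_sigma_algebraType (F s)] `&` f @^-1` A) by exact: mf.
rewrite filtration_measurableE// in mA'.
by have [_ /(_ s s0) + _] := hF; apply.
Qed.

Lemma adapted_coord (D : set R) (Y : R -> Omega -> 'rV[R]_d) i s :
  adapted D F Y -> D s ->
  measurable_fun [set: g_sigma_algebraType (F s)]
    (fun w : g_sigma_algebraType (F s) => Y s w ord0 i).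
Proof.
move=> /(_ s) mY Ds.
exact: (measurableT_comp (measurable_coord i) (mY Ds)).
Qed.

Let brownian_coord i s : 0 <= s ->
  measurable_fun [set: g_sigma_algebraType (F s)]
    (fun w : g_sigma_algebraType (F s) => B s w ord0 i).
Proof. by move=> s0; have [mB _ _ _ _] := hB; exact: (adapted_coord i mB). Qed.

Definition increment (s r : R) (i : 'I_d) (w : Omega) : R := (B r w - B s w) ord0 i.

Lemma measurable_increment s r i : 0 <= s -> s <= r ->
  measurable_fun [set: g_sigma_algebraType (F r)]
    (fun w : g_sigma_algebraType (F r) => increment s r i w).
Proof.
move=> s0 sr; rewrite /increment; under eq_fun do rewrite !mxE.
apply: measurable_funB; first by apply: brownian_coord; exact: le_trans sr.
apply: measurable_fun_filtration_le sr _ => //; exact: brownian_coord.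
Qed.

Lemma increment_law s r i (A : set R) : 0 <= s -> s < r -> measurable A ->
  P (increment s r i @^-1` A) = normal_prob 0 (Num.sqrt (r - s)) A.
Proof.
move=> s0 sr mA; have [_ _ _ _ /(_ s r (fun j => if j == i then A else setT) s0 sr)] := hB.
rewrite (bigD1 i)//= eqxx [X in (_ * X)%E]big1 ?mule1; last first.
  by move=> j /negPf ->; rewrite probability_setT.
move=> <-; last by move=> j; case: ifP.
congr (P _); apply/seteqP; split => w /=.
  by move=> Aw j; case: eqP => // ->.
by move=> /(_ i); rewrite eqxx.
Qed.

Lemma increment_eq0 s i : increment s s i = cst 0.
Proof. by apply/funext => w; rewrite /increment subrr mxE. Qed.

Lemma increment_sqr s r i : 0 <= s -> s <= r ->
  (\int[P]_w (increment s r i w ^+ 2)%:E <= (8 * (r - s))%:E)%E.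
Proof.
move=> s0; rewrite le_eqVlt => /predU1P[<-|sr].
  rewrite increment_eq0; under eq_integral do rewrite expr0n/=.
  by rewrite integral0 subrr mulr0.
have h : 0 <= r - s by rewrite subr_ge0 ltW.
rewrite -[X in (8 * X)%:E]sqr_sqrtr//.
apply: normal_variable_sqr; first by rewrite sqrtr_gt0 subr_gt0.
  apply: (@measurable_fun_filtration _ _ r); first by rewrite ltW// (le_lt_trans s0).
  exact: measurable_increment (ltW sr).
by move=> A mA; exact: increment_law.
Qed.

Lemma increment_symmetric s r i (A : set R) : 0 <= s -> s <= r -> measurable A ->
  P (increment s r i @^-1` (-%R @^-1` A)) = P (increment s r i @^-1` A).
Proof.
move=> s0 + mA; rewrite le_eqVlt => /predU1P[<-|sr].
  by rewrite increment_eq0; congr (P _); apply/seteqP; split => w /=; rewrite oppr0.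
have mN : measurable (-%R @^-1` A : set R).
  by rewrite -[X in measurable X]setTI; exact: oppr_measurable.
rewrite !increment_law//; apply: normal_prob_symmetric => //.
by rewrite gt_eqF// sqrtr_gt0 subr_gt0.
Qed.

Lemma increment_independent s r i (X : Omega -> R) : 0 <= s -> s <= r ->
  measurable_fun [set: g_sigma_algebraType (F s)] (X : g_sigma_algebraType (F s) -> R) ->
  forall A A' : set R, measurable A -> measurable A' ->
  P (X @^-1` A `&` increment s r i @^-1` A') =
  (P (X @^-1` A) * P (increment s r i @^-1` A'))%E.
Proof.
move=> s0 sr mX A A' mA mA'.
have [_ _ _ H _] := hB.
apply: (H s r _ [set v | A' (v ord0 i)]) => //.
  rewrite -filtration_measurableE// -[X in measurable X]setTI; exact: mX.
by rewrite -[X in measurable X]setTI; exact: measurable_coord.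
Qed.

Lemma step_integral_measurable n (p c : nat -> R) i : 0 <= p 0 ->
  (forall k, (k < n)%N -> p k <= p k.+1) ->
  measurable_fun [set: g_sigma_algebraType (F (p n))]
    (fun w : g_sigma_algebraType (F (p n)) => step_integral B n p c w ord0 i) /\
  0 <= p n.
Proof.
move=> p0; elim: n => [|n IH] pS.
  split=> //; rewrite /step_integral; under eq_fun do rewrite big_ord0 mxE.
  exact: measurable_cst.
have [mn pn0] := IH (fun k kn => pS k (ltnW kn)); have pnS := pS n (ltnSn n).
split; last exact: le_trans pnS.
rewrite /step_integral; under eq_fun do rewrite big_ord_recr/= mxE.
apply: measurable_funD; first exact: measurable_fun_filtration_le mn.
under eq_fun do rewrite mxE.
apply: measurable_funM; first exact: measurable_cst.
exact: measurable_increment.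
Qed.

(** The last increment is symmetric and independent of the past, so by [integral_sqr_independentD]
    second moments add up along the induction. The factor 8 is that of [normal_second_moment]. *)
Lemma step_integral_sqr n (p c : nat -> R) i : 0 <= p 0 ->
  (forall k, (k < n)%N -> p k <= p k.+1) ->
  (\int[P]_w (step_integral B n p c w ord0 i ^+ 2)%:E <=
   (8 * \sum_(k < n) c k ^+ 2 * (p k.+1 - p k))%:E)%E.
Proof.
move=> p0; elim: n => [|n IH] pS.
  rewrite big_ord0 mulr0; under eq_integral.
    by move=> w _; rewrite /step_integral big_ord0 mxE expr0n/=; over.
  by rewrite integral0.
have pS' k : (k < n)%N -> p k <= p k.+1 by move=> kn; exact: pS (ltnW kn).
have [mn pn0] := step_integral_measurable c i p0 pS'.
have pnS := pS n (ltnSn n).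
have mD : measurable_fun [set: Omega] (fun w => increment (p n) (p n.+1) i w).
  apply: (@measurable_fun_filtration _ _ (p n.+1)); first exact: le_trans pnS.
  exact: measurable_increment.
under eq_integral.
  move=> w _; rewrite /step_integral big_ord_recr/= mxE [X in _ + X]mxE.
  over.
rewrite (integral_sqr_independentD
   (X := fun w => step_integral B n p c w ord0 i) (Y := fun w => c n * increment (p n) (p n.+1) i w)).
- rewrite big_ord_recr/= mulrDr EFinD leeD ?IH//.
  under eq_integral do rewrite exprMn EFinM.
  rewrite ge0_integralZl//=.
  + rewrite (_ : (8 * (c n ^+ 2 * (p n.+1 - p n)))%:E =
        ((c n ^+ 2)%:E * (8 * (p n.+1 - p n))%:E)%E); last first.
      by rewrite -EFinM; congr EFin; ring.
    by rewrite lee_wpmul2l ?lee_fin ?sqr_ge0// increment_sqr.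
  + by apply/measurable_EFinP; exact: measurable_funX.
  + by move=> w _; rewrite lee_fin sqr_ge0.
  + by rewrite lee_fin sqr_ge0.
- exact: measurable_fun_filtration mn.
- exact: measurable_funM.
- move=> A A' mA mA'.
  have mA2 : measurable ((fun x : R => c n * x) @^-1` A').
    by rewrite -[X in measurable X]setTI; apply: measurable_funM.
  exact: (increment_independent i pn0 pnS mn mA mA2).
- move=> A mA.
  have mA2 : measurable ((fun x : R => c n * x) @^-1` A).
    by rewrite -[X in measurable X]setTI; apply: measurable_funM.
  rewrite -[RHS](increment_symmetric i pn0 pnS mA2); congr (P _).
  by apply/seteqP; split => w /=; rewrite mulrN.
Qed.

End brownian_increments.
Lemma sqr_sum_disjoint (R : realType) (I : finType) (x : I -> R) :
  (forall j k, j != k -> x j * x k = 0) ->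
  (\sum_j x j) ^+ 2 = \sum_j x j ^+ 2.
Proof.
move=> x0; rewrite expr2 big_distrl; apply: eq_bigr => j _ /=.
rewrite big_distrr (bigD1 j)//= big1 ?addr0 ?expr2// => k kj.
by apply: x0; rewrite eq_sym.
Qed.

Section step_functions.
Context {R : realType}.
Local Notation leb := (@lebesgue_measure R).
Variables (n : nat) (p c : nat -> R).
Hypothesis pS : forall k, (k < n)%N -> p k <= p k.+1.

Lemma step_points_le i j : (i <= j <= n)%N -> p i <= p j.
Proof.
move=> /andP[]; elim: j => [|j IH]; first by rewrite leqn0 => /eqP ->.
rewrite leq_eqVlt => /predU1P[->//|ij] jn.
by apply: le_trans (pS jn); apply: IH => //; exact: ltnW.
Qed.

Lemma step_fun_sqr r : step_fun n p c r ^+ 2 =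
  \sum_(k < n) c k ^+ 2 * \1_(`]p k, p k.+1]) r.
Proof.
rewrite /step_fun (sqr_sum_disjoint (x := fun k : 'I_n => c k * \1_(`]p k, p k.+1]) r)).
  apply: eq_bigr => k _; rewrite exprMn; congr (_ * _).
  by rewrite indicE; case: (_ \in _); rewrite ?expr1n ?expr0n.
have disj (j k : 'I_n) : (j < k)%N -> c j * \1_(`]p j, p j.+1]) r * (c k * \1_(`]p k, p k.+1]) r) = 0.
  move=> jk; rewrite mulrACA; apply/eqP; rewrite mulf_eq0; apply/orP; right.
  rewrite !indicE -natrM mulnb; case: andP => // -[/set_mem/= + /set_mem/=].
  rewrite !in_itv/= => /andP[_ rj] /andP[rk _].
  have : p j.+1 <= p k by apply: step_points_le; rewrite jk ltnW.
  by move=> /(le_trans rj)/(lt_le_trans rk); rewrite ltxx.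
move=> j k; rewrite neq_ltn => /orP[jk|kj]; first exact: disj.
by rewrite mulrC; exact: disj.
Qed.

Lemma measurable_step_fun : measurable_fun [set: measurableTypeR R] (step_fun n p c).
Proof.
rewrite /step_fun; apply: measurable_sum => k; exact: measurable_funM.
Qed.

Lemma integral_step_fun_sqr :
  (\int[leb]_(r in `[p 0%N, p n]) (step_fun n p c r ^+ 2)%:E =
   (\sum_(k < n) c k ^+ 2 * (p k.+1 - p k))%:E)%E.
Proof.
under eq_integral do rewrite step_fun_sqr -sumEFin.
rewrite ge0_integral_sum//; last 2 first.
- by move=> k; apply/measurable_EFinP; apply: measurable_funM => //; exact: measurable_indic.
- by move=> k r _; rewrite lee_fin mulr_ge0 ?sqr_ge0.
rewrite -sumEFin; apply: eq_bigr => k _.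
under eq_integral do rewrite EFinM.
rewrite ge0_integralZl//=; last 2 first.
- by apply/measurable_EFinP; exact: measurable_indic.
- by rewrite lee_fin sqr_ge0.
rewrite integral_indic//= [RHS]EFinM; congr mule.
rewrite setIidl.
  rewrite lebesgue_measure_itv/= lte_fin; case: ltP => // h.
  by apply/eqP; rewrite eq_sym eqe subr_eq0 eq_le h pS.
move=> r /=; rewrite !in_itv/= => /andP[h1 h2]; apply/andP; split.
  by apply: le_trans (ltW h1); apply: step_points_le; rewrite /= ltnW.
by apply: le_trans h2 _; apply: step_points_le; rewrite ltn_ord leqnn.
Qed.

End step_functions.

Lemma enorm_sqr (R : realType) (d : nat) (v : 'rV[R]_d) :
  enorm v ^+ 2 = \sum_i v ord0 i ^+ 2.
Proof. by rewrite sqr_sqrtr// sumr_ge0// => i _; rewrite sqr_ge0. Qed.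

Lemma enorm_sqrD (R : realType) (d : nat) (u v : 'rV[R]_d) :
  enorm (u + v) ^+ 2 <= 2 * enorm u ^+ 2 + 2 * enorm v ^+ 2.
Proof.
rewrite !enorm_sqr !mulr_sumr -big_split/=; apply: ler_sum => i _.
rewrite mxE -subr_ge0 [leRHS](_ : _ = (u ord0 i - v ord0 i) ^+ 2) ?sqr_ge0//; ring.
Qed.

Lemma ge0_integral_lin2 d (T : measurableType d) (R : realType)
    (m : {measure set T -> \bar R}) (D : set T) (a b : R) (f g : T -> R) :
  measurable D -> measurable_fun D f -> measurable_fun D g -> 0 <= a -> 0 <= b ->
  (forall x, 0 <= f x) -> (forall x, 0 <= g x) ->
  (\int[m]_(x in D) (a * f x + b * g x)%:E =
   a%:E * \int[m]_(x in D) (f x)%:E + b%:E * \int[m]_(x in D) (g x)%:E)%E.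
Proof.
move=> mD mf mg a0 b0 f0 g0.
under eq_integral do rewrite EFinD.
rewrite ge0_integralD//.
- by congr (_ + _)%E; under eq_integral do rewrite EFinM;
    rewrite ge0_integralZl//; try (by move=> x _; rewrite lee_fin); exact/measurable_EFinP.
- by move=> x _; rewrite lee_fin mulr_ge0.
- by apply/measurable_EFinP; exact: measurable_funM.
- by move=> x _; rewrite lee_fin mulr_ge0.
- by apply/measurable_EFinP; exact: measurable_funM.
Qed.

Section ito_second_moment.
Context {R : realType} {d : nat} {dO : measure_display} {Omega : measurableType dO}.
Variables (P : probability Omega R) (F : R -> set (set Omega)).
Variable B : R -> Omega -> 'rV[R]_d.
Hypotheses (hF : filtration F) (hB : brownian_motion P F B).
Local Notation leb := (@lebesgue_measure R).

Let step_integral_enorm n (p c : nat -> R) : 0 <= p 0%N ->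
  (forall k, (k < n)%N -> p k <= p k.+1) ->
  (\int[P]_w (enorm (step_integral B n p c w) ^+ 2)%:E <=
   (8 * d%:R)%:E * \int[leb]_(r in `[p 0%N, p n]) (step_fun n p c r ^+ 2)%:E)%E.
Proof.
move=> p0 pS; under eq_integral do rewrite enorm_sqr -sumEFin.
have [ms pn0] : (forall i, measurable_fun [set: g_sigma_algebraType (F (p n))]
    (fun w : g_sigma_algebraType (F (p n)) => step_integral B n p c w ord0 i)) /\ 0 <= p n.
  split; first by move=> i; have [] := step_integral_measurable hF hB c i p0 pS.
  have := step_points_le pS (i := 0%N) (j := n); rewrite leqnn => /(_ isT).
  exact: le_trans.
rewrite ge0_integral_sum//; last 2 first.
- move=> i; apply/measurable_EFinP; apply: measurable_funX.
  exact: (measurable_fun_filtration hF pn0 (ms i)).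
- by move=> i w _; rewrite lee_fin sqr_ge0.
rewrite integral_step_fun_sqr// -EFinM.
apply: (@le_trans _ _ (\sum_(i < d) (8 * \sum_(k < n) c k ^+ 2 * (p k.+1 - p k))%:E)%E).
  by apply: lee_sum => i _; exact: (step_integral_sqr hF hB).
by rewrite sumEFin lee_fin sumr_const card_ord -[X in X <= _]mulr_natr mulrAC.
Qed.

(** For a step integral S near X, |X|^2 <= 2 |X - S|^2 + 2 |S|^2; the second moment of S is at most
    8 d times the integral of the squared step function, and that square is at most 2 (sigma -
    step)^2 + 2 M^2. Both errors vanish in the limit, and 2 times 8 times 2 is 32. *)
Lemma ito_integral_second_moment (sigma : R -> R) (a b M : R) (X : Omega -> 'rV[R]_d) :
  0 <= a -> a <= b ->
  measurable_fun (`[a, b] : set (measurableTypeR R)) sigma ->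
  (forall r, r \in `[a, b] -> `|sigma r| <= M) ->
  measurable_fun [set: Omega] (X : Omega -> Rd R d) ->
  is_ito_integral P B sigma a b X ->
  (\int[P]_w (enorm (X w) ^+ 2)%:E <= (32 * d%:R * (M ^+ 2 * (b - a)))%:E)%E.
Proof.
move=> a0 ab ms sM mX [n [p [c [pab pS cvs cvX]]]].
set eps := (fun j => \int[leb]_(r in _) _)%E in cvs.
set eta := (fun j => \int[P]_w _)%E in cvX.
have step j : (\int[P]_w (enorm (X w) ^+ 2)%:E <=
    2%:E * eta j + ((32 * d%:R)%:E * eps j + (32 * d%:R * (M ^+ 2 * (b - a)))%:E))%E.
  have [pa pb] := pab j.
  have p0 : 0 <= p j 0%N by rewrite pa.
  have mst : measurable_fun [set: Omega]
      (step_integral B (n j) (p j) (c j) : Omega -> Rd R d).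
    apply: measurable_fun_rV => i.
    have [msi pn0] := step_integral_measurable hF hB (c j) i p0 (pS j).
    exact: (measurable_fun_filtration hF pn0 msi).
  have mXs : measurable_fun [set: Omega]
      (fun w => X w - step_integral B (n j) (p j) (c j) w : Rd R d).
    apply: measurable_fun_rV => i; under eq_fun do rewrite !mxE.
    apply: measurable_funB; first by move/measurable_fun_rVP : mX.
    by move/measurable_fun_rVP : mst.
  have m1 : measurable_fun [set: Omega]
      (fun w => (enorm (X w - step_integral B (n j) (p j) (c j) w) ^+ 2)%:E).
    apply/measurable_EFinP; apply: measurable_funX.
    exact: (measurableT_comp measurable_enorm mXs).
  have m2 : measurable_fun [set: Omega]
      (fun w => (enorm (step_integral B (n j) (p j) (c j) w) ^+ 2)%:E).
    apply/measurable_EFinP; apply: measurable_funX.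
    exact: (measurableT_comp measurable_enorm mst).
  have mstep : measurable_fun `[a, b] (step_fun (n j) (p j) (c j)).
    by apply: measurable_funTS; exact: measurable_step_fun.
  apply: (@le_trans _ _ (2%:E * eta j + 2%:E *
     \int[P]_w (enorm (step_integral B (n j) (p j) (c j) w) ^+ 2)%:E)%E).
    rewrite -(@ge0_integral_lin2 _ _ _ P setT 2 2
       (fun w => enorm (X w - step_integral B (n j) (p j) (c j) w) ^+ 2)
       (fun w => enorm (step_integral B (n j) (p j) (c j) w) ^+ 2))//;
      try (by move=> w; rewrite sqr_ge0); try by exact/measurable_EFinP.
    apply: le_integral_ge0 => w _; first by rewrite lee_fin sqr_ge0.
    rewrite lee_fin.
    by rewrite -{1}[X w](subrK (step_integral B (n j) (p j) (c j) w)) enorm_sqrD.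
  rewrite leeD2l//.
  apply: (@le_trans _ _ (2%:E * ((8 * d%:R)%:E *
      (2%:E * eps j + 2%:E * (M ^+ 2 * (b - a))%:E)))%E).
    rewrite lee_wpmul2l//.
    apply: le_trans (step_integral_enorm (c j) p0 (pS j)) _.
    rewrite lee_wpmul2l ?lee_fin ?mulr_ge0// pa pb.
    have -> : ((M ^+ 2 * (b - a))%:E = \int[leb]_(r in `[a, b]) (M ^+ 2)%:E)%E.
      rewrite integral_cst//= lebesgue_measure_itv/= lte_fin EFinM; congr (_ * _)%E.
      by case: ltP => // ba; apply/eqP; rewrite eqe subr_eq0 eq_le ab ba.
    rewrite -(@ge0_integral_lin2 _ _ _ leb `[a, b]%classic 2 2
       (fun r => (sigma r - step_fun (n j) (p j) (c j) r) ^+ 2) (fun=> M ^+ 2))//;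
      try (by move=> r; rewrite sqr_ge0); last first.
      by apply: measurable_funX; exact: measurable_funB.
    apply: le_integral_ge0 => r rab; first by rewrite lee_fin sqr_ge0.
    rewrite lee_fin.
    have : sigma r ^+ 2 <= M ^+ 2.
      by rewrite -real_normK ?num_real// lerXn2r ?nnegrE//; [exact: le_trans (sM r rab)|exact: sM].
    (* The difference 2 (sigma - step)^2 + 2 sigma^2 - step^2 is exactly (2 sigma - step)^2. *)
    by have := sqr_ge0 (2 * sigma r - step_fun (n j) (p j) (c j) r); nra.
  rewrite muleA -EFinM muleDr// ?fin_num_adde_defl// !muleA -!EFinM.
  by rewrite le_eqVlt; apply/orP; left; apply/eqP; congr (_%:E * _ + _%:E)%E; ring.
have cv : (2%:E * eta j + ((32 * d%:R)%:E * eps j + (32 * d%:R * (M ^+ 2 * (b - a)))%:E)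
    @[j --> \oo] --> 2%:E * 0 + ((32 * d%:R)%:E * 0 + (32 * d%:R * (M ^+ 2 * (b - a)))%:E))%E.
  apply: cvgeD; [by rewrite !mule0 adde_defC fin_num_adde_defl|exact: cvgeZl|].
  apply: cvgeD; [by rewrite !mule0|exact: cvgeZl|exact: cvg_cst].
rewrite !mule0 !add0e in cv.
by apply: cvge_to_ge cv _; near=> j; exact: step.
Unshelve. all: by end_near.
Qed.

End ito_second_moment.

(** * The delayed noise *)

Section grid.
Context {R : realType}.
Variables (t T : R) (tau : nat -> R).
Hypothesis tau0 : tau 0%N = t.
Hypothesis tau_lt : forall n, tau n < tau n.+1.
Hypothesis tauT : tau @ \oo --> T.

Lemma grid_le m n : (m <= n)%N -> tau m <= tau n.
Proof.
by move: m n; apply: (homo_leq (@lexx _ R) (@le_trans _ R)) => n; exact/ltW/tau_lt.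
Qed.

Lemma grid_lt_end n : tau n < T.
Proof.
apply: lt_le_trans (tau_lt n) _.
have nd : nondecreasing_seq tau by move=> m k; exact: grid_le.
by have := nondecreasing_cvgn_le nd (cvgP _ tauT) n.+1; rewrite (cvg_lim _ tauT).
Qed.

Lemma grid_in n : tau n \in `[t, T].
Proof. by rewrite in_itv/= -tau0 grid_le//= ltW// grid_lt_end. Qed.

Definition grid_index (s : R) : nat := xget 0%N [set n | tau n <= s < tau n.+1].

Lemma grid_indexE n s : tau n <= s < tau n.+1 -> grid_index s = n.
Proof.
move=> ns; rewrite /grid_index; case: xgetP => [m -> /= ms|/(_ n)]; last by rewrite /= ns.
have lt_grid k l : tau k <= s < tau k.+1 -> tau l <= s < tau l.+1 -> (k <= l)%N.
  move=> /andP[ks _] /andP[_ sl]; rewrite leqNgt; apply/negP => /grid_le lk.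
  by move: (lt_le_trans sl (le_trans lk ks)); rewrite ltxx.
by apply/eqP; rewrite eqn_leq !lt_grid.
Qed.

Lemma grid_past x : x < T -> exists n, x < tau n.
Proof.
move=> xT; have h : \forall n \near \oo, x < tau n.
  by apply: (cvgr_gt T) => //; exact: tauT.
by have [n _ hn] := h; exists n; exact: (hn n (leqnn n)).
Qed.

Lemma grid_indexP s : t <= s < T ->
  tau (grid_index s) <= s < tau (grid_index s).+1.
Proof.
move=> /andP[ts sT]; have [n sn] := grid_past sT.
suff [m hm] : exists m, tau m <= s < tau m.+1 by rewrite (grid_indexE hm).
elim: n sn => [|n IH sn]; first by rewrite tau0 ltNge ts.
by have [/IH//|ns] := ltP s (tau n); exists n; rewrite ns.
Qed.

Lemma grid_bigcup : \bigcup_n `[tau n, tau n.+1[%classic = `[t, T[%classic.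
Proof.
apply/seteqP; split => [s [n _]|s]; rewrite /= !in_itv/=.
  move=> /andP[h1 h2]; rewrite -tau0 (le_trans (grid_le (leq0n n)) h1)/=.
  exact: lt_trans h2 (grid_lt_end _).
by move=> h; exists (grid_index s) => //=; rewrite in_itv/= grid_indexP.
Qed.

Lemma grid_trivIset : trivIset setT (fun n => `[tau n, tau n.+1[%classic).
Proof.
move=> i j _ _ [s [/=]]; rewrite !in_itv/= => hi hj.
by rewrite -(grid_indexE hi) -(grid_indexE hj).
Qed.

Lemma measurable_fun_grid d1 d2 (X : measurableType d1) (S : measurableType d2)
    (phi : X -> measurableTypeR R) (f : nat -> X -> S) (g : X -> S) :
  measurable_fun setT phi -> (forall n, measurable_fun setT (f n)) ->
  measurable_fun setT g ->
  measurable_fun setT (fun x => if t <= phi x < T then f (grid_index (phi x)) x else g x).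
Proof.
move=> mphi mf mg _ V mV; rewrite setTI.
rewrite (_ : _ @^-1` V =
    (\bigcup_n (phi @^-1` `[tau n, tau n.+1[%classic `&` f n @^-1` V)) `|`
    (phi @^-1` (~` `[t, T[%classic) `&` g @^-1` V)).
  apply: measurableU.
    apply: bigcupT_measurable => n; apply: measurableI.
      by rewrite -[X in measurable X]setTI; apply: mphi => //; exact: measurable_itv.
    by rewrite -[X in measurable X]setTI; exact: mf.
  apply: measurableI; last by rewrite -[X in measurable X]setTI; exact: mg.
  rewrite -[X in measurable X]setTI; apply: mphi => //.
  by apply: measurableC; exact: measurable_itv.
apply/seteqP; split => x /=; rewrite in_itv/=.
  case: ifPn => [h V1|/negP h V1]; last by right.
  left; exists (grid_index (phi x)) => //; split => //=.
  by rewrite in_itv/= grid_indexP.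
move=> [[n _ [/=]]|[/negP/negPf->//]]; rewrite in_itv/= => h.
rewrite (grid_indexE h); case: ifPn => // /negP []; move: h => /andP[h1 h2].
by rewrite -tau0 (le_trans (grid_le (leq0n n)) h1)/= (lt_trans h2)// grid_lt_end.
Qed.

(* The path that on [tau n, tau (n + 1)[ goes from [y (n - 1)] to [y n], so
   that it only depends on the past ([n.-1] is [0] for [n = 0]); [l] is its value
   outside [t, T[. *)
Definition delayed (y : nat -> R) (l s : R) : R :=
  if t <= s < T then
    let n := grid_index s in
    y n.-1 + (s - tau n) * ((tau n.+1 - tau n)^-1 * (y n - y n.-1))
  else l.

Lemma delayedE y l n s : tau n <= s <= tau n.+1 ->
  delayed y l s = y n.-1 + (s - tau n) * ((tau n.+1 - tau n)^-1 * (y n - y n.-1)).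
Proof.
move=> /andP[ns sn]; have tn : t <= tau n by rewrite -tau0 grid_le.
rewrite /delayed (le_trans tn ns) (le_lt_trans sn (grid_lt_end _))/=.
(* At the right endpoint the index is already [n.+1], and the next cell starts from the value [y n]
   at which this one ends. *)
move: sn; rewrite le_eqVlt => /predU1P[->|sn]; last by rewrite (@grid_indexE n) ?ns.
rewrite (@grid_indexE n.+1) ?lexx ?tau_lt//= subrr mul0r addr0 mulrA mulfV.
  by rewrite mul1r subrKC.
by rewrite subr_eq0 gt_eqF.
Qed.

(** The fraction of cell [n] elapsed at time [s], equal to 0 before the cell and to 1 after it.
    Writing the path with these continuous ramps avoids gluing at the grid points. *)
Let theta n s : R := Num.min 1 (Num.max 0 ((s - tau n) / (tau n.+1 - tau n))).

Let theta_continuous n : continuous (theta n).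
Proof.
move=> s; apply: (@continuous_min R R (cst 1) (fun s => Num.max 0 ((s - tau n) / (tau n.+1 - tau n)))).
  exact: cvg_cst.
apply: (@continuous_max R R (cst 0) (fun s => (s - tau n) / (tau n.+1 - tau n))).
  exact: cvg_cst.
by apply: cvgM; [apply: cvgB; [exact: cvg_id|exact: cvg_cst]|exact: cvg_cst].
Qed.

Let sum_pred_increments (y : nat -> R) N : \sum_(k < N) (y k - y k.-1) = y N.-1 - y 0%N.
Proof.
elim: N => [|N IH]; first by rewrite big_ord0 subrr.
by rewrite big_ord_recr/= IH addrC addrA subrK.
Qed.

(** Finished cells contribute full increments, which telescope, and later cells contribute nothing.
    The term k = 0 vanishes because [0.-1] is 0. *)
Let delayed_sum y l N s : t <= s <= tau N ->
  delayed y l s = y 0%N + \sum_(k < N) theta k s * (y k - y k.-1).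
Proof.
have gap n : 0 < tau n.+1 - tau n by rewrite subr_gt0.
elim: N s => [|N IH] s /andP[ts sN].
  have st : s = tau 0%N by apply/eqP; rewrite eq_le sN tau0 ts.
  have hs : tau 0%N <= s <= tau 1%N by rewrite st lexx ltW.
  rewrite big_ord0 addr0 (delayedE _ _ hs) st/=.
  by rewrite subrr mul0r addr0.
have [sN'|Ns] := leP s (tau N).
  rewrite IH ?ts// big_ord_recr/= [theta N s]/theta max_l ?min_r ?mul0r ?addr0//.
  by rewrite pmulr_lle0 ?invr_gt0// subr_le0.
have hs : tau N <= s <= tau N.+1 by rewrite sN ltW.
rewrite (delayedE _ _ hs) big_ord_recr/= addrA.
have -> : theta N s = (s - tau N) / (tau N.+1 - tau N).
  rewrite /theta max_r ?min_r//; first by rewrite ler_pdivrMr// mul1r lerD2r.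
  by rewrite divr_ge0 ?subr_ge0 ?ltW.
rewrite (eq_bigr (fun k : 'I_N => y k - y k.-1)) ?sum_pred_increments ?subrKC ?mulrA// => k _.
rewrite /theta [X in X * _]min_l ?mul1r// le_max; apply/orP; right.
rewrite ler_pdivlMr// mul1r lerD2r (le_trans _ (ltW Ns))// grid_le//.
Qed.

(** Before [T] the path is locally a finite sum of ramps; near [T] its value is a convex combination
    of [y n.-1] and [y n], both close to [l]. *)
Lemma delayed_continuous y l : y @ \oo --> l ->
  {within `[t, T], continuous (delayed y l)}.
Proof.
move=> yl; suff h (s : R) : t <= s -> s <= T ->
    delayed y l r @[r --> within `[t, T]%classic (nbhs s)] --> delayed y l s.
  by apply/subspace_continuousP => s /=; rewrite in_itv/= => /andP[/h]; exact.
move=> ts; rewrite le_eqVlt => /predU1P[->|sT].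
  have -> : delayed y l T = l by rewrite /delayed ltxx andbF.
  apply/cvgrPdist_lt => e e0.
  have [m _ hm] : \forall n \near \oo, `|l - y n| < e by move/cvgrPdist_lt : yl; exact.
  (* Beyond [tau m.+1] the cell index exceeds [m], so that its predecessor, too, is at least [m]. *)
  have nT : \forall r \near T, tau m.+1 < r by apply: lt_nbhsr; exact: grid_lt_end.
  apply: filterS nT => r mr; rewrite /= in_itv/= => /andP[tr rT].
  rewrite /delayed tr/=; have [rlT|_] := ltP r T; last by rewrite subrr normr0.
  have /andP[nr rn] : tau (grid_index r) <= r < tau (grid_index r).+1.
    by apply: grid_indexP; rewrite tr.
  set n := grid_index r in nr rn *.
  have mn : (m < n)%N.
    rewrite ltnNge; apply/negP => nm; have := @grid_le n.+1 m.+1 nm.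
    by move=> /(lt_le_trans rn)/(lt_trans mr); rewrite ltxx.
  have h1 : `|l - y n.-1| < e by apply: hm => /=; lia.
  have h2 : `|l - y n| < e by apply: hm => /=; lia.
  pose x := (r - tau n) / (tau n.+1 - tau n).
  have gap : 0 < tau n.+1 - tau n by rewrite subr_gt0.
  have x0 : 0 <= x by apply: divr_ge0; [rewrite subr_ge0|exact: ltW].
  have x1 : x <= 1 by rewrite ler_pdivrMr// mul1r lerD2r ltW.
  rewrite mulrA -/x [X in `|X|](_ : _ = (1 - x) * (l - y n.-1) + x * (l - y n)); last by ring.
  apply: (@le_lt_trans _ _ (Num.max `|l - y n.-1| `|l - y n|)); last by rewrite gt_max h1 h2.
  clearbody x; rewrite (le_trans (ler_normD _ _))// !normrM (ger0_norm x0) (@ger0_norm _ (1 - x)) ?subr_ge0//.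
  rewrite [leRHS](_ : _ = (1 - x) * Num.max `|l - y n.-1| `|l - y n| +
    x * Num.max `|l - y n.-1| `|l - y n|) ?lerD//; last by ring.
    by rewrite ler_wpM2l ?subr_ge0// le_max lexx.
  by rewrite ler_wpM2l// le_max lexx orbT.
have [N sN] := grid_past sT.
rewrite (@delayed_sum _ _ N) ?ts ?ltW//.
apply: (@cvg_trans _ ((fun r => y 0%N + \sum_(k < N) theta k r * (y k - y k.-1)) @
    within `[t, T]%classic (nbhs s))).
  apply: near_eq_cvg; rewrite near_withinE.
  have nN : \forall r \near s, r < tau N by exact: lt_nbhsl.
  apply: filterS nN => r rN; rewrite /= in_itv/= => /andP[tr rT].
  by apply/esym/delayed_sum; rewrite tr ltW.
apply: cvg_within_filter; apply: cvgD; first exact: cvg_cst.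
apply: (@cvg_big _ _ +%R 0) => [|k _]; first exact: add_continuous.
by apply: cvgM; [exact: theta_continuous|exact: cvg_cst].
Qed.

End grid.

(** * The rate of the diffusion coefficient and the dyadic grid *)

Lemma smooth_on_continuous (R : realType) (D : set R) (f : R -> R) :
  smooth_on D f -> {within D, continuous f}.
Proof.
move=> [g [g0 dg]]; suff h x : D x -> f y @[y --> within D (nbhs x)] --> f x.
  exact/subspace_continuousP.
move=> Dx; have hx := dg 0%N x Dx.
have hid : (y - x) @[y --> within D x^'] --> x - x.
  apply: cvgB; last exact: cvg_cst.
  move=> A nA; suff : \forall y \near x, y != x -> D y -> A y by [].
  by apply: filterS nA.
have h2 : (g 0%N y - g 0%N x) @[y --> within D x^'] --> g 1%N x * (x - x).
  apply: cvg_trans (cvgM hx hid); apply: near_eq_cvg.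
  suff : \forall y \near x, y != x -> D y ->
      (g 0%N y - g 0%N x) / (y - x) * (y - x) = g 0%N y - g 0%N x by [].
  have nT : \forall y \near x, True by exact: filterT.
  by apply: filterS nT => y _ yx _; rewrite divfK// subr_eq0.
rewrite subrr mulr0 in h2.
apply/cvgrPdist_lt => e e0; have /cvgrPdist_lt/(_ e e0) := h2.
move=> h; have {}h : \forall y \near x, y != x -> D y -> `|0 - (g 0%N y - g 0%N x)| < e := h.
suff : \forall y \near x, D y -> `|f x - f y| < e by [].
apply: filterS h => y hy Dy.
have [->|yx] := eqVneq y x; first by rewrite subrr normr0.
by have := hy yx Dy; rewrite sub0r normrN !g0// distrC.
Qed.

(** The equivalence gives the bound only near [T]. Farther away, where T - s >= e, it follows from
    boundedness of [sigma], with the constant |M| / e^gamma. *)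
Lemma powR_rate_bound (R : realType) (sigma : R -> R) (T K gamma M : R) :
  0 < gamma -> (forall s, s \in `[0, T[ -> `|sigma s| <= M) ->
  sigma ~_(T^'-) (fun s => K * (T - s) `^ gamma) ->
  exists2 C, 0 <= C & forall s, s \in `[0, T[ -> `|sigma s| <= C * (T - s) `^ gamma.
Proof.
move=> gamma0 sM /equivOLR/eqOP hO.
have [k [k0 hk]] : exists k, 0 < k /\ \forall s \near T^'-, `|sigma s| <= k * `|K * (T - s) `^ gamma|.
  have h : \forall k \near +oo, 0 < k /\ \forall s \near T^'-, `|sigma s| <= k * `|K * (T - s) `^ gamma|.
    by apply: filterS2 (nbhs_pinfty_gt (num_real 0)) hO => k k0 hk; split.
  by have [k ?] := filter_ex h; exists k.
have [e /= e0 he] : exists2 e, 0 < e & forall s, T - e < s < T -> `|sigma s| <= k * `|K * (T - s) `^ gamma|.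
  move: hk; rewrite /at_left near_withinE => /nbhs_ballP[e /= e0 he].
  exists e => // s /andP[es sT]; apply: he => //.
  by rewrite /ball/= ger0_norm ?subr_ge0 ?ltW// ltrBlDr -ltrBlDl.
have ee : 0 < e `^ gamma by rewrite powR_gt0.
exists (k * `|K| + `|M| / e `^ gamma).
  by rewrite addr_ge0 ?mulr_ge0 ?invr_ge0// ltW.
move=> s sT; have /= := sT; rewrite in_itv/= => /andP[s0 slT].
have [es|se] := ltP (T - e) s.
  rewrite (le_trans (he s _)) ?es// normrM (ger0_norm (powR_ge0 _ _)) mulrA ler_wpM2r ?powR_ge0//.
  by rewrite lerDl; apply: divr_ge0 => //; exact: ltW.
rewrite (le_trans (sM s sT))// (le_trans (ler_norm M))//.
apply: (@le_trans _ _ (`|M| / e `^ gamma * (T - s) `^ gamma)); last first.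
  by rewrite ler_wpM2r ?powR_ge0// lerDr mulr_ge0// ltW.
rewrite -mulrA ler_peMr// ler_pdivlMl// mulr1 ge0_ler_powR ?nnegrE ?subr_ge0//; try exact: ltW.
by rewrite lerBrDr -lerBrDl.
Qed.

Lemma continuous_subitv_measurable (R : realType) (sigma : R -> R) (T a b : R) :
  {within `[0, T[, continuous sigma} -> 0 <= a -> b < T ->
  measurable_fun (`[a, b]%classic : set (measurableTypeR R)) sigma.
Proof.
move=> cs a0 bT; apply: (@measurable_funS _ _ _ _ (`[0, T[%classic : set (measurableTypeR R))) => //.
  by move=> s /=; rewrite !in_itv/= => /andP[h1 h2]; rewrite (le_trans a0 h1) (le_lt_trans h2).
by apply: subspace_continuous_measurable_fun.
Qed.

Section dyadic_grid.
Context {R : realType}.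
Variables t T : R.
Hypothesis tT : t < T.

Definition dyadic (n : nat) : R := T - (T - t) / 2 ^+ n.

Lemma dyadic0 : dyadic 0 = t.
Proof. by rewrite /dyadic expr0 divr1 subKr. Qed.

Lemma dyadic_gap n : dyadic n.+1 - dyadic n = (T - t) / 2 ^+ n.+1.
Proof.
by rewrite /dyadic exprS; field; rewrite expf_neq0.
Qed.

Lemma dyadic_lt n : dyadic n < dyadic n.+1.
Proof. by rewrite -subr_gt0 dyadic_gap divr_gt0 ?subr_gt0// exprn_gt0. Qed.

Lemma dyadic_cvg : dyadic @ \oo --> T.
Proof.
rewrite -[X in _ --> X]subr0; apply: cvgB; first exact: cvg_cst.
rewrite -[X in _ --> X](mulr0 (T - t)); apply: cvgM; first exact: cvg_cst.
under eq_cvg do rewrite -exprVn.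
by apply: cvg_expr; rewrite ger0_norm// invf_lt1// ltr1n.
Qed.

Let powR_exprn (x gamma : R) n : 0 <= x -> (x ^+ n) `^ gamma = (x `^ gamma) ^+ n.
Proof.
move=> x0; elim: n => [|n IH]; first by rewrite !expr0 powR1.
by rewrite !exprS powRM ?exprn_ge0// IH.
Qed.

(** For n >= 1 the distance from [dyadic n.-1] to [T] is 2 (T - t) / 2^n, with equality in the
    bound; for n = 0 it is T - t, and the factor 2 is slack. The ratio of the geometric sequence is
    4^(-gamma). *)
Lemma dyadic_rate_sqr (gamma : R) n : 0 < gamma ->
  ((T - dyadic n.-1) `^ gamma) ^+ 2 <=
  ((2 * (T - t)) `^ gamma) ^+ 2 * ((2^-1 `^ gamma) ^+ 2) ^+ n.
Proof.
move=> gamma0; have Tt : 0 <= 2 * (T - t) by rewrite mulr_ge0// subr_ge0 ltW.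
have i0 : 0 <= 2^-1 :> R by rewrite invr_ge0.
have -> : (2^-1 `^ gamma) ^+ 2 ^+ n = ((2^-1 ^+ n) `^ gamma) ^+ 2 by rewrite powR_exprn// exprAC.
rewrite -exprMn -powRM ?exprn_ge0//.
rewrite lerXn2r ?nnegrE ?powR_ge0// ge0_ler_powR ?nnegrE//; first exact: ltW.
- by rewrite /dyadic subKr divr_ge0 ?subr_ge0 ?exprn_ge0// ltW.
- by rewrite mulr_ge0 ?exprn_ge0.
rewrite /dyadic subKr exprVn; case: n => [|n] /=.
  by rewrite expr0 invr1 !mulr1 ler_peMl ?ler1n ?subr_ge0// ltW.
by rewrite exprS invfM mulrACA mulfV// mul1r.
Qed.

End dyadic_grid.

Lemma geometric_eseries_lty (R : realType) (C q : R) : 0 <= C -> 0 <= q < 1 ->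
  (\sum_(n <oo) (C * q ^+ n)%:E < +oo)%E.
Proof.
move=> C0 /andP[q0 q1].
have cv : series (geometric C q) @ \oo --> C * (1 - q)^-1.
  by apply: cvg_geometric_series; rewrite ger0_norm.
rewrite (_ : (\sum_(n <oo) (C * q ^+ n)%:E)%E = (C * (1 - q)^-1)%:E) ?ltry//.
apply/cvg_lim => //; under eq_cvg do rewrite sumEFin.
by apply: cvg_EFin; [exact: nearW|exact: cv].
Qed.

Section delayed_noise.
Context {R : realType} {d : nat} {dO : measure_display} {Omega : measurableType dO}.
Local Notation leb := (@lebesgue_measure R).
Variables (t T : R) (tau : nat -> R).
Hypothesis tau0 : tau 0%N = t.
Hypothesis tau_lt : forall n, tau n < tau n.+1.
Hypothesis tauT : tau @ \oo --> T.
Variable Y : R -> Omega -> 'rV[R]_d.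

(** For n = 0 the two times coincide and the slope is zero: the path waits at [Y t] during the first
    cell. *)
Definition delayed_slope (n : nat) (w : Omega) : 'rV[R]_d :=
  (tau n.+1 - tau n)^-1 *: (Y (tau n) w - Y (tau n.-1) w).

Definition delayed_path (w : Omega) (s : R) : 'rV[R]_d :=
  \row_i delayed t T tau (fun n => Y (tau n) w ord0 i) (Y T w ord0 i) s.

Definition delayed_velocity (w : Omega) (s : R) : 'rV[R]_d :=
  if t <= s < T then delayed_slope (grid_index tau s) w else 0.

Lemma delayed_pathE w n s : tau n <= s <= tau n.+1 ->
  delayed_path w s = Y (tau n.-1) w + (s - tau n) *: delayed_slope n w.
Proof.
by move=> ns; apply/rowP => i; rewrite !mxE (delayedE tau0 tau_lt tauT _ _ ns).
Qed.

Let piece_in n s : tau n <= s < tau n.+1 -> t <= s < T.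
Proof.
move=> /andP[ns sn]; rewrite (le_trans _ ns) ?(lt_trans sn (grid_lt_end tau_lt tauT _))//.
by rewrite -tau0 grid_le.
Qed.

Lemma delayed_velocityE w n s : tau n <= s < tau n.+1 ->
  delayed_velocity w s = delayed_slope n w.
Proof.
by move=> ns; rewrite /delayed_velocity (piece_in ns) (grid_indexE tau_lt ns).
Qed.

Lemma delayed_path_grid w n : delayed_path w (tau n) = Y (tau n.-1) w.
Proof. by rewrite (@delayed_pathE w n) ?lexx ?ltW// subrr scale0r addr0. Qed.

Lemma delayed_path_end w : delayed_path w T = Y T w.
Proof. by apply/rowP => i; rewrite mxE /delayed ltxx andbF. Qed.

Lemma delayed_velocity_piece w n s : tau n <= s < tau n.+1 ->
  delayed_velocity w s = delayed_velocity w (tau n).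
Proof.
by move=> ns; rewrite (delayed_velocityE w ns) (@delayed_velocityE w n) ?lexx/=.
Qed.

Lemma delayed_path_affine w n s : tau n <= s <= tau n.+1 ->
  delayed_path w s = delayed_path w (tau n) + (s - tau n) *: delayed_velocity w (tau n).
Proof.
by move=> ns; rewrite (delayed_pathE w ns) delayed_path_grid (@delayed_velocityE w n) ?lexx/=.
Qed.

Lemma delayed_path_continuous w : {within `[t, T], continuous (Y ^~ w)} ->
  {within `[t, T], continuous (delayed_path w)}.
Proof.
move=> cY; have tT : t < T by rewrite -tau0 (grid_lt_end tau_lt tauT).
have tDT : (T : R) \in `[t, T] by rewrite in_itv /= lexx ltW.
have Yl i : (fun n => Y (tau n) w ord0 i) @ \oo --> Y T w ord0 i.
  have h1 : (fun n => Y (tau n) w) @ \oo --> Y T w.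
    move=> V HV; have h := (subspace_continuousP _ _).1 cY T tDT V HV.
    have {}h : \forall s \near T, `[t, T]%classic s -> V (Y s w) := h.
    have hn : \forall n \near \oo, `[t, T]%classic (tau n) -> V (Y (tau n) w) := tauT h.
    suff : \forall n \near \oo, V (Y (tau n) w) by [].
    by apply: filterS hn => n; apply; exact: (grid_in tau0 tau_lt tauT).
  exact: (continuous_cvg _ (@coord_continuous _ _ _ ord0 i (Y T w)) h1).
apply: continuous_rV => i.
have := delayed_continuous tau0 tau_lt tauT (Yl i).
rewrite (_ : delayed t T tau _ _ = fun s => delayed_path w s ord0 i); first exact.
by apply/funext => s; rewrite mxE.
Qed.

Section measurability.
Context d' (X : measurableType d').
Variables (phi : X -> measurableTypeR R) (om : X -> Omega).
Hypothesis mphi : measurable_fun setT phi.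
Hypothesis mY : forall n, measurable_fun setT (fun x => Y (tau n) (om x) : Rd R d).

Let mslope n : measurable_fun setT (fun x => delayed_slope n (om x) : Rd R d).
Proof.
apply: measurable_fun_rV => i; under eq_fun do rewrite !mxE.
apply: measurable_funM; first exact: measurable_cst.
by apply: measurable_funB; move: i; apply/measurable_fun_rVP; exact: mY.
Qed.

(** Time and outcome are arbitrary functions of a parameter, which covers joint measurability as
    well as measurability in time for a frozen outcome. *)
Lemma measurable_delayed_velocity :
  measurable_fun setT (fun x => delayed_velocity (om x) (phi x) : Rd R d).
Proof.
exact: (measurable_fun_grid tau0 tau_lt tauT (g := fun=> 0 : Rd R d) mphi mslope (measurable_cst _)).
Qed.

Lemma measurable_delayed_path : measurable_fun setT (fun x => Y T (om x) : Rd R d) ->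
  measurable_fun setT (fun x => delayed_path (om x) (phi x) : Rd R d).
Proof.
move=> /measurable_fun_rVP mYT; apply: measurable_fun_rV => i; under eq_fun do rewrite mxE.
have mYi n : measurable_fun setT (fun x => Y (tau n) (om x) ord0 i).
  by move: i; apply/measurable_fun_rVP; exact: mY.
apply: (measurable_fun_grid tau0 tau_lt tauT (f := fun n x =>
  Y (tau n.-1) (om x) ord0 i + (phi x - tau n) * ((tau n.+1 - tau n)^-1 *
    (Y (tau n) (om x) ord0 i - Y (tau n.-1) (om x) ord0 i))) mphi _ (mYT i)) => n.
apply: measurable_funD; first exact: mYi.
apply: measurable_funM; first by apply: measurable_funB; [exact: mphi|exact: measurable_cst].
by apply: measurable_funM; [exact: measurable_cst|apply: measurable_funB; exact: mYi].
Qed.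

End measurability.

Section adaptedness.
Variable F : R -> set (set Omega).
Hypotheses (t0 : 0 <= t) (hF : filtration F) (aY : adapted `[t, T] F Y).

Let mYs n s : tau n <= s ->
  measurable_fun [set: g_sigma_algebraType (F s)] (Y (tau n) : _ -> Rd R d).
Proof.
move=> ns; have tn : t <= tau n by rewrite -tau0 grid_le.
apply: (measurable_fun_filtration_le hF (le_trans t0 tn) ns); apply: aY.
exact: (grid_in tau0 tau_lt tauT).
Qed.

Let mslope n s : tau n <= s ->
  measurable_fun [set: g_sigma_algebraType (F s)] (delayed_slope n : _ -> Rd R d).
Proof.
move=> ns; have ns' : tau n.-1 <= s by rewrite (le_trans _ ns)// grid_le// leq_pred.
apply: measurable_fun_rV => i; under eq_fun do rewrite !mxE.
apply: measurable_funM; first exact: measurable_cst.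
by apply: measurable_funB; move: i; apply/measurable_fun_rVP; exact: mYs.
Qed.

Lemma adapted_delayed_velocity s :
  measurable_fun [set: g_sigma_algebraType (F s)] (delayed_velocity ^~ s : _ -> Rd R d).
Proof.
rewrite (_ : delayed_velocity ^~ s = if t <= s < T then delayed_slope (grid_index tau s)
  else fun=> 0); last by apply/funext => w; rewrite /delayed_velocity; case: ifP.
have [ts|_] := boolP (t <= s < T); last exact: measurable_cst.
by apply: mslope; have /andP[] := grid_indexP tau0 tau_lt tauT ts.
Qed.

(** In cell [n] the path reads [Y] only at [tau n.-1] and [tau n], both at most [s]; at time [T] it
    is [Y T]. *)
Lemma adapted_delayed_path s : s \in `[t, T] ->
  measurable_fun [set: g_sigma_algebraType (F s)] (delayed_path ^~ s : _ -> Rd R d).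
Proof.
move=> sD; have [ts|sT] := boolP (t <= s < T); last first.
  have -> : s = T.
    move: sD sT; rewrite in_itv/= => /andP[-> sT]; rewrite /= -leNgt => Ts.
    by apply/eqP; rewrite eq_le sT.
  rewrite (_ : delayed_path ^~ T = Y T); last by apply/funext => w; exact: delayed_path_end.
  by apply: aY; rewrite /= in_itv/= lexx -tau0 ltW// (grid_lt_end tau_lt tauT).
have /andP[ns sn] := grid_indexP tau0 tau_lt tauT ts; set n := grid_index tau s in ns sn.
have ns' : tau n.-1 <= s by rewrite (le_trans _ ns)// grid_le// leq_pred.
rewrite (_ : delayed_path ^~ s =
    fun w => Y (tau n.-1) w + (s - tau n) *: delayed_slope n w); last first.
  by apply/funext => w; apply: delayed_pathE; rewrite ns ltW.
apply: measurable_fun_rV => i; under eq_fun do rewrite mxE [X in _ + X]mxE.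
apply: measurable_funD; first by move: i; apply/measurable_fun_rVP; exact: mYs.
apply: measurable_funM; first exact: measurable_cst.
by move: i; apply/measurable_fun_rVP; exact: mslope.
Qed.

End adaptedness.

(** The integral of the squared speed over cell [n]: the squared slope brings the inverse square of
    the length, and the integration one power of it. *)
Definition delayed_energy (n : nat) (w : Omega) : \bar R :=
  ((tau n.+1 - tau n)^-1 * enorm (Y (tau n) w - Y (tau n.-1) w) ^+ 2)%:E.

Lemma integral_delayed_velocity_sqr w :
  (\int[leb]_(s in `[t, T]) (enorm (delayed_velocity w s) ^+ 2)%:E =
   \sum_(n <oo) delayed_energy n w)%E.
Proof.
have mav : measurable_fun [set: measurableTypeR R] (fun s => (enorm (delayed_velocity w s) ^+ 2)%:E).
  apply/measurable_EFinP; apply: measurable_funX; apply: (measurableT_comp measurable_enorm).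
  exact: (@measurable_delayed_velocity _ (measurableTypeR R) id (fun=> w)
    (@measurable_id _ _ _) (fun n => measurable_cst _)).
rewrite -integral_itv_bndo_bndc; last exact: measurable_funTS.
rewrite -(grid_bigcup tau0 tau_lt tauT) ge0_integral_bigcup//; last 3 first.
- exact: measurable_funTS.
- by move=> s _; rewrite lee_fin sqr_ge0.
- exact: grid_trivIset.
apply: eq_eseriesr => n _.
have gap : 0 < tau n.+1 - tau n by rewrite subr_gt0.
transitivity (\int[leb]_(s in `[tau n, tau n.+1[) (enorm (delayed_slope n w) ^+ 2)%:E)%E.
  by apply: eq_integral => s /set_mem/=; rewrite in_itv/= => /delayed_velocityE ->.
rewrite integral_cst//= lebesgue_measure_itv/= lte_fin tau_lt -EFinB -EFinM /delayed_energy.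
congr EFin; rewrite !enorm_sqr /delayed_slope.
under eq_bigr do rewrite mxE exprMn.
rewrite -mulr_sumr; set S := \sum_i _; field; by rewrite gt_eqF.
Qed.

End delayed_noise.

Section delayed_energy_finite.
Context {R : realType} {d : nat} {dO : measure_display} {Omega : measurableType dO}.
Variables (P : probability Omega R) (F : R -> set (set Omega)).
Variable B : R -> Omega -> 'rV[R]_d.
Hypotheses (hF : filtration F) (hB : brownian_motion P F B).
Variables (sigma : R -> R) (t T gamma C : R) (Y : R -> Omega -> 'rV[R]_d).
Hypotheses (t0 : 0 <= t) (tT : t < T) (gamma0 : 0 < gamma).
Hypothesis csigma : {within `[0, T[, continuous sigma}.
Hypothesis sigmaC : forall s, s \in `[0, T[ -> `|sigma s| <= C * (T - s) `^ gamma.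
Hypothesis C0 : 0 <= C.
Hypothesis mY : forall s, s \in `[t, T] -> measurable_fun [set: Omega] (Y s : _ -> Rd R d).
Hypothesis ito : forall a b, t <= a -> a <= b -> b <= T ->
  is_ito_integral P B sigma a b (fun w => Y b w - Y a w).
Local Notation tau := (dyadic t T).

Let tau_in n : tau n \in `[t, T].
Proof.
have cT : tau @ \oo --> T by exact: dyadic_cvg.
exact: (grid_in (dyadic0 t T) (dyadic_lt tT) cT n).
Qed.

Let mincr n : measurable_fun [set: Omega] (fun w => Y (tau n) w - Y (tau n.-1) w : Rd R d).
Proof.
apply: measurable_fun_rV => i; under eq_fun do rewrite !mxE.
by apply: measurable_funB; move: i; apply/measurable_fun_rVP; apply: mY; exact: tau_in.
Qed.

Lemma measurable_delayed_energy n : measurable_fun [set: Omega] (delayed_energy tau Y n).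
Proof.
apply/measurable_EFinP; apply: measurable_funM; first exact: measurable_cst.
by apply: measurable_funX; exact: (measurableT_comp measurable_enorm (mincr n)).
Qed.

Lemma delayed_energy_ge0 n w : (0 <= delayed_energy tau Y n w)%E.
Proof.
by rewrite lee_fin mulr_ge0 ?sqr_ge0// invr_ge0 subr_ge0 ltW// dyadic_lt.
Qed.

(** The second moment of the increment over cell n - 1 is at most 32 d M^2 times the length of that
    cell, which is at most twice the length of cell [n]; hence 64 in [D]. What remains is M^2, of
    geometric decay by [dyadic_rate_sqr]. *)
Lemma expected_delayed_energy_lty :
  (\int[P]_w \sum_(n <oo) delayed_energy tau Y n w < +oo)%E.
Proof.
rewrite integral_nneseries//; last 2 first.
- exact: measurable_delayed_energy.
- by move=> n w _; exact: delayed_energy_ge0.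
pose q := ((2^-1 : R) `^ gamma) ^+ 2.
pose D := 64 * d%:R * C ^+ 2 * ((2 * (T - t)) `^ gamma) ^+ 2.
have q01 : 0 <= q < 1.
  rewrite sqr_ge0/= expr_lt1 ?powR_ge0//.
  have p1 : (1 : R) `^ gamma = 1 by rewrite powR1.
  rewrite -[X in _ < X]p1 gt0_ltr_powR ?nnegrE//.
  by rewrite invf_lt1// ltr1n.
have D0 : 0 <= D by do 2![apply: mulr_ge0; last exact: sqr_ge0]; rewrite mulr_ge0.
apply: le_lt_trans (geometric_eseries_lty D0 q01); apply: lee_nneseries => n _.
  by move=> _; apply: integral_ge0 => w _; exact: delayed_energy_ge0.
have gap : 0 < tau n.+1 - tau n by rewrite subr_gt0 dyadic_lt.
rewrite /delayed_energy; under eq_integral do rewrite EFinM.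
rewrite ge0_integralZl//; last 3 first.
- apply/measurable_EFinP; apply: measurable_funX.
  exact: (measurableT_comp measurable_enorm (mincr n)).
- by move=> w _; rewrite lee_fin sqr_ge0.
- by rewrite lee_fin invr_ge0 ltW.
have tn : t <= tau n.-1 by have := tau_in n.-1; rewrite in_itv/= => /andP[].
have cT : tau @ \oo --> T by exact: dyadic_cvg.
have nT : tau n < T by exact: (grid_lt_end (dyadic_lt tT) cT).
have nn : tau n.-1 <= tau n by apply: (grid_le (dyadic_lt tT)); exact: leq_pred.
(* The rate decreases towards [T], so on the earlier cell it is largest at the left endpoint. *)
pose M := C * (T - tau n.-1) `^ gamma.
have sM r : r \in `[tau n.-1, tau n] -> `|sigma r| <= M.
  rewrite in_itv/= => /andP[r1 r2]; rewrite (le_trans (sigmaC _))//.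
    by rewrite in_itv/= (le_trans t0 (le_trans tn r1)) (le_lt_trans r2 nT).
  rewrite ler_wpM2l// ge0_ler_powR ?nnegrE ?subr_ge0 ?lerD2l ?lerN2//; first exact: ltW.
    by rewrite (le_trans r2)// ltW.
  by rewrite (le_trans nn)// ltW.
have ms : measurable_fun (`[tau n.-1, tau n]%classic : set (measurableTypeR R)) sigma.
  by apply: (continuous_subitv_measurable csigma) => //; exact: le_trans tn.
have := ito_integral_second_moment hF hB (le_trans t0 tn) nn ms sM (mincr n)
  (ito tn nn (ltW nT)).
move=> /(lee_wpmul2l (x := ((tau n.+1 - tau n)^-1)%:E)); rewrite lee_fin invr_ge0 (ltW gap).
move=> /(_ isT)/le_trans; apply; rewrite -EFinM lee_fin.
(* An equality for n >= 1, since lengths halve; for n = 0 the left side is 0. *)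
have gap2 : tau n - tau n.-1 <= 2 * (tau n.+1 - tau n).
  rewrite dyadic_gap; case: n {tn nT nn M sM ms gap} => [|n] /=.
    by rewrite subrr mulr_ge0// divr_ge0 ?exprn_ge0// subr_ge0 ltW.
  by rewrite dyadic_gap [in leRHS]exprS invfM mulrCA mulrA mulrA mulfK.
have rate := dyadic_rate_sqr tT n gamma0.
apply: (@le_trans _ _ (64 * d%:R * M ^+ 2)).
  rewrite ler_pdivrMl//.
  apply: (@le_trans _ _ (32 * d%:R * (M ^+ 2 * (2 * (tau n.+1 - tau n))))).
    by rewrite ler_wpM2l ?mulr_ge0// ler_wpM2l ?sqr_ge0.
  by rewrite le_eqVlt; apply/orP; left; apply/eqP; ring.
by rewrite /M exprMn /D -!mulrA !ler_wpM2l ?sqr_ge0// mulrA; exact: rate.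
Qed.

End delayed_energy_finite.

(** * The control and the bound on its cost *)

Theorem proposition3p8 (R : realType) (d : nat) (dO : measure_display)
    (Omega : measurableType dO) (P : probability Omega R)
    (F : R -> set (set Omega)) (B : R -> Omega -> 'rV[R]_d)
    (T : R) (nu : probability (Torus R d) R)
    (L : torus R d -> 'rV[R]_d -> R) (sigma : R -> R) (K gamma : R)
    (hd : (0 < d)%N)
    (hF : filtration F) (hB : brownian_motion P F B)
    (hT : 0 < T)
    (hL0 : forall x a, 0 <= L x a)
    (hL : exists2 C : R, 0 <= C &
       forall x a, L x a <= C * (1 + enorm a ^+ 2))
    (hsmooth : smooth_on `[0, T[ sigma)
    (hbounded : exists M : R, forall s, s \in `[0, T[ -> `|sigma s| <= M)
    (hK : K != 0) (hgamma : 0 < gamma)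
    (hsigma : sigma ~_(T^'-) (fun s => K * (T - s) `^ gamma))
    (t : R) (ht0 : 0 <= t) (htT : t < T)
    (mu : probability (Torus R d) R) (w0 : torus R d)
    (W : R -> Omega -> torus R d)
    (hW : diffusion_from P F B sigma t T w0 W) :
  (value P F L T nu W t mu < +oo)%E.
Proof.
have [C0 C00 hC] := hL; have [M0 sM0] := hbounded.
have [Cs Cs0 sigmaC] := powR_rate_bound hgamma sM0 hsigma.
have csigma := smooth_on_continuous hsmooth.
have [Y [aY cY ito Y0 hWY]] := hW.
pose tau := dyadic t T.
have tau0 : tau 0%N = t := dyadic0 t T.
have tau_lt : forall n, tau n < tau n.+1 := dyadic_lt htT.
have tauT : tau @ \oo --> T by exact: dyadic_cvg.
have tDT : (T : R) \in `[t, T] by rewrite in_itv/= lexx ltW.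
have tau_in n : tau n \in `[t, T] := grid_in tau0 tau_lt tauT n.
have mY s : s \in `[t, T] -> measurable_fun [set: Omega] (Y s : _ -> Rd R d).
  move=> sD; have /= := sD; rewrite in_itv/= => /andP[ts _].
  exact: (measurable_fun_filtration hF (le_trans ht0 ts) (aY s sD)).
pose Z := (Torus R d * Torus R d)%type.
pose Q : probability Z R := (mu \x nu)%E.
pose x0 (q : Z) : 'rV[R]_d := torus_rep q.1.
(* The displacement is taken between representatives in R^d. It brings the particle to y + w0 at
   time [T], the noise being left to [A]. *)
pose u (q : Z) : 'rV[R]_d := (T - t)^-1 *: (torus_rep q.2 + torus_rep w0 - torus_rep q.1).
have uE q i : u q ord0 i = (T - t)^-1 *
    (torus_rep q.2 ord0 i + torus_rep w0 ord0 i - torus_rep q.1 ord0 i) by rewrite !mxE.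
have mx0 : measurable_fun [set: Z] (x0 : Z -> Rd R d).
  exact: (measurableT_comp measurable_torus_rep (@measurable_fst _ _ _ _)).
have mu_ : measurable_fun [set: Z] (u : Z -> Rd R d).
  apply: measurable_fun_rV => i; under eq_fun do rewrite uE.
  have mr : measurable_fun [set: Torus R d] (fun x : Torus R d => torus_rep x ord0 i).
    by move: i; apply/measurable_fun_rVP; exact: measurable_torus_rep.
  apply: measurable_funM; first exact: measurable_cst.
  apply: measurable_funB; last exact: (measurableT_comp mr (@measurable_fst _ _ _ _)).
  apply: measurable_funD; last exact: measurable_cst.
  exact: (measurableT_comp mr (@measurable_snd _ _ _ _)).
(* All representatives have coordinates in [0, 1[, so the displacement has coordinates in ]-1,
   2[. *)
pose c := 2 / (T - t).
have Tt : 0 < T - t by rewrite subr_gt0.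
have uc z i : `|u z ord0 i| <= c.
  rewrite uE normrM gtr0_norm ?invr_gt0// mulrC ler_wpM2r ?invr_ge0 ?ltW//.
  have /andP[? ?] := torus_rep_itv z.1 i; have /andP[? ?] := torus_rep_itv z.2 i.
  by have /andP[? ?] := torus_rep_itv w0 i; rewrite ltr_norml; apply/andP; split; lra.
have [v [mv vc hv]] := exists_velocity Q htT mx0 mu_ uc.
pose A := delayed_path t T tau Y.
pose a := delayed_velocity t T tau Y.
pose m w s := flow Q t mx0 mu_ (A w) s.
pose psi w s x := dirac_velocity v (A w) (a w) s x.
pose energy w := (\sum_(n <oo) delayed_energy tau Y n w)%E.
have energy_lty : (\int[P]_w energy w < +oo)%E.
  exact: (expected_delayed_energy_lty hF hB ht0 htT hgamma csigma sigmaC Cs0 mY ito).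
have menergy : measurable_fun [set: Omega] energy.
  apply: (ge0_emeasurable_sum (P := xpredT)) => [n w _ _|n _].
    exact: delayed_energy_ge0.
  exact: (measurable_delayed_energy htT mY).
have energyE w := integral_delayed_velocity_sqr tau0 tau_lt tauT Y w.
have energy0 w : (0 <= energy w)%E.
  by apply: nneseries_ge0 => n _ _; exact: delayed_energy_ge0.
have ma w : measurable_fun [set: measurableTypeR R] (a w : _ -> Rd R d).
  exact: (@measurable_delayed_velocity _ _ _ _ _ _ _ tau0 tau_lt tauT Y _
    (measurableTypeR R) id (fun=> w) (@measurable_id _ _ _) (fun n => measurable_cst _)).
have ma2 w : measurable_fun [set: measurableTypeR R] (fun s => enorm (a w s) ^+ 2).
  by apply: measurable_funX; exact: (measurableT_comp measurable_enorm (ma w)).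
have ctrl : control P F T nu W t mu psi m.
  (* Used below with the two product spaces of [random_pair], and with time alone for a frozen
     outcome. *)
  have tX d' (X : measurableType d') (phi : X -> measurableTypeR R) (om : X -> Omega) :
      measurable_fun setT phi -> measurable_fun setT om ->
      measurable_fun setT (fun x => A (om x) (phi x) : Rd R d) /\
      measurable_fun setT (fun x => a (om x) (phi x) : Rd R d).
    move=> mphi mom; have mYom n : measurable_fun setT (fun x => Y (tau n) (om x) : Rd R d).
      exact: (measurableT_comp (mY _ (tau_in n)) mom).
    split; last exact: (measurable_delayed_velocity tau0 tau_lt tauT mphi mYom).
    apply: (measurable_delayed_path tau0 tau_lt tauT mphi mYom).
    exact: (measurableT_comp (mY _ tDT) mom).
  have aA s : s \in `[t, T] ->
      measurable_fun [set: g_sigma_algebraType (F s)] (A ^~ s : _ -> Rd R d).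
    exact: (adapted_delayed_path tau0 tau_lt tauT ht0 hF aY).
  have aa s : measurable_fun [set: g_sigma_algebraType (F s)] (a ^~ s : _ -> Rd R d).
    exact: (adapted_delayed_velocity tau0 tau_lt tauT ht0 hF aY).
  split.
  - split.
      apply: measurable_fun_dirac_comp; apply: measurable_funTS.
      have [m1 m2] := tX _ (Omega * (R * Torus R d))%type (fun p => p.2.1) fst
        (measurableT_comp (@measurable_fst _ _ _ _) (@measurable_snd _ _ _ _))
        (@measurable_fst _ _ _ _).
      have := measurable_velocity mv
        (measurableT_comp (@measurable_fst _ _ R (Torus R d)) (@measurable_snd _ _ Omega _))
        (measurableT_comp (@measurable_snd _ _ R (Torus R d)) (@measurable_snd _ _ Omega _))
        m1 m2.
      exact.
    apply: measurable_funTS.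
    have [m1 _] := tX _ (Omega * R)%type snd fst
        (@measurable_snd _ _ _ _) (@measurable_fst _ _ _ _).
    apply: (measurable_fun_law Q (g := fun p : Omega * R => pos t x0 u (A p.1) p.2)
      (fun p => measurable_pos t mx0 mu_ (A p.1) p.2)).
    have := measurable_shifted_pos t mx0 mu_
      (measurableT_comp (@measurable_snd _ _ Omega R) (@measurable_fst _ _ _ Z))
      (@measurable_snd _ _ (Omega * R)%type Z)
      (measurableT_comp m1 (@measurable_fst _ _ _ Z)).
    exact.
  - move=> s sD; split.
      apply: measurable_fun_dirac_comp.
      have := measurable_velocity mv
        (@measurable_cst _ _ (g_sigma_algebraType (F s) * Torus R d)%type (measurableTypeR R) setT s)
        (@measurable_snd _ _ (g_sigma_algebraType (F s)) (Torus R d))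
        (measurableT_comp (aA s sD) (@measurable_fst _ _ _ (Torus R d)))
        (measurableT_comp (aa s) (@measurable_fst _ _ _ (Torus R d))).
      exact.
    apply: (measurable_fun_law Q (T := g_sigma_algebraType (F s)) (g := fun w => pos t x0 u (A w) s)
      (fun w => measurable_pos t mx0 mu_ (A w) s)).
    have := measurable_shifted_pos t mx0 mu_
      (@measurable_cst _ _ (g_sigma_algebraType (F s) * Z)%type (measurableTypeR R) setT s)
      (@measurable_snd _ _ (g_sigma_algebraType (F s)) Z)
      (measurableT_comp (aA s sD) (@measurable_fst _ _ _ Z)).
    exact.
  (* The pair is admissible for each outcome such that [Y] is continuous, starts from 0 and has
     finite energy. The last condition holds a.s. because the energy has finite expectation. *)
  - have ae_energy : {ae P, forall w, (energy w < +oo)%E}.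
      have ie : P.-integrable [set: Omega] energy.
        apply/integrableP; split => //.
        by under eq_integral do rewrite gee0_abs//.
      apply: filterS (integrable_ae measurableT ie) => w /(_ I) wf.
      by rewrite ltey_eq wf.
    apply: filterS (filterI cY (filterI Y0 ae_energy)) => w [cw [Yw ew]].
    have [mAw maw] := tX _ (measurableTypeR R) id (fun=> w)
      (@measurable_id _ _ _) (@measurable_cst _ _ _ _ _ _).
    (* The final law itself serves as target here; its identification with the translate of [nu] is
       the last clause of [control]. *)
    exists (m w T); apply: (flow_admissible htT mx0 mu_ uc mv vc hv mAw maw
       (delayed_path_continuous tau0 tau_lt tauT cw) _ tau0 tau_lt tauT
       (delayed_path_affine tau0 tau_lt tauT Y w) (delayed_velocity_piece tau0 tau_lt tauT Y w)).
    (* Integrability of the slope follows from finite energy through |x| <= 1 + x^2, constants being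
       integrable on [t, T]. *)
    + move=> i; have i1 : lebesgue_measure.-integrable `[t, T] (EFin \o cst (1 : R)).
        by apply: integrable_cst_lty => //; rewrite /= lebesgue_measure_itv/= lte_fin htT -EFinB ltry.
      have i2 : lebesgue_measure.-integrable `[t, T] (EFin \o (fun s => enorm (a w s) ^+ 2)).
        apply/integrableP; split; first by apply/measurable_EFinP; exact: measurable_funTS.
        under eq_integral do rewrite /= ger0_norm ?sqr_ge0//.
        by rewrite energyE.
      have mitv : measurable (`[t, T]%classic : set (measurableTypeR R)) by exact: measurable_itv.
      have i3 : lebesgue_measure.-integrable `[t, T]
          (EFin \o (fun s => 1 + enorm (a w s) ^+ 2)) by exact: (integrable_EFinD mitv i1 i2).
      apply: (le_integrable mitv _ _ i3).
        apply/measurable_EFinP; apply: measurable_funTS.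
        by move: i; apply/measurable_fun_rVP; exact: ma.
      move=> s _ /=; rewrite lee_fin [leRHS]ger0_norm; last by rewrite addr_ge0 ?sqr_ge0.
      have : a w s ord0 i ^+ 2 <= enorm (a w s) ^+ 2.
        by rewrite enorm_sqr (bigD1 i)//= lerDl sumr_ge0// => j _; exact: sqr_ge0.
      rewrite -[a w s ord0 i ^+ 2]real_normK ?num_real//.
      by have := sqr_ge0 (`|a w s ord0 i| - 1); nra.
    (* As A_t = Y_t = 0, the initial position is the first coordinate, whose law under [Q] is
       [mu]. *)
    + move=> E mE; rewrite (_ : _ @^-1` E = E `*` [set: Torus R d]).
        transitivity (mu E * nu [set: Torus R d])%E.
          by rewrite [nu _]probability_setT mule1.
        by symmetry; exact: product_measure1E.
      apply/seteqP; split => z /=; rewrite /pos /base_pos subrr scale0r addr0.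
        by rewrite -{1}tau0 /A delayed_path_grid// tau0 Yw addr0 torus_repK.
      by rewrite -{1}tau0 /A delayed_path_grid// tau0 Yw addr0 torus_repK => -[].
    + by move=> E mE.
  - apply: filterS hWY => w /(_ T tDT) -> E mE.
    (* At time [T] the starting point cancels: the lift of the position is that of y plus that of w0
       plus [Y T w], so only the second coordinate, of law [nu], remains. *)
    have trE z : pos t x0 u (A w) T z = translate (translate (torus_proj (Y T w)) w0) z.2.
      rewrite -[w0 in RHS]torus_repK torus_projD -[z.2 in RHS]torus_repK torus_projD.
      rewrite /pos /base_pos /A delayed_path_end; congr torus_proj.
      rewrite /u scalerA mulfV ?gt_eqF// scale1r /x0.
      by rewrite addrC -!addrA; apply/rowP => i; rewrite !mxE; ring.
    rewrite /m /flow lawE (_ : _ @^-1` E =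
        [set: Torus R d] `*` (translate (translate (torus_proj (Y T w)) w0) @^-1` E)); last first.
      by apply/seteqP; split => z /=; rewrite trE => // -[].
    have mtr : measurable_fun [set: Torus R d]
        (translate (translate (torus_proj (Y T w)) w0) : Torus R d -> Torus R d).
      rewrite -[w0]torus_repK torus_projD.
      exact: (measurable_translate (@measurable_cst _ _ _ _ _ _) (@measurable_id _ _ _)).
    transitivity (mu [set: Torus R d] *
        nu (translate (translate (torus_proj (Y T w)) w0) @^-1` E))%E.
      apply: product_measure1E => //; rewrite -[X in measurable X]setTI; exact: mtr.
    by rewrite [mu _]probability_setT mul1e.
have cst_lty : (cost P L T t psi m < +oo)%E.
  (* The quadratic growth of [L] is applied to |v + a|^2 <= 2 |v|^2 + 2 |a|^2 with |v|^2 <= d c^2.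
     The part without [a] is a constant, and the other integrates in time to the energy. *)
  pose k1 := C0 * (1 + 2 * (d%:R * c ^+ 2)); pose k2 := 2 * C0.
  have k10 : 0 <= k1.
    apply: mulr_ge0 => //; apply: addr_ge0 => //.
    by apply: mulr_ge0 => //; apply: mulr_ge0 => //; exact: sqr_ge0.
  have k20 : 0 <= k2 by rewrite mulr_ge0.
  have bound w s x : (\int[psi w s x]_z (L x z)%:E <= (k1 * 1 + k2 * enorm (a w s) ^+ 2)%:E)%E.
    apply: (@le_trans _ _ (\int[psi w s x]_z (C0 * (1 + enorm (z : 'rV[R]_d) ^+ 2))%:E)%E).
      by apply: le_integral_ge0 => z _; rewrite lee_fin.
    rewrite integral_dirac//; last first.
      apply/measurable_EFinP; apply: measurable_funM => //; apply: measurable_funD => //.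
      by apply: measurable_funX; exact: measurable_enorm.
    rewrite diracT mul1e lee_fin.
    have := enorm_sqrD (v (s, translate (torus_proj (- A w s)) x)) (a w s).
    have : enorm (v (s, translate (torus_proj (- A w s)) x)) ^+ 2 <= d%:R * c ^+ 2.
      rewrite enorm_sqr; apply: (@le_trans _ _ (\sum_(i < d) c ^+ 2)).
        apply: ler_sum => i _; rewrite -real_normK ?num_real//.
        have c0 : 0 <= c := le_trans (normr_ge0 _) (vc (s, x) i).
        by rewrite lerXn2r ?nnegrE.
      by rewrite sumr_const card_ord -[leLHS]mulr_natl.
    rewrite /velocity /k1 /k2; set X := enorm (v _) ^+ 2; set V := enorm (a w s) ^+ 2.
    set N := enorm _ ^+ 2 => hX hN.
    rewrite [leRHS](_ : _ = C0 * (1 + (2 * (d%:R * c ^+ 2) + 2 * V))); last by ring.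
    by rewrite ler_wpM2l// lerD2l (le_trans hN)// lerD2r ler_wpM2l.
  apply: (@le_lt_trans _ _ (\int[P]_w ((k1 * (T - t))%:E + k2%:E * energy w))%E).
    apply: le_integral_ge0 => w _.
      by do 3![apply: integral_ge0 => ? _]; rewrite lee_fin.
    rewrite -[energy w]energyE (_ : (k1 * (T - t))%:E =
        k1%:E * \int[lebesgue_measure]_(s in `[t, T]) (1 : R)%:E)%E; last first.
      by rewrite integral_cst//= mul1e lebesgue_measure_itv/= lte_fin htT -EFinB EFinM.
    rewrite -(@ge0_integral_lin2 _ _ _ lebesgue_measure `[t, T]%classic k1 k2 (fun=> 1)
      (fun s => enorm (a w s) ^+ 2))//; [|exact: measurable_funTS|by move=> s; exact: sqr_ge0].
    apply: le_integral_ge0 => s _.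
      by do 2![apply: integral_ge0 => ? _]; rewrite lee_fin.
    rewrite -[leRHS](integral_probability_cst (m w s)).
    apply: le_integral_ge0 => x _; last exact: bound.
    by apply: integral_ge0 => z _; rewrite lee_fin.
  rewrite ge0_integralD//.
  - rewrite integral_probability_cst ge0_integralZl//.
    by rewrite lte_add_pinfty ?ltry// lte_mul_pinfty.
  - by move=> w _; rewrite lee_fin mulr_ge0// ltW.
  - by move=> w _; rewrite mule_ge0.
  - exact: measurable_funeM.
apply: le_lt_trans cst_lty; apply: ereal_inf_lbound.
by exists psi, m.
Qed.
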